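(* Let $\hat a$ be an admissible cutoff function (of type (a), (b) or (c)). Then for every $\sigma>0$ there exists a constant $c_\sigma$ depending on $\sigma$, $|\kappa|$ and $d$ such that for every integer $n\ge1$ the kernel $L_n^\kappa(x,y)=\sum_{j=0}^\infty\hat a(j/n)P_j(w_\kappa;x,y)$ satisfies $$|L_n^\kappa(x,y)|\le\frac{c_\sigma n^d}{\sqrt{W_\kappa(n;x)}\sqrt{W_\kappa(n;y)}}\big(1+n\rho(x,y)\big)^{-\sigma},\qquad x,y\in T^d.$$
   Context: $T^d=\{x\in\mathbb R^d:x_1,\dots,x_d\ge0,\ 1-|x|_1\ge0\}$, $|x|_1=x_1+\dots+x_d$, with weight $w_\kappa(x)=x_1^{\kappa_1-1/2}\cdots x_d^{\kappa_d-1/2}(1-|x|_1)^{\kappa_{d+1}-1/2}$, where $\kappa=(\kappa_1,\dots,\kappa_{d+1})$, $\kappa_i\ge0$, $|\kappa|=\kappa_1+\dots+\kappa_{d+1}$. $P_n(w_\kappa;x,y)$ is the kernel of the orthogonal projector of $L^2(T^d,w_\kappa)$ onto the space of polynomials of total degree $n$ orthogonal to all lower-degree polynomials: $(\mathrm{Proj}_nf)(x)=\int_{T^d}f(y)P_n(w_\kappa;x,y)w_\kappa(y)dy$. With $x_{d+1}:=1-|x|_1$, $y_{d+1}:=1-|y|_1$: $\rho(x,y)=\arccos\{\sqrt{x_1y_1}+\dots+\sqrt{x_{d+1}y_{d+1}}\}$ and $W_\kappa(n;x)=\prod_{i=1}^{d+1}(x_i+n^{-2})^{\kappa_i}$. Admissible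 cutoff functions: $\hat a\in C^\infty[0,\infty)$ of type (a): $\operatorname{supp}\hat a\subset[0,2]$, $\hat a=1$ on $[0,1]$; type (b): $\operatorname{supp}\hat a\subset[1/2,2]$; type (c): type (b) and $|\hat a(t)|^2+|\hat a(t/2)|^2=1$ on $[1,2]$. *)

(* Defs.v *)
From HB Require Import structures.
From mathcomp Require Import all_boot all_order all_algebra.
From mathcomp Require Import all_classical all_reals all_analysis.
Set Implicit Arguments. Unset Strict Implicit. Unset Printing Implicit Defensive.
Import Order.TTheory GRing.Theory Num.Theory.
Local Open Scope classical_set_scope.
Local Open Scope ring_scope.

Section Simplex.
Variable R : realType.

Definition l1 (d : nat) (x : d.-tuple R) : R := \sum_(i < d) tnth x i.

Definition Tsimplex (d : nat) : set (d.-tuple R) :=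
  [set x | (forall i : 'I_d, 0 <= tnth x i) /\ l1 x <= 1].

Definition xext (d : nat) (x : d.-tuple R) (i : 'I_d.+1) : R :=
  if (i < d)%N then nth 0 (x : seq R) i else 1 - l1 x.

Definition wkappa (d : nat) (kappa : 'I_d.+1 -> R) (x : d.-tuple R) : R :=
  \prod_(i < d.+1) (xext x i) `^ (kappa i - 2^-1).

Definition kabs (d : nat) (kappa : 'I_d.+1 -> R) : R := \sum_(i < d.+1) kappa i.

Definition Wkappa (d : nat) (kappa : 'I_d.+1 -> R) (n : nat) (x : d.-tuple R) : R :=
  \prod_(i < d.+1) (xext x i + (n%:R ^+ 2)^-1) `^ (kappa i).

Definition rho (d : nat) (x y : d.-tuple R) : R :=
  acos (\sum_(i < d.+1) Num.sqrt (xext x i * xext y i)).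

(* Lebesgue integral over T^d, written as iterated one-dimensional Lebesgue
   integrals: int_{T^d} f = int_0^1 int_0^{1-x_1} ... int_0^{1-x_1-...-x_{d-1}} f.
   [simplex_int k s f] integrates f over {x in R^k : x_i >= 0, |x|_1 <= s}. *)
Fixpoint simplex_int (k : nat) : R -> (k.-tuple R -> R) -> R :=
  match k return R -> (k.-tuple R -> R) -> R with
  | 0 => fun _ f => f [tuple]
  | k'.+1 => fun s f =>
      Rintegral lebesgue_measure `[0, s]%classic
        (fun t => simplex_int (s - t) (fun y : k'.-tuple R => f [tuple of t :: y]))
  end.

Definition int_T (d : nat) (f : d.-tuple R -> R) : R := simplex_int 1 f.

Definition ip (d : nat) (kappa : 'I_d.+1 -> R) (f g : d.-tuple R -> R) : R :=
  int_T (fun y => f y * g y * wkappa kappa y).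

Definition poly_le (d n : nat) (p : d.-tuple R -> R) : Prop :=
  exists s : seq (('I_d -> nat) * R),
    all (fun m => (\sum_(i < d) m.1 i <= n)%N) s /\
    forall x, p x = \sum_(m <- s) m.2 * \prod_(i < d) tnth x i ^+ m.1 i.

Definition in_Vn (d : nat) (kappa : 'I_d.+1 -> R) (n : nat) (f : d.-tuple R -> R) : Prop :=
  (exists p, poly_le n p /\ forall y, Tsimplex y -> f y = p y) /\
  (forall m q, (m < n)%N -> poly_le m q -> ip kappa f q = 0).

(* P is the kernel of the orthogonal projector Proj_n of L^2(T^d,w_kappa) onto V_n:
   for each x in T^d, P n x . lies in V_n and reproduces V_n, so that
   Proj_n f (x) = int_{T^d} f(y) P n x y w_kappa(y) dy. *)
Definition proj_kernel (d : nat) (kappa : 'I_d.+1 -> R)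
    (P : nat -> d.-tuple R -> d.-tuple R -> R) : Prop :=
  forall n x, Tsimplex x ->
    in_Vn kappa n (P n x) /\
    (forall f, in_Vn kappa n f -> ip kappa f (P n x) = f x).

Definition smooth_on_nonneg (a : R -> R) : Prop :=
  exists g : R -> R, (forall (k : nat) (t : R), derivable (derive1n k g) t 1) /\
                     (forall t, 0 <= t -> g t = a t).

Definition cutoff_a (a : R -> R) : Prop :=
  smooth_on_nonneg a /\ (forall t, 2 < t -> a t = 0) /\ (forall t, 0 <= t <= 1 -> a t = 1).

Definition cutoff_b (a : R -> R) : Prop :=
  smooth_on_nonneg a /\ (forall t, 0 <= t -> (t < 2^-1 \/ 2 < t) -> a t = 0).

Definition cutoff_c (a : R -> R) : Prop :=
  cutoff_b a /\ (forall t, 1 <= t <= 2 -> `|a t| ^+ 2 + `|a (t / 2)| ^+ 2 = 1).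

Definition admissible (a : R -> R) : Prop := cutoff_a a \/ cutoff_b a \/ cutoff_c a.

(* L_n(x,y) = sum_{j >= 0} a(j/n) P_j(x,y); the terms with j > 2n vanish since
   supp a is contained in [0,2], so the sum is finite. *)
Definition Lker (d : nat) (a : R -> R) (P : nat -> d.-tuple R -> d.-tuple R -> R)
    (n : nat) (x y : d.-tuple R) : R :=
  \sum_(0 <= j < (2 * n).+1) a (j%:R / n%:R) * P j x y.

End Simplex.

(* Main.v *)
(* [P_j(x,y)] is a [(d+1)]-fold average of a univariate polynomial: with
   [lam = |kappa| + (d-1)/2] and [Z_i = (i + lam)/lam C_i^lam],
     [P_j(x,y) = const * E Z_(2j)(sum_i t_i sqrt(x_i y_i))],
   where the [t_i] are independent with density proportional to
   [(1-t^2)^(kappa_i - 1)] ([t_i = +-1] with probability 1/2 if [kappa_i = 0]).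
   Here this is proved by comparing coefficients, and all averages are
   functionals on polynomials given by their moments.
   Hence [L_n(x,y)] is the same average of [M(z) = sum_i a(i/N) Z_i(z)],
   [N = 2n], the terms with [i] odd being annihilated.  The three-term recurrence
   turns multiplication of [M] by [1 - z] into a second-order difference operator on
   the coefficients, which gains [N^-2] on [a(i/N)]; so
   [|M(z)| (1 + N^2(1-z))^k <= C N^(2 lam + 1)] for every [k].
   Averaging over [t_i] costs finitely many powers of [1 + N^2(1-z)] and gains
   [(1 + N^2 sqrt(x_i y_i))^(-kappa_i)].  What remains at [z = cos rho(x,y)] is
   [(1 + n rho)^(-sigma)], and passing from [sqrt(x_i y_i)] to the product of
   [x_i + n^-2] and [y_i + n^-2] costs only powers of [1 + n rho]. *)

(* The constant is fixed before [kappa], from |kappa| alone, so every estimate must be uniform over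
   0 <= kappa_i <= |kappa|. This includes kappa_i = 0, where the density degenerates into two point
   masses, and lam = 0, where the usual Gegenbauer normalization breaks down. Moments and the factor
   (i + lam)/lam remove both exceptions. [P] is known only through orthogonality and reproduction on
   T^d; it is first identified there with an explicit kernel. The comparison of coefficients works
   because both sides contain the same series: the Dirichlet moments of the weight and the even
   moments of t_i, the latter divided by (2a)!, both produce the denominators a! (kappa_i + 1/2)_a.
   The powers balance as follows. Since 2 lam + 1 = 2|kappa| + d, the univariate bound is of size
   n^(2|kappa| + d). The factors gained by averaging, once compared with x_i + n^-2 and y_i + n^-2,
   contribute n^(-2|kappa|) and the two square roots of [Wkappa], which leaves n^d. *)
Require Import Defs.
From HB Require Import structures.
From mathcomp Require Import all_boot all_order all_algebra.
From mathcomp Require Import all_classical all_reals all_analysis.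
From mathcomp Require Import measurable_realfun ring lra zify.
Import Order.TTheory GRing.Theory Num.Theory.
Import numFieldNormedType.Exports.
Local Open Scope classical_set_scope.
Local Open Scope ring_scope.
Set Implicit Arguments. Unset Strict Implicit. Unset Printing Implicit Defensive.

(** * Beta integrals *)

Section BetaDensity.
Variable R : realType.
Notation mu := (@lebesgue_measure R).

(* Closed intervals exhausting ]0, s[: they keep the fundamental theorem of calculus
   away from the singular endpoints. *)
Definition inner_itv (s : R) (k : nat) : set R := `[s / k.+3%:R, s - s / k.+3%:R]%classic.

Lemma measurable_inner_itv (s : R) k : measurable (inner_itv s k : set R).
Proof. exact: measurable_itv. Qed.

Lemma inner_itv_ends (s : R) k : 0 < s ->
  [/\ 0 < s / k.+3%:R, s / k.+3%:R < s - s / k.+3%:R & s - s / k.+3%:R < s].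
Proof.
move=> s0; have h0 : 0 < s / k.+3%:R by rewrite divr_gt0.
(* The offset 3 exceeds 2, so the interval is nondegenerate already for [k = 0]. *)
have : s / k.+3%:R * 2 < s.
  by rewrite -mulrA gtr_pMr// mulrC ltr_pdivrMr// mul1r ltr_nat.
by move: (s / _) h0 => u u0 h; split; lra.
Qed.

Lemma inner_itv_sub (s : R) k : 0 < s -> inner_itv s k `<=` `]0, s[%classic.
Proof.
move=> s0 x; rewrite /inner_itv /= !in_itv/= => /andP[].
have [] := inner_itv_ends k s0; move: (s / _) => u h0 h1 h2 h3 h4.
by apply/andP; split; lra.
Qed.

Lemma nondecreasing_inner_itv (s : R) : 0 < s -> nondecreasing_seq (inner_itv s).
Proof.
move=> s0 m n mn; rewrite subsetEset => x; rewrite /inner_itv /= !in_itv/=.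
have : s / n.+3%:R <= s / m.+3%:R.
  by rewrite ler_pM2l// lef_pV2 ?posrE// ler_nat.
move: (s / _) (s / _) => u v h /andP[h1 h2]; apply/andP; split; lra.
Qed.

Lemma inner_itv_bigcup (s : R) : 0 < s -> \bigcup_k inner_itv s k = `]0, s[%classic.
Proof.
move=> s0; apply/seteqP; split=> x; first by move=> [k _]; exact: inner_itv_sub.
rewrite /= in_itv/= => /andP[x0 xs].
pose e := Num.min x (s - x).
have e0 : 0 < e by rewrite lt_min x0 subr_gt0.
exists (Num.trunc (s / e)) => //; rewrite /inner_itv/= in_itv/=.
have : s / (Num.trunc (s / e)).+3%:R <= e.
  rewrite ler_pdivrMr// mulrC -ler_pdivrMr//.
  by apply: (le_trans (ltW (truncnS_gt _))); rewrite ler_nat; do 2! apply: leqW.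
move: (s / _.+3%:R) => u; rewrite /e le_min => /andP[h1 h2].
by apply/andP; split; lra.
Qed.

Lemma cvg_div_natr3 (s : R) : s / k.+3%:R @[k --> \oo] --> 0.
Proof.
rewrite -(mulr0 s); apply: cvgMr.
have := @cvg_harmonic R; rewrite -(cvg_shiftn 2).
by apply: cvg_trans; apply: near_eq_cvg; near=> k; rewrite /harmonic /= addn2.
Unshelve. all: end_near. Qed.

Lemma within_inner_itv (s : R) k (h : R -> R) : 0 < s ->
  {in `]0, s[, continuous h} -> {within inner_itv s k, continuous h}.
Proof.
move=> s0 hc; apply: continuous_in_subspaceT => x /set_mem xs.
by apply: hc; exact: (inner_itv_sub s0 xs).
Qed.

Lemma cvg_integral_inner_itv (s : R) (h : R -> R) : 0 < s ->
  {in `]0, s[, continuous h} -> (forall t, t \in `]0, s[ -> 0 <= h t) ->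
  (\int[mu]_(t in inner_itv s k) (h t)%:E)%E @[k --> \oo] -->
  (\int[mu]_(t in `]0%R, s[) (h t)%:E)%E.
Proof.
move=> s0 hc h0; rewrite -inner_itv_bigcup//.
apply: ge0_nondecreasing_set_cvg_integral.
- exact: nondecreasing_inner_itv.
- by move=> i; exact: measurable_itv.
- move=> i; apply/measurable_EFinP; apply: subspace_continuous_measurable_fun; first exact: measurable_itv.
  exact: within_inner_itv.
- by move=> i x xi; rewrite lee_fin; apply: h0; apply: (inner_itv_sub s0 xi).
Qed.

Definition primitive (s : R) (h G : R -> R) : Prop :=
  forall t, t \in `]0, s[ -> is_derive t 1 G (h t).

Lemma FTC_inner_itv (s : R) k (h G : R -> R) : 0 < s ->
  {in `]0, s[, continuous h} ->
  primitive s h G ->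
  (\int[mu]_(t in inner_itv s k) (h t)%:E = (G (s - s / k.+3%:R) - G (s / k.+3%:R))%:E)%E.
Proof.
move=> s0 hc hG; have [h1 h2 h3] := inner_itv_ends k s0.
have Gc t : t \in `]0, s[ -> {for t, continuous G}.
  by move=> /hG ?; apply/differentiable_continuous/derivable1_diffP; apply: ex_derive.
have sub t : t \in `]s / k.+3%:R, s - s / k.+3%:R[ -> t \in `]0, s[.
  by rewrite !in_itv/= => /andP[a b]; apply/andP; split; [apply: lt_trans a|apply: lt_trans h3].
rewrite EFinB; apply: continuous_FTC2 => //.
- exact: within_inner_itv.
- split.
  + by move=> t /sub /hG H; apply: ex_derive.
  + by apply: cvg_at_right_filter; apply: Gc; rewrite in_itv/= h1 (lt_trans h2).
  + by apply: cvg_at_left_filter; apply: Gc; rewrite in_itv/= h3 (lt_trans h1).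
- by move=> t /sub /hG H; rewrite derive1E; apply: derive_val.
Qed.

Definition beta_dens (a b s t : R) : R := t `^ (a - 1) * (s - t) `^ (b - 1).

Lemma beta_dens_ge0 a b s t : 0 <= beta_dens a b s t.
Proof. by rewrite mulr_ge0// powR_ge0. Qed.

Lemma is_derive_powRl (a s t : R) : 0 < s - t ->
  is_derive t 1 (fun t => (s - t) `^ a) (- (a * (s - t) `^ (a - 1))).
Proof.
move=> st; have H := is_derive1_powR a st.
have H2 : is_derive t 1 (fun t : R => s - t) (-1).
  by apply: is_derive_eq; rewrite add0r mul1r.
by have := @is_derive1_comp _ (fun x => x `^ a) (fun t => s - t) _ _ _ H H2; rewrite mulrN1.
Qed.

Lemma is_derive_continuous (f : R -> R) (t df : R) :
  is_derive t 1 f df -> {for t, continuous f}.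
Proof. by move=> ?; apply/differentiable_continuous/derivable1_diffP; apply: ex_derive. Qed.

Lemma continuous_beta_dens a b s : {in `]0, s[, continuous (beta_dens a b s)}.
Proof.
move=> t; rewrite in_itv/= => /andP[t0 ts].
apply: (@continuousM _ _ (fun t => t `^ (a - 1)) (fun t => (s - t) `^ (b - 1))).
  exact: (is_derive_continuous (is_derive1_powR _ t0)).
by apply: (is_derive_continuous (is_derive_powRl _ _)); rewrite subr_gt0.
Qed.

Lemma powRS1 (t a : R) : 0 < t -> t `^ a = t * t `^ (a - 1).
Proof.
move=> t0; rewrite powRB ?(gt_eqF t0) ?implybT// powRr1 ?ltW// mulrCA divff ?mulr1//.
by rewrite gt_eqF.
Qed.

Definition ibeta (a b s : R) : \bar R := (\int[mu]_(t in `]0%R, s[) (beta_dens a b s t)%:E)%E.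

Lemma cvg_ibeta a b s : 0 < s ->
  (\int[mu]_(t in inner_itv s k) (beta_dens a b s t)%:E)%E @[k --> \oo] --> ibeta a b s.
Proof.
by move=> s0; apply: cvg_integral_inner_itv => // [|t _]; [exact: continuous_beta_dens|exact: beta_dens_ge0].
Qed.

Lemma ibeta1_lty a s : 0 < a -> 0 < s -> (ibeta a 1 s < +oo)%E.
Proof.
move=> a0 s0; apply: (@le_lt_trans _ _ (s `^ a / a)%:E); last exact: ltry.
apply: (cvge_to_le (@cvg_ibeta a 1 s s0)); near=> k.
rewrite (@FTC_inner_itv s k (beta_dens a 1 s) (fun t => t `^ a / a))//; last 2 first.
- exact: continuous_beta_dens.
- move=> t; rewrite in_itv/= => /andP[t0 ts].
  have H := is_derive1_powR a t0.
  apply: is_derive_eq.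
  by rewrite scaler0 add0r /GRing.scale /= mulrA mulVf ?gt_eqF// mul1r /beta_dens subrr powRr0 mulr1.
rewrite lee_fin -mulrBl ler_pM2r ?invr_gt0//.
have [h1 h2 h3] := inner_itv_ends k s0.
rewrite lerBlDr -[X in X <= _]addr0 lerD ?powR_ge0//.
by rewrite ge0_ler_powR ?nnegrE ?ltW// (lt_trans h1).
Unshelve. all: end_near. Qed.

Lemma ibetar1_lty b s : 0 < b -> 0 < s -> (ibeta 1 b s < +oo)%E.
Proof.
move=> a0 s0; apply: (@le_lt_trans _ _ (s `^ b / b)%:E); last exact: ltry.
apply: (cvge_to_le (@cvg_ibeta 1 b s s0)); near=> k.
rewrite (@FTC_inner_itv s k (beta_dens 1 b s) (fun t => - ((s - t) `^ b / b)))//; last 2 first.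
- exact: continuous_beta_dens.
- move=> t; rewrite in_itv/= => /andP[t0 ts].
  have ts' : 0 < s - t by rewrite subr_gt0.
  have H := is_derive_powRl b ts'.
  apply: is_derive_eq.
  rewrite scaler0 add0r -?scalerN /GRing.scale /= ?mulrN opprK mulrA mulVf ?gt_eqF//.
  by rewrite /beta_dens subrr powRr0.
rewrite lee_fin -opprD opprB -mulrBl ler_pM2r ?invr_gt0//.
have [h1 h2 h3] := inner_itv_ends k s0.
rewrite lerBlDr -[X in X <= _]addr0 lerD ?powR_ge0//.
by rewrite ge0_ler_powR ?nnegrE ?subr_ge0 ?lerBlDr ?lerDl ?ltW// (lt_trans h2).
Unshelve. all: end_near. Qed.

Lemma measurable_beta_dens a b s D : measurable D -> measurable_fun D (beta_dens a b s).
Proof.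
move=> mD; apply: measurable_funTS; apply: measurable_funM.
  exact: measurable_powR.
apply: (measurableT_comp (measurable_powR _)).
by apply: measurable_funB.
Qed.

(** On each half of the interval only one factor can be singular. For t <= s/2, from 1 <= (2/s)(s -
    t) one gets (s - t)^(b-1) <= (2/s) s^b, whatever the sign of b - 1; the other half is symmetric.
    This reduces to the cases with one parameter equal to 1, which have explicit primitives. *)
Lemma ibeta_lty a b s : 0 < a -> 0 < b -> 0 < s -> (ibeta a b s < +oo)%E.
Proof.
move=> a0 b0 s0.
have mbt u v : measurable_fun `]0%R, s[%classic (fun t => (beta_dens u v s t)%:E).
  by apply/measurable_EFinP; exact: measurable_beta_dens.
pose u := s `^ b * (2 / s); pose v := s `^ a * (2 / s).
have u0 : 0 <= u by rewrite mulr_ge0 ?powR_ge0 ?divr_ge0// ltW.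
have v0 : 0 <= v by rewrite mulr_ge0 ?powR_ge0 ?divr_ge0// ltW.
apply: (@le_lt_trans _ _ (u%:E * ibeta a 1 s + v%:E * ibeta 1 b s)%E); last first.
  by apply: lte_add_pinfty; apply: lte_mul_pinfty; rewrite ?lee_fin//; [exact: ibeta1_lty|exact: ibetar1_lty].
rewrite /ibeta -!ge0_integralZl_EFin//;
  try (by move=> t ?; rewrite lee_fin beta_dens_ge0); try exact: mbt.
have mu1 := measurable_funeM u%:E (mbt a 1); have mv1 := measurable_funeM v%:E (mbt 1 b).
have pos w c d t : 0 <= w -> `]0%R, s[%classic t -> (0 <= w%:E * (beta_dens c d s t)%:E)%E.
  by move=> w0 _; rewrite mule_ge0 ?lee_fin ?beta_dens_ge0.
rewrite -(@ge0_integralD _ _ _ mu _ (measurable_itv _) _ _ (pos _ _ _ ^~ u0) mu1 (pos _ _ _ ^~ v0) mv1).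
apply: ge0_le_integral => //.
- by move=> t _; rewrite lee_fin beta_dens_ge0.
- exact: mbt.
- exact: emeasurable_funD.
move=> t; rewrite /= in_itv/= => /andP[t0 ts].
rewrite -!EFinM -EFinD lee_fin.
have st : 0 < s - t by rewrite subr_gt0.
have st2 x : s / 2 <= x -> 1 <= 2 / s * x.
  by move=> h; rewrite mulrAC ler_pdivlMr// mul1r mulrC -ler_pdivrMr.
have [h|h] := leP t (s / 2).
  rewrite -[X in X <= _]addr0; apply: lerD; last exact: (mulr_ge0 v0 (beta_dens_ge0 _ _ _ _)).
  rewrite /beta_dens subrr powRr0 mulr1 mulrC ler_wpM2r ?powR_ge0//.
  have h2 : (s - t) `^ b <= s `^ b.
    by rewrite ge0_ler_powR ?nnegrE ?lerBlDr ?lerDl ?ltW.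
  rewrite /u -[X in X <= _]mul1r; apply: (@le_trans _ _ (2 / s * (s - t) * (s - t) `^ (b - 1))).
    by rewrite ler_wpM2r ?powR_ge0// st2//; lra.
  by rewrite -mulrA -powRS1// mulrC ler_wpM2r// divr_ge0// ltW.
rewrite -[X in X <= _]add0r; apply: lerD; first exact: (mulr_ge0 u0 (beta_dens_ge0 _ _ _ _)).
rewrite /beta_dens subrr powRr0 mul1r ler_wpM2r ?powR_ge0//.
have h2 : t `^ a <= s `^ a.
  by rewrite ge0_ler_powR ?nnegrE ?ltW.
rewrite /u -[X in X <= _]mul1r; apply: (@le_trans _ _ (2 / s * t * t `^ (a - 1))).
  by rewrite ler_wpM2r ?powR_ge0// st2// ltW.
by rewrite -mulrA -powRS1// mulrC ler_wpM2r// divr_ge0// ltW.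
Qed.

End BetaDensity.

(** * Values of the beta function *)

Section Beta.
Variable R : realType.
Notation mu := (@lebesgue_measure R).

Lemma derive1_mull (s : R) : ((fun x : R => s * x)^`() = cst s)%classic.
Proof.
apply/funext => x; rewrite derive1E.
have H : is_derive x 1 (fun x : R => s * x) (s *: 1) by apply: is_deriveZ.
by rewrite derive_val /GRing.scale /= mulr1.
Qed.

Lemma beta_dens_scale (a b s x : R) : 0 < s -> 0 < x < 1 ->
  beta_dens a b s (s * x) * s = s `^ (a + b - 1) * beta_dens a b 1 x.
Proof.
move=> s0 /andP[x0 x1]; have sn : s != 0 by rewrite gt_eqF.
have y0 : 0 < 1 - x by rewrite subr_gt0.
rewrite /beta_dens -{2}(mulr1 s) -mulrBr !powRM ?ltW//.
have -> : a + b - 1 = (a - 1) + (b - 1) + 1 by ring.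
rewrite (@powRD _ _ (a - 1 + (b - 1)) 1) ?sn ?implybT//.
rewrite (@powRD _ _ (a - 1) (b - 1)) ?sn ?implybT// powRr1 ?ltW//.
by ring.
Qed.

Lemma ibeta_scale (a b s : R) : 0 < s ->
  ibeta a b s = ((s `^ (a + b - 1))%:E * ibeta a b 1)%E.
Proof.
move=> s0; have := @cvg_ibeta _ a b s s0; set f := (X in X @ _ --> _).
have -> : f = fun k => ((s `^ (a + b - 1))%:E * \int[mu]_(t in inner_itv 1 k) (beta_dens a b 1 t)%:E)%E.
  apply/funext => k; rewrite /f.
  have [h1 h2 h3] := @inner_itv_ends R 1 k ltr01.
  have -> : inner_itv s k = `[s * (1 / k.+3%:R), s * (1 - 1 / k.+3%:R)]%classic.
    by rewrite /inner_itv mul1r mulrBr mulr1.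
  have HH := @integration_by_substitution_increasing _ (fun x => s * x) (beta_dens a b s) (1 / k.+3%:R) (1 - 1 / k.+3%:R).
  have dl (x : R) : derivable (fun x => s * x) x 1.
    by have H : is_derive x 1 (fun x : R => s * x) (s *: 1) by apply: is_deriveZ.
  rewrite HH.
  - rewrite -ge0_integralZl_EFin ?powR_ge0//.
    + apply: eq_integral => x /set_mem/(inner_itv_sub ltr01).
      rewrite /= in_itv /= => x01.
      by rewrite derive1_mull -EFinM -beta_dens_scale.
    + exact: measurable_itv.
    + by move=> t _; rewrite lee_fin beta_dens_ge0.
    + apply/measurable_EFinP; apply: measurable_beta_dens; exact: measurable_inner_itv.
  - exact: ltW.
  - by move=> x y _ _; rewrite ltr_pM2l.
  - by rewrite derive1_mull => x _; exact: cvg_cst.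
  - by rewrite derive1_mull; exact: is_cvg_cst.
  - by rewrite derive1_mull; exact: is_cvg_cst.
  - split.
    + by move=> x _.
    + by apply: cvg_at_right_filter; apply: differentiable_continuous; apply/derivable1_diffP.
    + by apply: cvg_at_left_filter; apply: differentiable_continuous; apply/derivable1_diffP.
  - have -> : `[s * (1 / k.+3%:R), s * (1 - 1 / k.+3%:R)]%classic = inner_itv s k.
      by rewrite /inner_itv mul1r mulrBr mulr1.
    by apply: within_inner_itv => //; exact: continuous_beta_dens.
move=> h; apply: (cvg_unique _ h) => //.
apply: cvgeZl => //.
exact: cvg_ibeta.
Qed.

Lemma ibeta_ge0 (a b s : R) : (0 <= ibeta a b s)%E.
Proof. by apply: integral_ge0 => t _; rewrite lee_fin beta_dens_ge0. Qed.

Lemma ibeta_fin (a b s : R) : 0 < a -> 0 < b -> 0 < s -> ibeta a b s \is a fin_num.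
Proof. by move=> *; rewrite ge0_fin_numE ?ibeta_ge0// ibeta_lty. Qed.

Lemma beta_dens_integrable_oo (a b s : R) : 0 < a -> 0 < b -> 0 < s ->
  mu.-integrable `]0, s[ (EFin \o beta_dens a b s).
Proof.
move=> a0 b0 s0; apply/integrableP; split.
  by apply/measurable_EFinP; apply: measurable_beta_dens; exact: measurable_itv.
under eq_integral do rewrite /= ger0_norm ?beta_dens_ge0//.
exact: ibeta_lty.
Qed.

Lemma beta_dens_integrable (a b s : R) : 0 < a -> 0 < b -> 0 < s ->
  mu.-integrable `[0, s] (EFin \o beta_dens a b s).
Proof.
move=> a0 b0 s0; have m : measurable_fun setT (EFin \o beta_dens a b s).
  by apply/measurable_EFinP; apply: measurable_beta_dens; exact: measurableT.
apply/integrableP; split; first exact: measurable_funTS.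
under eq_integral do rewrite /= ger0_norm ?beta_dens_ge0//.
rewrite -integral_itv_bndo_bndc; last exact: measurable_funTS.
rewrite -integral_itv_obnd_cbnd; last exact: measurable_funTS.
exact: ibeta_lty.
Qed.

Definition beta (a b : R) : R := fine (ibeta a b 1).

Lemma Rintegral_beta_dens (a b s : R) : 0 < a -> 0 < b -> 0 < s ->
  \int[mu]_(t in `[0, s]) beta_dens a b s t = s `^ (a + b - 1) * beta a b.
Proof.
move=> a0 b0 s0; have m : measurable_fun setT (EFin \o beta_dens a b s).
  by apply/measurable_EFinP; apply: measurable_beta_dens; exact: measurableT.
rewrite /Rintegral -integral_itv_bndo_bndc; last exact: measurable_funTS.
rewrite -integral_itv_obnd_cbnd; last exact: measurable_funTS.
by rewrite -/(ibeta a b s) ibeta_scale// fineM// ?ibeta_fin.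
Qed.

Lemma beta_ge0 (a b : R) : 0 <= beta a b.
Proof. by rewrite fine_ge0// ibeta_ge0. Qed.

Lemma beta_add (a b : R) : 0 < a -> 0 < b ->
  beta a b = beta (a + 1) b + beta a (b + 1).
Proof.
move=> a0 b0; have a1 : 0 < a + 1 by lra. have b1 : 0 < b + 1 by lra.
rewrite /beta -fineD ?ibeta_fin//; congr fine.
rewrite /ibeta -ge0_integralD//=; last first.
- by apply/measurable_EFinP; apply: measurable_beta_dens; exact: measurable_itv.
- by move=> t _; rewrite lee_fin beta_dens_ge0.
- by apply/measurable_EFinP; apply: measurable_beta_dens; exact: measurable_itv.
- by move=> t _; rewrite lee_fin beta_dens_ge0.
apply: eq_integral => t; rewrite inE/= in_itv/= => /andP[t0 t1].
rewrite -EFinD; congr EFin; rewrite /beta_dens !addrK.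
have h : 0 < 1 - t by rewrite subr_gt0.
by rewrite (@powRS1 _ t a)// (@powRS1 _ (1 - t) b)//; ring.
Qed.

(** Integrates the derivative of t^a (1-t)^b, which vanishes at both ends. Together with [beta_add]
    this determines the effect of integer shifts without the Gamma function. *)
Lemma beta_parts (a b : R) : 0 < a -> 0 < b ->
  a * beta a (b + 1) = b * beta (a + 1) b.
Proof.
move=> a0 b0; have a1 : 0 < a + 1 by lra. have b1 : 0 < b + 1 by lra.
pose G (t : R) := t `^ a * (1 - t) `^ b.
have prim : primitive 1 (fun t => a * beta_dens a (b + 1) 1 t - b * beta_dens (a + 1) b 1 t) G.
  move=> t; rewrite in_itv/= => /andP[t0 t1].
  have t1' : 0 < 1 - t by rewrite subr_gt0.
  have H1 := is_derive1_powR a t0; have H2 := is_derive_powRl b t1'.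
  have H3 := is_deriveM H1 H2; apply: is_derive_eq.
  by rewrite /beta_dens !addrK /GRing.scale /=; ring.
have cb c u v : {in `]0, 1[, continuous (fun t => c * beta_dens u v 1 t)}.
  move=> t t1; apply: (@continuousM _ _ (fun=> c)); first exact: cst_continuous.
  exact: continuous_beta_dens.
pose I u v k := \int[mu]_(t in inner_itv 1 k) beta_dens u v 1 t.
have E k : a * I a (b + 1) k = b * I (a + 1) b k + (G (1 - 1 / k.+3%:R) - G (1 / k.+3%:R)).
  have mk := @measurable_inner_itv R 1 k.
  have ik u v : 0 < u -> 0 < v -> mu.-integrable (inner_itv 1 k) (EFin \o beta_dens u v 1).
    move=> u0 v0; apply: (@integrableS _ _ _ mu `]0%R, 1[%classic) => //.
    - exact: inner_itv_sub.
    - exact: beta_dens_integrable_oo.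
  have ikZ c u v : 0 < u -> 0 < v -> mu.-integrable (inner_itv 1 k) (EFin \o (fun t => c * beta_dens u v 1 t)).
    move=> u0 v0; rewrite (_ : _ \o _ = (fun t => c%:E * (EFin \o beta_dens u v 1) t)%E)//.
    exact: integrableZl (ik _ _ u0 v0).
  rewrite /I -(@RintegralZl _ _ _ mu _ _ a mk (ik _ _ a0 b1)) -(@RintegralZl _ _ _ mu _ _ b mk (ik _ _ a1 b0)).
  have -> : G (1 - 1 / k.+3%:R) - G (1 / k.+3%:R) =
      \int[mu]_(t in inner_itv 1 k) (a * beta_dens a (b + 1) 1 t - b * beta_dens (a + 1) b 1 t).
    rewrite /Rintegral (FTC_inner_itv k ltr01 _ prim)// => t t1.
    apply: (@continuousB _ _ _ (fun t => a * _) (fun t => b * _)); exact: cb.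
  rewrite (@RintegralB _ _ _ mu _ _ _ mk (ikZ _ _ _ a0 b1) (ikZ _ _ _ a1 b0)).
  by rewrite [RHS]addrC subrK.
have G0 : (G (1 - 1 / k.+3%:R) - G (1 / k.+3%:R)) @[k --> \oo] --> (0 : R).
  have P c : 0 < c -> (1 / k.+3%:R) `^ c @[k --> \oo] --> (0 : R).
    move=> c0; have /cvg_at_rightP := powR_cvg0 c0; apply.
    by split=> [n|]; [rewrite divr_gt0|exact: cvg_div_natr3].
  have Pab : ((1 / k.+3%:R) `^ a + (1 / k.+3%:R) `^ b) @[k --> \oo] --> (0 : R).
    by rewrite -(addr0 0); apply: cvgD; exact: P.
  apply/cvgr0Pnorm_le => e e0; move/cvgr0Pnorm_le : Pab => /(_ e e0).
  apply: filterS => k; apply: le_trans.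
  have [h1 h2 h3] := @inner_itv_ends R 1 k ltr01.
  move: (1 / k.+3%:R) h1 h2 h3 => u h1 h2 h3.
  rewrite [X in _ <= X]ger0_norm ?addr_ge0 ?powR_ge0// /G subKr.
  have Q (x c : R) : 0 < c -> 0 <= x -> x <= 1 -> x `^ c <= 1.
    move=> c0 x0 x1; have -> : 1 = 1 `^ c :> R by rewrite powR1.
    by rewrite ge0_ler_powR ?nnegrE// ltW.
  rewrite (le_trans (ler_normB _ _))//.
  rewrite !ger0_norm ?mulr_ge0 ?powR_ge0// [X in X <= _]addrC lerD//.
    by rewrite ler_piMr ?powR_ge0// Q//; lra.
  by rewrite ler_piMl ?powR_ge0// Q//; lra.
have L u v : 0 < u -> 0 < v -> I u v k @[k --> \oo] --> beta u v.
  move=> u0 v0; apply: fine_cvg; rewrite fineK ?ibeta_fin//.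
  exact: cvg_ibeta.
have L1 : a * I a (b + 1) k @[k --> \oo] --> a * beta a (b + 1).
  by apply: cvgMr; exact: L.
have L2 : (b * I (a + 1) b k + (G (1 - 1 / k.+3%:R) - G (1 / k.+3%:R))) @[k --> \oo]
    --> b * beta (a + 1) b + 0.
  by apply: cvgD; [apply: cvgMr; exact: L|exact: G0].
have := E => /funext E'; rewrite E' in L1.
by have := cvg_unique _ L1 L2; rewrite addr0; apply.
Qed.

Definition poch (c : R) n : R := \prod_(i < n) (c + i%:R).

Lemma poch0 c : poch c 0 = 1.
Proof. by rewrite /poch big_ord0. Qed.

Lemma pochS c n : poch c n.+1 = poch c n * (c + n%:R).
Proof. by rewrite /poch big_ord_recr. Qed.

Lemma pochSl c n : poch c n.+1 = c * poch (c + 1) n.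
Proof.
rewrite /poch big_ord_recl addr0; congr (_ * _); apply: eq_bigr => i _.
by rewrite lift0 -nat1r addrA.
Qed.

Lemma pochD c m n : poch c (m + n) = poch c m * poch (c + m%:R) n.
Proof.
elim: n => [|n IH]; first by rewrite addn0 poch0 mulr1.
by rewrite addnS !pochS IH natrD; ring.
Qed.

Lemma poch_gt0 c n : 0 < c -> 0 < poch c n.
Proof. by move=> c0; apply: prodr_gt0 => i _; rewrite ltr_pwDl. Qed.

Lemma betaSl (a b : R) : 0 < a -> 0 < b -> beta (a + 1) b = beta a b * (a / (a + b)).
Proof.
move=> a0 b0; have h := beta_parts a0 b0; have h2 := beta_add a0 b0.
by have : a + b != 0; [rewrite gt_eqF// addr_gt0|move=> ab; rewrite h2; field: h].
Qed.

Lemma betaSr (a b : R) : 0 < a -> 0 < b -> beta a (b + 1) = beta a b * (b / (a + b)).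
Proof.
move=> a0 b0; have h := beta_parts a0 b0; have h2 := beta_add a0 b0.
by have : a + b != 0; [rewrite gt_eqF// addr_gt0|move=> ab; rewrite h2; field: h].
Qed.

Lemma beta_poch (a b : R) m n : 0 < a -> 0 < b ->
  beta (a + m%:R) (b + n%:R) = beta a b * (poch a m * poch b n / poch (a + b) (m + n)).
Proof.
move=> a0 b0; elim: n => [|n IH].
  elim: m => [|m IH]; first by rewrite !addr0 !poch0 mul1r divr1 mulr1.
  rewrite -natr1 addrA betaSl ?IH ?addr0 ?addn0//; last by rewrite ltr_pwDl.
  rewrite !pochS; have := poch_gt0 m (addr_gt0 a0 b0).
  have : 0 < a + b + m%:R by rewrite ltr_pwDl// addr_gt0.
  by move=> h1 h2; field; rewrite !gt_eqF.
rewrite -natr1 addrA betaSr ?IH; [|by rewrite ltr_pwDl..].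
rewrite addnS !pochS natrD; have := poch_gt0 (m + n) (addr_gt0 a0 b0).
have : 0 < a + b + (m%:R + n%:R) by rewrite ltr_pwDl// ?addr_gt0// addr_ge0.
move=> h1 h2; have h3 : 0 < a + m%:R + (b + n%:R) by rewrite addrACA.
by field; rewrite !gt_eqF.
Qed.

Lemma beta11 : beta 1 1 = 1.
Proof.
rewrite /beta /ibeta (eq_integral (fun=> 1%E)); last first.
  by move=> t _; rewrite /beta_dens subrr !powRr0 mulr1.
rewrite integral_cst//= ?lebesgue_measure_itv/= ?lte01 ?mul1e ?oppr0 ?adde0//.
Qed.

Lemma beta_le (a b a' b' : R) : 0 < a -> 0 < b -> a <= a' -> b <= b' ->
  beta a' b' <= beta a b.
Proof.
move=> a0 b0 aa bb; have a0' := lt_le_trans a0 aa; have b0' := lt_le_trans b0 bb.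
apply: fine_le; rewrite ?ibeta_fin//.
apply: ge0_le_integral => //.
- by move=> t _; rewrite lee_fin beta_dens_ge0.
- by apply/measurable_EFinP; apply: measurable_beta_dens; exact: measurable_itv.
- by apply/measurable_EFinP; apply: measurable_beta_dens; exact: measurable_itv.
move=> t; rewrite /= in_itv/= => /andP[t0 t1]; rewrite lee_fin.
have t0' : 0 < t <= 1 by rewrite t0 ltW.
have t1' : 0 < 1 - t <= 1 by apply/andP; split; lra.
by apply: ler_pM; rewrite ?powR_ge0// ger_powR// lerD2r.
Qed.

(** By monotonicity it suffices to raise both parameters to integers, where the value is explicit
    from [beta11]. *)
Lemma beta_gt0 (a b : R) : 0 < a -> 0 < b -> 0 < beta a b.
Proof.
move=> a0 b0.
have u (c : R) : c <= 1 + (Num.trunc c).+1%:R.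
  by rewrite (le_trans (ltW (truncnS_gt c)))// lerDr.
apply: (lt_le_trans _ (beta_le a0 b0 (u a) (u b))).
by rewrite beta_poch// beta11 mul1r divr_gt0// ?mulr_gt0// poch_gt0.
Qed.

End Beta.

(** * Dirichlet integrals over the simplex *)

Section Dirichlet.
Variable R : realType.
Notation mu := (@lebesgue_measure R).

(** Drops the endpoint [t = s]: the remaining simplex of size [s - t] is degenerate there, and the
    induction over the dimension needs a positive size. *)
Lemma eq_Rintegral_co (s : R) (f g : R -> R) : 0 < s ->
  measurable_fun setT g -> (forall t, 0 <= t < s -> f t = g t) ->
  \int[mu]_(t in `[0, s]) f t = \int[mu]_(t in `[0, s]) g t.
Proof.
move=> s0 mg fg; rewrite /Rintegral.
have fg' : {in `[0, s[%classic, (fun t => (f t)%:E) =1 (fun t => (g t)%:E)}.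
  by move=> t /set_mem; rewrite /= in_itv/= => h; rewrite fg.
have mg' : measurable_fun `[0, s[%classic (fun t => (g t)%:E).
  by apply/measurable_EFinP; exact: measurable_funTS.
rewrite -!integral_itv_bndo_bndc//; first by congr fine; exact: eq_integral.
by apply: eq_measurable_fun mg' => t ts; rewrite fg'.
Qed.

Lemma integrable_sum (T : Type) (D : set R) (L : seq T) (C : T -> R) (F : T -> R -> R) :
  measurable D -> (forall e, mu.-integrable D (EFin \o F e)) ->
  mu.-integrable D (EFin \o (fun t => \sum_(e <- L) C e * F e t)).
Proof.
move=> mD iF; elim: L => [|e L IH].
  rewrite (_ : _ \o _ = cst 0%E); first exact: integrable0.
  by apply/funext => t /=; rewrite big_nil.
rewrite (_ : _ \o _ = (fun t => (C e)%:E * (EFin \o F e) t)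
    \+ (EFin \o (fun t => (\sum_(e <- L) C e * F e t)%R)))%E.
  by apply: integrableD => //; exact: integrableZl.
by apply/funext => t /=; rewrite big_cons EFinD.
Qed.

Lemma Rintegral_sum (T : Type) (D : set R) (L : seq T) (C : T -> R) (F : T -> R -> R) :
  measurable D -> (forall e, mu.-integrable D (EFin \o F e)) ->
  \int[mu]_(t in D) (\sum_(e <- L) C e * F e t) =
  \sum_(e <- L) C e * \int[mu]_(t in D) F e t.
Proof.
move=> mD iF; elim: L => [|e L IH].
  under eq_Rintegral do rewrite big_nil.
  by rewrite big_nil /Rintegral integral0.
under eq_Rintegral do rewrite big_cons.
rewrite big_cons -IH -(@RintegralZl _ _ _ mu _ _ (C e) mD (iF e)).
apply: RintegralD => //; last exact: integrable_sum.
rewrite (_ : _ \o _ = (fun t => (C e)%:E * (EFin \o F e) t)%E)//.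
exact: integrableZl.
Qed.

Definition dirichlet_dens k (a : nat -> R) (b s : R) (y : k.-tuple R) : R :=
  (\prod_(i < k) tnth y i `^ (a i - 1)) * (s - l1 y) `^ (b - 1).

(** The integral of [dirichlet_dens] over the unit simplex: integrating out all variables but the
    first leaves a power of 1 - t, hence a beta value. Indexing the parameters by [nat] makes the
    recursion a mere shift. *)
Fixpoint dirichlet k (a : nat -> R) (b : R) : R :=
  if k is k'.+1 then
    beta (a 0%N) (\sum_(i < k') a i.+1 + b) * dirichlet k' (fun i => a i.+1) b
  else 1.

Lemma l1_cons k (t : R) (y : k.-tuple R) : l1 [tuple of t :: y] = t + l1 y.
Proof.
rewrite /l1 big_ord_recl tnth0; congr (_ + _); apply: eq_bigr => i _.
by rewrite tnthS.
Qed.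

Lemma dirichlet_dens_cons k a b s t (y : k.-tuple R) :
  dirichlet_dens a b s [tuple of t :: y] =
  t `^ (a 0%N - 1) * dirichlet_dens (fun i => a i.+1) b (s - t) y.
Proof.
rewrite /dirichlet_dens big_ord_recl tnth0 l1_cons opprD addrA -mulrA; congr (_ * (_ * _)).
by apply: eq_bigr => i _; rewrite tnthS.
Qed.

(** Stated for linear combinations because [simplex_int] is linear only where the inner integrals
    converge; carrying the sum through the induction keeps every integrand a combination of
    integrable beta densities. *)
Lemma simplex_int_dirichlet_dens (T : Type) (L : seq T) k (C : T -> R) (a : T -> nat -> R) (b : T -> R) s :
  0 < s -> (forall e i, 0 < a e i) -> (forall e, 0 < b e) ->
  simplex_int s (fun y : k.-tuple R => \sum_(e <- L) C e * dirichlet_dens (a e) (b e) s y) =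
  \sum_(e <- L) C e * (s `^ (\sum_(i < k) a e i + b e - 1) * dirichlet k (a e) (b e)).
Proof.
elim: k C a s => [|k IH] C a s s0 a0 b0 /=.
  apply: eq_bigr => e _.
  by rewrite /dirichlet_dens /l1 !big_ord0 mul1r subr0 mulr1 add0r.
pose S e := \sum_(i < k) a e i.+1 + b e.
have S0 e : 0 < S e by rewrite ltr_wpDl// sumr_ge0// => i _; rewrite ltW.
pose D e := dirichlet k (fun i => a e i.+1) (b e).
rewrite (@eq_Rintegral_co s _ (fun t => \sum_(e <- L) C e * D e * beta_dens (a e 0%N) (S e) s t)) //.
- rewrite (@Rintegral_sum _ _ _ (fun e => C e * D e)); last 2 first.
  + exact: measurable_itv.
  + by move=> e; exact: beta_dens_integrable.
  apply: eq_bigr => e _; rewrite Rintegral_beta_dens//.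
  have -> : a e 0%N + S e = \sum_(i < k.+1) a e i + b e by rewrite big_ord_recl addrA.
  by rewrite -/(D e) -/(S e); ring.
- apply: measurable_sum => e; apply: measurable_funM; first exact: measurable_cst.
  by apply: measurable_beta_dens; exact: measurableT.
move=> t /andP[t0 ts].
rewrite [X in simplex_int _ X](_ : _ = fun y : k.-tuple R =>
    \sum_(e <- L) C e * t `^ (a e 0%N - 1) * dirichlet_dens (fun i => a e i.+1) (b e) (s - t) y).
  rewrite (IH (fun e => _)) ?subr_gt0//; apply: eq_bigr => e _.
  by rewrite /beta_dens -/(S e) -/(D e); ring.
by apply/funext => y; apply: eq_bigr => e _; rewrite dirichlet_dens_cons mulrA.
Qed.

Lemma eq_simplex_int k s (f g : k.-tuple R -> R) : 0 <= s ->
  (forall y, (forall i, 0 <= tnth y i) -> l1 y <= s -> f y = g y) ->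
  simplex_int s f = simplex_int s g.
Proof.
elim: k s f g => [|k IH] s f g s0 fg /=.
  by apply: fg => [[]//|]; rewrite /l1 big_ord0.
apply: eq_Rintegral => t /set_mem; rewrite /= in_itv/= => /andP[t0 ts].
apply: IH => [|y y0 ys]; first by rewrite subr_ge0.
apply: fg; last by rewrite l1_cons; lra.
by move=> i; case: (unliftP ord0 i) => [j ->|->]; rewrite ?tnthS ?tnth0.
Qed.

Lemma dirichlet_gt0 k a b : (forall i, 0 < a i) -> 0 < b -> 0 < dirichlet k a b.
Proof.
elim: k a => [|k IH] a a0 b0 //=; rewrite mulr_gt0 ?IH// beta_gt0//.
by rewrite ltr_wpDl// sumr_ge0// => i _; rewrite ltW.
Qed.

(** Integer shifts of the parameters amount to multiplying the density by a monomial, so this gives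
    all moments. *)
Lemma dirichlet_poch k a b (e : nat -> nat) f : (forall i, 0 < a i) -> 0 < b ->
  dirichlet k (fun i => a i + (e i)%:R) (b + f%:R) =
  dirichlet k a b * ((\prod_(i < k) poch (a i) (e i)) * poch b f /
    poch (\sum_(i < k) a i + b) (\sum_(i < k) e i + f)).
Proof.
elim: k a e => [|k IH] a e a0 b0 /=.
  by rewrite !big_ord0 add0r add0n !mul1r divff ?mulr1// gt_eqF// poch_gt0.
pose S := \sum_(i < k) a i.+1 + b; pose E := (\sum_(i < k) e i.+1 + f)%N.
have S0 : 0 < S by rewrite ltr_wpDl// sumr_ge0// => i _; rewrite ltW.
rewrite big_split/= -natr_sum addrACA -natrD -/S -/E beta_poch// IH// -/S -/E.
rewrite !big_ord_recl /= -!addrA -!addnA -/S -/E.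
have := poch_gt0 E S0; have := poch_gt0 (e 0%N + E) (addr_gt0 (a0 0%N) S0).
by move=> h1 h2; field; rewrite !gt_eqF.
Qed.

Lemma dirichlet_le k a b a' b' : (forall i, 0 < a i) -> 0 < b ->
  (forall i, a i <= a' i) -> b <= b' -> dirichlet k a' b' <= dirichlet k a b.
Proof.
elim: k a a' => [|k IH] a a' a0 b0 aa bb //=.
have S0 : 0 < \sum_(i < k) a i.+1 + b by rewrite ltr_wpDl// sumr_ge0// => i _; rewrite ltW.
apply: ler_pM; rewrite ?beta_ge0 ?IH//.
  apply: ltW; apply: dirichlet_gt0 => [i|]; [exact: lt_le_trans (aa _)|exact: lt_le_trans bb].
by apply: beta_le => //; rewrite lerD// ler_sum.
Qed.

End Dirichlet.

(** * Coefficients of truncated series *)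

Section PolyAlgebra.
Variable R : realType.

Lemma coef_prod_poly k N (F : 'I_k -> nat -> R) m :
  (\prod_(i < k) \poly_(a < N) F i a)`_m =
  \sum_(f : {ffun 'I_k -> 'I_N} | (\sum_i f i == m)%N) \prod_i F i (f i).
Proof.
under eq_bigr do rewrite poly_def.
rewrite bigA_distr_bigA /= coef_sum [RHS]big_mkcond; apply: eq_bigr => f _.
have -> : \prod_i (F i (f i) *: 'X^(f i)) = (\prod_i F i (f i)) *: 'X^(\sum_i f i) :> {poly R}.
  by rewrite scaler_prod prodrXr.
by rewrite coefZ coefXn eq_sym; case: eqP; rewrite ?mulr1 ?mulr0.
Qed.

Definition eq_upto N (p q : {poly R}) := forall m, (m < N)%N -> p`_m = q`_m.

Lemma eq_uptoM N p q p' q' : eq_upto N p q -> eq_upto N p' q' -> eq_upto N (p * p') (q * q').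
Proof.
move=> h h' m mN; rewrite !coefM; apply: eq_bigr => i _.
by rewrite h ?h'//; [exact: leq_ltn_trans (leq_subr _ _) mN|apply: leq_ltn_trans mN; rewrite -ltnS].
Qed.

Lemma eq_upto_prod N k (p q : 'I_k -> {poly R}) :
  (forall i, eq_upto N (p i) (q i)) -> eq_upto N (\prod_i p i) (\prod_i q i).
Proof.
move=> h; apply: (big_ind2 (eq_upto N)) => // *; exact: eq_uptoM.
Qed.

Definition trunc_exp N (x : R) : {poly R} := \poly_(a < N) (x ^+ a / a`!%:R).

Lemma fact_neq0 n : n`!%:R != 0 :> R.
Proof. by rewrite pnatr_eq0 -lt0n fact_gt0. Qed.

Lemma trunc_expD N x y : eq_upto N (trunc_exp N x * trunc_exp N y) (trunc_exp N (x + y)).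
Proof.
move=> m mN; rewrite coefM coef_poly mN [x + y]addrC exprDn mulr_suml; apply: eq_bigr => i _.
have im : (i <= m)%N by rewrite -ltnS.
rewrite !coef_poly (leq_ltn_trans im mN) (leq_ltn_trans (leq_subr _ _) mN).
rewrite -[_ *+ 'C(m, i)]mulr_natr.
have -> : 'C(m, i)%:R = m`!%:R / (i`!%:R * (m - i)`!%:R) :> R.
  by rewrite -(bin_fact im) !natrM mulfK// mulf_neq0 ?fact_neq0.
by field; rewrite !fact_neq0.
Qed.

Lemma trunc_exp_sum N k (x : 'I_k -> R) : (0 < N)%N ->
  eq_upto N (\prod_i trunc_exp N (x i)) (trunc_exp N (\sum_i x i)).
Proof.
move=> N0; apply: (big_ind2 (fun p s => eq_upto N p (trunc_exp N s))) => //.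
- move=> m mN; rewrite coefC coef_poly mN; case: m mN => [|m] _.
    by rewrite expr0 fact0 divr1.
  by rewrite exprS mul0r mul0r.
- move=> p s q t hp hq m mN; rewrite -trunc_expD//; exact: (eq_uptoM hp hq mN).
Qed.

(** Falling factorials arise from X^g (d/dX)^g, which multiplies the exponential series of xX by
    (xX)^g. *)
Lemma trunc_exp_ffact N x g :
  eq_upto N (\poly_(a < N) (x ^+ a / a`!%:R * (a ^_ g)%:R)) (x ^+ g *: ('X^g * trunc_exp N x)).
Proof.
move=> m mN; rewrite coefZ coefXnM !coef_poly mN.
case: ltnP => gm; first by rewrite ffact_small// !mulr0.
rewrite (leq_ltn_trans (leq_subr _ _) mN) -{1}(subnKC gm) exprD.
have -> : m`!%:R = (m ^_ g)%:R * (m - g)`!%:R :> R by rewrite -natrM ffact_fact.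
have h1 := fact_neq0 (m - g).
have h2 : (m ^_ g)%:R != 0 :> R by rewrite pnatr_eq0 -lt0n ffact_gt0.
by field; rewrite h1 h2.
Qed.

Lemma coef_prod_ffact N k (x : 'I_k -> R) (g : 'I_k -> nat) m : (m < N)%N ->
  (\prod_i \poly_(a < N) (x i ^+ a / a`!%:R * (a ^_ g i)%:R))`_m =
  if (\sum_i g i <= m)%N then
    (\prod_i x i ^+ g i) * ((\sum_i x i) ^+ (m - \sum_i g i) / (m - \sum_i g i)`!%:R)
  else 0.
Proof.
move=> mN; have N0 : (0 < N)%N by apply: leq_ltn_trans mN.
rewrite (eq_upto_prod (fun i => @trunc_exp_ffact N (x i) (g i)) mN).
have -> : \prod_i (x i ^+ g i *: ('X^(g i) * trunc_exp N (x i))) =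
    (\prod_i x i ^+ g i) *: ('X^(\sum_i g i) * \prod_i trunc_exp N (x i)).
  by rewrite scaler_prod big_split prodrXr.
rewrite coefZ coefXnM ltnNge; case: leqP => //= h; last by rewrite mulr0.
rewrite trunc_exp_sum//; last exact: leq_ltn_trans (leq_subr _ _) mN.
by rewrite coef_poly (leq_ltn_trans (leq_subr _ _) mN).
Qed.

(* Coefficients of [a |-> (c + a)_b] in the basis of falling factorials [a ^_ g]. *)
Fixpoint poch_to_ffact (c : R) (b g : nat) : R :=
  if b is b'.+1 then
    (if g is g'.+1 then poch_to_ffact c b' g' else 0) + poch_to_ffact c b' g * (c + b'%:R + g%:R)
  else (g == 0%N)%:R.

Lemma poch_to_ffact_gt c b g : (b < g)%N -> poch_to_ffact c b g = 0.
Proof.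
elim: b g => [|b IH] [|g] //= h.
by rewrite !IH ?mul0r ?addr0// ltnW.
Qed.

Lemma poch_to_ffact_diag c b : poch_to_ffact c b b = 1.
Proof. by elim: b => [|b IH] //=; rewrite IH poch_to_ffact_gt// mul0r addr0. Qed.

(** The bound [M] is free so that one index range can serve all coordinates. *)
Lemma poch_ffact c b M a : (b < M)%N ->
  poch (c + a%:R) b = \sum_(g < M) poch_to_ffact c b g * (a ^_ g)%:R.
Proof.
elim: b M => [|b IH] M bM.
  case: M bM => // M _; rewrite poch0 big_ord_recl /= ffactn0 mulr1 big1 ?addr0// => i _.
  by rewrite mul0r.
case: M bM => // M bM; rewrite pochS (IH M.+1) 1?ltnW//.
rewrite big_distrl /=.
(* Writes c + a + b as (a - g) + (c + b + g); the first summand raises the falling factorial by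
   one. *)
have E g : poch_to_ffact c b g * (a ^_ g)%:R * (c + a%:R + b%:R) =
    poch_to_ffact c b g * (a ^_ g.+1)%:R + poch_to_ffact c b g * (c + b%:R + g%:R) * (a ^_ g)%:R.
  have -> : (a ^_ g.+1)%:R = (a ^_ g)%:R * (a%:R - g%:R) :> R.
    case: (leqP g a) => h; first by rewrite ffactnSr natrM natrB.
    by rewrite !ffact_small ?mul0r// ltnW.
  ring.
under eq_bigr do rewrite E.
rewrite big_split /= [in RHS]big_ord_recl /=.
rewrite [X in X + _]big_ord_recr /= poch_to_ffact_gt// mul0r addr0.
rewrite [X in _ + X]big_ord_recl /= add0r addrCA; congr (_ + _).
rewrite -big_split; apply: eq_bigr => i _ /=.
by rewrite [in RHS]mulrDl.
Qed.

(** Because the [x i] sum to 1, the product of the exponentials no longer depends on [x]: what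
    remains is polynomial in [x], of degree governed by [b] and not by [m]. *)
Lemma coef_prod_poch N k (x c : 'I_k -> R) (b : 'I_k -> nat) m M : (m < N)%N ->
  \sum_i x i = 1 -> (forall i, b i < M)%N ->
  (\prod_i \poly_(a < N) (x i ^+ a / a`!%:R * poch (c i + a%:R) (b i)))`_m =
  \sum_(g : {ffun 'I_k -> 'I_M}) (\prod_i poch_to_ffact (c i) (b i) (g i)) *
    (if (\sum_i g i <= m)%N then (\prod_i x i ^+ g i) / (m - \sum_i g i)`!%:R else 0).
Proof.
move=> mN x1 bM.
have -> : \prod_i \poly_(a < N) (x i ^+ a / a`!%:R * poch (c i + a%:R) (b i)) =
  \prod_i \sum_(g < M) (poch_to_ffact (c i) (b i) g *: \poly_(a < N) (x i ^+ a / a`!%:R * (a ^_ g)%:R)).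
  apply: eq_bigr => i _; apply/polyP => a; rewrite coef_poly coef_sum.
  case: ifP => aN; last first.
    by rewrite big1// => g _; rewrite coefZ coef_poly aN mulr0.
  rewrite (poch_ffact _ _ (bM i)) big_distrr /=; apply: eq_bigr => g _.
  by rewrite coefZ coef_poly aN; ring.
rewrite bigA_distr_bigA /= coef_sum; apply: eq_bigr => g _.
rewrite scaler_prod coefZ coef_prod_ffact// x1.
by case: ifP => // _; rewrite expr1n mul1r.
Qed.

(** Up to sign this is the [n]-th finite difference of a polynomial in [m] of degree [r < n]. *)
Lemma alt_bin_poch (n r : nat) (c : R) : (r < n)%N ->
  \sum_(m < n.+1) (-1) ^+ m * 'C(n, m)%:R * poch (c + m%:R) r = 0.
Proof.
have S k (F : nat -> R) : \sum_(m < k.+2) (-1) ^+ m * 'C(k.+1, m)%:R * F m =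
    \sum_(m < k.+1) (-1) ^+ m * 'C(k, m)%:R * (F m - F m.+1).
  under [RHS]eq_bigr do rewrite mulrBr.
  rewrite sumrB big_ord_recl [X in _ = X - _]big_ord_recl /=.
  rewrite -addrA; congr (_ + _); first by rewrite !bin0.
  rewrite -sumrN.
  have -> : \sum_(i < k) (-1) ^+ i.+1 * 'C(k, i.+1)%:R * F i.+1 =
     \sum_(i < k.+1) (-1) ^+ i.+1 * 'C(k, i.+1)%:R * F i.+1 :> R.
    by rewrite big_ord_recr /= bin_small// mulr0 mul0r addr0.
  rewrite -big_split; apply: eq_bigr => i _ /=.
  by rewrite binS natrD exprS; ring.
elim: n r c => // n IH r c rn; rewrite (S n (fun m => poch (c + m%:R) r)).
case: r rn => [|r] rn.
  by under eq_bigr do rewrite !poch0 subrr mulr0; rewrite big1.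
have E m : poch (c + m%:R) r.+1 - poch (c + m.+1%:R) r.+1 = - (r.+1)%:R * poch (c + 1 + m%:R) r.
  rewrite pochSl pochS -!natr1.
  have -> : c + 1 + m%:R = c + m%:R + 1 by ring.
  have -> : c + (m%:R + 1) = c + m%:R + 1 by ring.
  ring.
under eq_bigr do rewrite E mulrCA.
by rewrite -big_distrr /= IH ?mulr0.
Qed.

End PolyAlgebra.

(** * The reproducing kernel of the orthogonal polynomials *)

Section Kernel.
Variables (R : realType) (d : nat) (kappa : 'I_d.+1 -> R).
Hypothesis kappa_ge0 : forall i, 0 <= kappa i.

(** The weight exponents are [shift_half i - 1], so these are its Dirichlet parameters. *)
Definition shift_half i : R := kappa i + 2^-1.
Definition half_sum : R := \sum_i shift_half i.
Definition simplex_mass : R := dirichlet d (fun n => shift_half (inord n)) (shift_half ord_max).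

Lemma shift_half_gt0 i : 0 < shift_half i.
Proof. by rewrite /shift_half ltr_wpDl ?invr_gt0. Qed.

Lemma half_sum_gt0 : 0 < half_sum.
Proof.
by rewrite /half_sum big_ord_recl ltr_pwDl ?shift_half_gt0// sumr_ge0// => i _; rewrite ltW// shift_half_gt0.
Qed.

Lemma simplex_mass_gt0 : 0 < simplex_mass.
Proof. by apply: dirichlet_gt0 => *; exact: shift_half_gt0. Qed.

Definition xmonom (x : d.-tuple R) (e : 'I_d.+1 -> nat) : R := \prod_i xext x i ^+ e i.

Definition dirichlet_moment (e : 'I_d.+1 -> nat) : R :=
  (\prod_i poch (shift_half i) (e i)) / poch half_sum (\sum_i e i).

Lemma xext_inord (x : d.-tuple R) (i : 'I_d) : xext x (widen_ord (leqnSn d) i) = tnth x i.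
Proof. by rewrite /xext /= ltn_ord (tnth_nth 0). Qed.

Lemma xext_max (x : d.-tuple R) : xext x ord_max = 1 - l1 x.
Proof. by rewrite /xext /= ltnn. Qed.

Lemma xext_ge0 (x : d.-tuple R) i : Tsimplex x -> 0 <= xext x i.
Proof.
move=> [x0 x1]; rewrite /xext; case: ifP => [h|_]; last by rewrite subr_ge0.
by have := x0 (Ordinal h); rewrite (tnth_nth 0).
Qed.

Lemma sum_xext (x : d.-tuple R) : \sum_i xext x i = 1.
Proof.
rewrite big_ord_recr /= xext_max; under eq_bigr do rewrite xext_inord.
by rewrite /l1 addrC subrK.
Qed.

(** This holds at [t = 0] too: for [n = 0] the two exponents agree, and for [n > 0] the right
    exponent is at least 1/2, so both sides vanish. Hence faces of the simplex need no special
    care. *)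
Lemma powR_shift (t k : R) n : 0 <= t -> 0 <= k ->
  t ^+ n * t `^ (k - 2^-1) = t `^ (k + 2^-1 + n%:R - 1).
Proof.
have -> : k + 2^-1 + n%:R - 1 = n%:R + (k - 2^-1) by field.
rewrite le_eqVlt => /predU1P[<-|t0] k0; last first.
  by rewrite (@powRD _ t n%:R (k - 2^-1)) ?(gt_eqF t0) ?implybT// powR_mulrn// ltW.
case: n => [|n]; first by rewrite expr0 mul1r add0r.
rewrite expr0n mul0r powR0//; apply: lt0r_neq0.
have : 1 <= n.+1%:R :> R by rewrite ler1n.
move: (n.+1%:R) => u; lra.
Qed.

Lemma int_T_monomials (T : Type) (L : seq T) (C : T -> R) (E : T -> 'I_d.+1 -> nat) :
  int_T (fun y => (\sum_(e <- L) C e * xmonom y (E e)) * wkappa kappa y) =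
  \sum_(e <- L) C e * (simplex_mass * dirichlet_moment (E e)).
Proof.
pose a e n := shift_half (inord n) + (E e (inord n))%:R.
pose b e := shift_half ord_max + (E e ord_max)%:R.
have iE (i : 'I_d) : inord i = widen_ord (leqnSn d) i.
  by apply: val_inj; rewrite /= inordK// ltnS ltnW.
transitivity (simplex_int 1 (fun y : d.-tuple R => \sum_(e <- L) C e * dirichlet_dens (a e) (b e) 1 y)).
  apply: eq_simplex_int => // y y0 y1.
  rewrite big_distrl /=; apply: eq_bigr => e _; rewrite -mulrA; congr (_ * _).
  rewrite /xmonom /wkappa -big_split /= big_ord_recr /= xext_max /dirichlet_dens; congr (_ * _).
    apply: eq_bigr => i _; rewrite xext_inord /a iE /shift_half powR_shift//.
  by rewrite powR_shift ?subr_ge0.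
rewrite simplex_int_dirichlet_dens//; first last.
- by move=> e; rewrite /b ltr_pwDl ?shift_half_gt0.
- by move=> e i; rewrite /a ltr_pwDl ?shift_half_gt0.
apply: eq_bigr => e _; rewrite powR1 mul1r /a /b.
rewrite (dirichlet_poch d (fun n => E e (inord n))) ?shift_half_gt0//; last by move=> *; exact: shift_half_gt0.
rewrite -/simplex_mass /dirichlet_moment; congr (_ * (_ * (_ / poch _ _))).
- by rewrite big_ord_recr /=; congr (_ * _); apply: eq_bigr => i _; rewrite iE.
- by rewrite /half_sum big_ord_recr /=; congr (_ + _); apply: eq_bigr => i _; rewrite iE.
- by rewrite big_ord_recr /=; congr (_ + _)%N; apply: eq_bigr => i _; rewrite iE.
Qed.

(** Polynomials in the d+1 barycentric coordinates, with a strict bound on the degree: [ext_poly 0]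
    is the zero function, so it can describe the remainder after a leading term in degree 0. *)
Definition ext_poly n (p : d.-tuple R -> R) : Prop :=
  exists s : seq (('I_d.+1 -> nat) * R),
    all (fun m => (\sum_i m.1 i < n)%N) s /\ forall x, p x = \sum_(m <- s) m.2 * xmonom x m.1.

Lemma ext_poly_add n c p q : ext_poly n p -> ext_poly n q -> ext_poly n (fun x => p x + c * q x).
Proof.
move=> [s [hs ps]] [t [ht qt]]; exists (s ++ [seq (m.1, c * m.2) | m <- t]); split.
  by rewrite all_cat hs all_map.
move=> x; rewrite ps qt big_cat big_map /= big_distrr; congr (_ + _).
by apply: eq_bigr => m _ /=; rewrite mulrA.
Qed.

Lemma ext_poly0 n : ext_poly n (fun=> 0).
Proof. by exists [::]; split=> // x; rewrite big_nil. Qed.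

Lemma ext_poly_xmonom n c e : (\sum_i e i < n)%N -> ext_poly n (fun x => c * xmonom x e).
Proof. by move=> h; exists [:: (e, c)]; split=> [|x]; rewrite /= ?h// big_seq1. Qed.

Lemma ext_poly_sum n (I : eqType) (r : seq I) (c : I -> R) (p : I -> d.-tuple R -> R) :
  (forall i, i \in r -> ext_poly n (p i)) -> ext_poly n (fun x => \sum_(i <- r) c i * p i x).
Proof.
elim: r => [|i r IH] h.
  rewrite (_ : (fun _ => _) = fun=> 0); first exact: ext_poly0.
  by apply/funext => x; rewrite big_nil.
rewrite (_ : (fun _ => _) = fun x => (\sum_(i <- r) c i * p i x) + c i * p i x).
  apply: ext_poly_add; last by apply: h; rewrite mem_head.
  by apply: IH => j jr; apply: h; rewrite inE jr orbT.
by apply/funext => x; rewrite big_cons addrC.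
Qed.

Lemma xmonomD x e e' : xmonom x (fun i => e i + e' i)%N = xmonom x e * xmonom x e'.
Proof. by rewrite /xmonom -big_split; apply: eq_bigr => i _; rewrite exprD. Qed.

Lemma ip_sums (T T' : Type) (s : seq T) (s' : seq T') C C' (E : T -> 'I_d.+1 -> nat) (E' : T' -> _)
    (f g : d.-tuple R -> R) :
  (forall y, Tsimplex y -> f y = \sum_(m <- s) C m * xmonom y (E m)) ->
  (forall y, Tsimplex y -> g y = \sum_(m <- s') C' m * xmonom y (E' m)) ->
  ip kappa f g = \sum_(m <- s) \sum_(m' <- s') C m * C' m' *
     (simplex_mass * dirichlet_moment (fun i => E m i + E' m' i)%N).
Proof.
move=> fs gs.
have := @int_T_monomials (T * T')%type [seq (m, m') | m <- s, m' <- s']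
  (fun p => C p.1 * C' p.2) (fun p i => E p.1 i + E' p.2 i)%N.
rewrite big_allpairs_dep /= => <-.
apply: eq_simplex_int => // y y0 y1; congr (_ * _).
rewrite fs// gs// big_allpairs_dep /= big_distrl /=; apply: eq_bigr => m _.
rewrite big_distrr /=; apply: eq_bigr => m' _.
by rewrite xmonomD; ring.
Qed.

Lemma ipC f g : ip kappa f g = ip kappa g f.
Proof. by apply: eq_simplex_int => // y _ _; rewrite (mulrC (f y)). Qed.

Lemma eq_ip f g f' g' : (forall y, Tsimplex y -> f y = f' y) ->
  (forall y, Tsimplex y -> g y = g' y) -> ip kappa f g = ip kappa f' g'.
Proof. by move=> ff gg; apply: eq_simplex_int => // y y0 y1; rewrite ff ?gg. Qed.

Lemma ip_addr n m k c p q r : ext_poly n p -> ext_poly m q -> ext_poly k r ->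
  ip kappa p (fun x => q x + c * r x) = ip kappa p q + c * ip kappa p r.
Proof.
move=> [s [_ hs]] [t [_ ht]] [u [_ hu]].
rewrite (@ip_sums _ _ s (t ++ [seq (m.1, c * m.2) | m <- u]) snd snd fst fst) //; last first.
  move=> y _; rewrite ht hu big_cat big_map /= big_distrr; congr (_ + _).
  by apply: eq_bigr => i _ /=; rewrite mulrA.
rewrite (@ip_sums _ _ s t snd snd fst fst)// (@ip_sums _ _ s u snd snd fst fst)//.
rewrite big_distrr /= -big_split /=; apply: eq_bigr => i _.
rewrite big_cat big_map /= big_distrr; congr (_ + _).
by apply: eq_bigr => j _ /=; ring.
Qed.

Lemma poly_le_cst n c : poly_le n (fun _ : d.-tuple R => c).
Proof.
exists [:: (fun=> 0%N, c)]; split=> [|x]; first by rewrite /= big1.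
by rewrite big_seq1 big1 ?mulr1// => i _; rewrite expr0.
Qed.

Lemma poly_leD n (p q : d.-tuple R -> R) : poly_le n p -> poly_le n q ->
  poly_le n (fun x => p x + q x).
Proof.
move=> [s [hs ps]] [t [ht qt]]; exists (s ++ t); split; first by rewrite all_cat hs.
by move=> x; rewrite ps qt big_cat.
Qed.

Lemma poly_leM m n (p q : d.-tuple R -> R) : poly_le m p -> poly_le n q ->
  poly_le (m + n) (fun x => p x * q x).
Proof.
move=> [s [/allP hs ps]] [t [/allP ht qt]].
exists [seq ((fun i => a.1 i + b.1 i)%N, a.2 * b.2) | a <- s, b <- t]; split.
  apply/allP => _ /allpairsP[[a b] /= [/hs ha /ht hb ->]] /=.
  by rewrite big_split leq_add.
move=> x; rewrite ps qt big_allpairs_dep big_distrl; apply: eq_bigr => a _.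
rewrite big_distrr; apply: eq_bigr => b _ /=.
rewrite [in RHS](eq_bigr (fun i => tnth x i ^+ a.1 i * tnth x i ^+ b.1 i)); last first.
  by move=> i _; rewrite exprD.
by rewrite big_split /=; ring.
Qed.

Lemma poly_le_mono m n (p : d.-tuple R -> R) : (m <= n)%N -> poly_le m p -> poly_le n p.
Proof.
move=> mn [s [hs ps]]; exists s; split=> //.
by apply: sub_all hs => a /leq_trans; apply.
Qed.

Lemma poly_le_sum n (I : eqType) (r : seq I) (p : I -> d.-tuple R -> R) :
  (forall i, i \in r -> poly_le n (p i)) -> poly_le n (fun x => \sum_(i <- r) p i x).
Proof.
elim: r => [|i r IH] h.
  rewrite (_ : (fun _ => _) = fun=> 0); first exact: poly_le_cst.
  by apply/funext => x; rewrite big_nil.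
rewrite (_ : (fun _ => _) = fun x => p i x + (\sum_(i <- r) p i x)).
  apply: poly_leD; first by apply: h; rewrite mem_head.
  by apply: IH => j jr; apply: h; rewrite inE jr orbT.
by apply/funext => x; rewrite big_cons.
Qed.

Lemma poly_le_tnth (i : 'I_d) : poly_le 1 (fun x : d.-tuple R => tnth x i).
Proof.
exists [:: (fun j => (j == i : nat), 1)]; split=> [|x].
  by rewrite /= (bigD1 i) //= eqxx big1 // => j /negbTE ->.
rewrite big_seq1 mul1r (bigD1 i) //= eqxx expr1 big1 ?mulr1// => j /negbTE ->.
by rewrite expr0.
Qed.

Lemma poly_le_xext i : poly_le 1 (fun x : d.-tuple R => xext x i).
Proof.
case: (ltnP i d) => h.
  rewrite (_ : (fun _ => _) = fun x => tnth x (Ordinal h)); first exact: poly_le_tnth.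
  by apply/funext => x; rewrite /xext h (tnth_nth 0).
rewrite (_ : (fun _ => _) = fun x => 1 + -1 * l1 x); last first.
  by apply/funext => x; rewrite /xext ltnNge h mulN1r.
apply: poly_leD; first exact: poly_le_cst.
rewrite -[1%N]add0n; apply: poly_leM; first exact: poly_le_cst.
by apply: poly_le_sum => j _; exact: poly_le_tnth.
Qed.

Lemma poly_le_xmonom e : poly_le (\sum_i e i) (fun x => xmonom x e).
Proof.
have H k i : poly_le k (fun x : d.-tuple R => xext x i ^+ k).
  elim: k => [|k IH]; first exact: poly_le_cst.
  rewrite (_ : (fun _ => _) = fun x => xext x i * xext x i ^+ k).
    exact: (poly_leM (poly_le_xext i) IH).
  by apply/funext => x; rewrite exprS.
rewrite /xmonom; elim: (index_enum _) => [|i r IH].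
  rewrite big_nil (_ : (fun _ => _) = fun=> 1); first exact: poly_le_cst.
  by apply/funext => x; rewrite big_nil.
rewrite big_cons (_ : (fun _ => _) = fun x => xext x i ^+ e i * \prod_(i <- r) xext x i ^+ e i).
  exact: poly_leM.
by apply/funext => x; rewrite big_cons.
Qed.

Lemma ext_poly_poly_le n p : ext_poly n.+1 p -> poly_le n p.
Proof.
move=> [s [/allP hs ps]].
have -> : p = fun x => \sum_(i < size s) (nth (fun=> 0%N, 0) s i).2 * xmonom x (nth (fun=> 0%N, 0) s i).1.
  by apply/funext => x; rewrite ps (big_nth (fun=> 0%N, 0)) big_mkord.
apply: poly_le_sum => i _; rewrite -[n]add0n; apply: poly_leM; first exact: poly_le_cst.
by apply: poly_le_mono (poly_le_xmonom _); rewrite -ltnS; apply: hs; exact: mem_nth.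
Qed.

Definition ext0 (m : 'I_d -> nat) (i : 'I_d.+1) : nat := if insub (val i) is Some j then m j else 0%N.

Lemma ext0_widen m j : ext0 m (widen_ord (leqnSn d) j) = m j.
Proof. by rewrite /ext0 /= valK. Qed.

Lemma ext0_max m : ext0 m ord_max = 0%N.
Proof. by rewrite /ext0 /= insubN// ltnn. Qed.

Lemma poly_le_ext_poly n p : poly_le n p -> ext_poly n.+1 p.
Proof.
move=> [s [hs ps]]; exists [seq (ext0 m.1, m.2) | m <- s]; split.
  rewrite all_map; apply: sub_all hs => m /=.
  rewrite ltnS big_ord_recr /= ext0_max addn0.
  by under [in X in _ -> X]eq_bigr do rewrite ext0_widen.
move=> x; rewrite ps big_map; apply: eq_bigr => m _ /=; congr (_ * _).
rewrite /xmonom big_ord_recr /= ext0_max expr0 mulr1; apply: eq_bigr => i _.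
by rewrite ext0_widen xext_inord.
Qed.

(** The sum over |f| = m of prod_i (x_i y_i)^(f_i) / (f_i! (kappa_i + 1/2)_(f_i)), for any [N > m].
    Coding it as a coefficient of a product gives access to the exponential identities above and to
    products of [moment_poly] below. *)
Definition prod_ker N m (x y : d.-tuple R) : R :=
  (\prod_i \poly_(a < N) ((xext x i * xext y i) ^+ a / (a`!%:R * poch (shift_half i) a)))`_m.

(** The value 1 at [n = 0] is the one that the general formula takes formally, (c - 1)(c)_(-1) = 1
    with c = [half_sum]. *)
Definition reproducing_coef n m : R :=
  (if n is n'.+1 then (n.*2%:R + half_sum - 1) * poch half_sum (n' + m) else 1)
  * (-1) ^+ (n - m) / (n - m)`!%:R.

(* Coefficients chosen so that [reproducing_coef_sum] is an alternating binomial sum: testing against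
   a monomial of degree [k < n] leaves the [n]-th difference of a polynomial of lower degree. *)
Definition reproducing_ker n (x y : d.-tuple R) : R :=
  simplex_mass^-1 * \sum_(m < n.+1) reproducing_coef n m * prod_ker n.+1 m x y.

Lemma prod_kerC N m x y : prod_ker N m x y = prod_ker N m y x.
Proof.
rewrite /prod_ker; congr nth; congr polyseq; apply: eq_bigr => i _.
by apply/polyP => a; rewrite !coef_poly (mulrC (xext x i)).
Qed.

Lemma reproducing_kerC n x y : reproducing_ker n x y = reproducing_ker n y x.
Proof. by rewrite /reproducing_ker; congr (_ * _); apply: eq_bigr => m _; rewrite prod_kerC. Qed.

Lemma reproducing_coef_diag n : reproducing_coef n n = poch half_sum (n + n).
Proof.
rewrite /reproducing_coef subnn expr0 fact0 mulr1 divr1; case: n => [|n]; first by rewrite poch0.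
rewrite addSn pochS mulrC; congr (_ * _).
by rewrite doubleS -addnn addnS -!natr1; ring.
Qed.

(** The quotient (c)_(n-1+m) / (c)_(m+k) is a Pochhammer symbol in [m] of degree n-1-k, and the
    factorials form a binomial of order n-j, which is larger since j <= k. *)
Lemma reproducing_coef_sum n k j : (j <= k)%N -> (k < n)%N ->
  \sum_(m < n.+1) reproducing_coef n m * ((if (j <= m)%N then (m - j)`!%:R^-1 else 0) / poch half_sum (m + k)) = 0.
Proof.
move=> jk kn; case: n kn => // n kn.
pose F m := reproducing_coef n.+1 m * ((if (j <= m)%N then (m - j)`!%:R^-1 else 0) / poch half_sum (m + k)).
rewrite -(big_mkord xpredT F) (@big_cat_nat _ _ _ j) //=; last by lia.
rewrite big_nat big1 ?add0r; last first.
  by move=> i /andP[_ ij]; rewrite /F leqNgt ij /= mul0r mulr0.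
rewrite -{1}[j]add0n big_addn big_mkord.
have -> : (n.+2 - j = (n.+1 - j).+1)%N by lia.
pose q := (n.+1 - j)%N.
have E (p : 'I_q.+1) : F (p + j)%N = (n.+1.*2%:R + half_sum - 1) * (-1) ^+ q / q`!%:R *
   ((-1) ^+ p * 'C(q, p)%:R * poch (half_sum + (j + k)%:R + p%:R) (n - k)).
  have pq : (p <= q)%N by rewrite -ltnS.
  rewrite /F /reproducing_coef leq_addl addnK.
  have -> : (n.+1 - (p + j) = q - p)%N by rewrite /q addnC subnDA.
  have -> : (n + (p + j) = (p + j + k) + (n - k))%N by lia.
  rewrite pochD.
  have -> : half_sum + (j + k)%:R + p%:R = half_sum + (p + j + k)%:R by rewrite -addrA -natrD addnC addnA.
  have -> : 'C(q, p)%:R = q`!%:R / (p`!%:R * (q - p)`!%:R) :> R.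
    by rewrite -(bin_fact pq) !natrM mulfK// mulf_neq0 ?fact_neq0.
  have -> : (-1) ^+ (q - p) = (-1) ^+ q * (-1) ^+ p :> R.
    by rewrite -signr_odd oddB// signr_addb !signr_odd.
  have := poch_gt0 (p + j + k) half_sum_gt0.
  by move=> h; field; rewrite !fact_neq0 gt_eqF.
under eq_bigr do rewrite E.
rewrite -big_distrr /= alt_bin_poch ?mulr0// /q; lia.
Qed.

Lemma prod_kerE N m x y : prod_ker N m x y =
  \sum_(f : {ffun 'I_d.+1 -> 'I_N} | (\sum_i f i == m)%N)
    (\prod_i (xext x i ^+ f i / ((f i)`!%:R * poch (shift_half i) (f i)))) * xmonom y (fun i => f i).
Proof.
rewrite /prod_ker coef_prod_poly; apply: eq_bigr => f _; rewrite /xmonom -big_split.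
by apply: eq_bigr => i _ /=; rewrite exprMn; ring.
Qed.

Lemma prod_ker_ext_poly N m n x : (m < n)%N -> ext_poly n (prod_ker N m x).
Proof.
move=> mn; rewrite (_ : prod_ker N m x = fun y => \sum_(f <- enum [pred f : {ffun 'I_d.+1 -> 'I_N} | (\sum_i f i == m)%N])
    (\prod_i (xext x i ^+ f i / ((f i)`!%:R * poch (shift_half i) (f i)))) * xmonom y (fun i => f i)).
  apply: ext_poly_sum => f; rewrite mem_enum inE => /eqP fm.
  have := @ext_poly_xmonom n 1 (fun i => f i); rewrite fm => /(_ mn).
  by under eq_fun do rewrite mul1r.
by apply/funext => y; rewrite prod_kerE big_enum_cond /=; apply: eq_bigl => f; rewrite andbT.
Qed.

Lemma reproducing_ker_ext_poly n x : ext_poly n.+1 (reproducing_ker n x).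
Proof.
rewrite (_ : reproducing_ker n x = fun y => \sum_(m <- index_enum 'I_n.+1)
    (simplex_mass^-1 * reproducing_coef n m) * prod_ker n.+1 m x y).
  by apply: ext_poly_sum => m _; exact: prod_ker_ext_poly.
by apply/funext => y; rewrite /reproducing_ker mulr_sumr; apply: eq_bigr => m _; rewrite mulrA.
Qed.

(** The moment of y^(f+e) contains (s_i)_(f_i+e_i), and the denominator (s_i)_(f_i) of the kernel
    reduces it to (s_i + f_i)_(e_i). What is left is the coefficient computed in
    [coef_prod_poch]. *)
Lemma ip_prod_ker_xmonom N m M x e : (m < N)%N -> (forall i, e i < M)%N ->
  ip kappa (prod_ker N m x) (xmonom^~ e) =
  simplex_mass * \sum_(g : {ffun 'I_d.+1 -> 'I_M}) (\prod_i poch_to_ffact (shift_half i) (e i) (g i)) * xmonom x (fun i => g i) *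
    ((if (\sum_i g i <= m)%N then (m - \sum_i g i)`!%:R^-1 else 0) / poch half_sum (m + \sum_i e i)).
Proof.
move=> mN eM.
pose cf (f : {ffun 'I_d.+1 -> 'I_N}) := \prod_i (xext x i ^+ f i / ((f i)`!%:R * poch (shift_half i) (f i))).
rewrite (@ip_sums _ _ (enum [pred f : {ffun 'I_d.+1 -> 'I_N} | (\sum_i f i == m)%N])
  [:: e] cf (fun=> 1) (fun f i => f i) id); first last.
- by move=> y _; rewrite big_seq1 mul1r.
- by move=> y _; rewrite prod_kerE big_enum_cond; apply: eq_bigl => f; rewrite andbT.
rewrite [LHS](_ : _ = simplex_mass * \sum_(f <- enum [pred f : {ffun 'I_d.+1 -> 'I_N} | (\sum_i f i == m)%N])
    cf f * dirichlet_moment (fun i => f i + e i)%N); last first.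
  by rewrite mulr_sumr; apply: eq_bigr => f _; rewrite big_seq1; ring.
congr (_ * _).
have := @coef_prod_poch R N _ (xext x) shift_half e m M mN (sum_xext x) eM.
rewrite coef_prod_poly => H.
transitivity ((poch half_sum (m + \sum_i e i))^-1 * \sum_(f : {ffun 'I_d.+1 -> 'I_N} | (\sum_i f i == m)%N)
   \prod_i (xext x i ^+ f i / (f i)`!%:R * poch (shift_half i + (f i)%:R) (e i))).
  rewrite big_enum_cond big_distrr /=; apply: eq_big => [f|f]; first by rewrite andbT.
  rewrite andbT => /eqP fm; rewrite /dirichlet_moment big_split /= fm mulrA mulrC; congr (_ * _).
  rewrite /cf -big_split; apply: eq_bigr => i _ /=; rewrite pochD.
  have := poch_gt0 (f i) (shift_half_gt0 i) => h.
  by field; rewrite fact_neq0 gt_eqF.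
rewrite H big_distrr /=; apply: eq_bigr => g _.
by case: ifP => _; rewrite /xmonom; ring.
Qed.

Lemma ip_sumr n m f (I : eqType) (r : seq I) (c : I -> R) (p : I -> d.-tuple R -> R) :
  ext_poly m f -> (forall i, i \in r -> ext_poly n (p i)) ->
  ip kappa f (fun x => \sum_(i <- r) c i * p i x) = \sum_(i <- r) c i * ip kappa f (p i).
Proof.
move=> ef; elim: r => [|i r IH] h.
  rewrite big_nil; transitivity (ip kappa f (fun=> 0)).
    by apply: eq_ip => // y _; rewrite big_nil.
  have [s [_ fs]] := ef.
  rewrite (@ip_sums _ _ s [::] snd (fun _ : nat => 0) fst (fun _ _ => 0%N)) //; last first.
    by move=> y _; rewrite big_nil.
  by rewrite big1// => j _; rewrite big_nil.
have hr j : j \in r -> ext_poly n (p j) by move=> jr; apply: h; rewrite inE jr orbT.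
rewrite big_cons -IH// addrC -(@ip_addr m n n) //.
- by apply: eq_ip => // y _; rewrite big_cons addrC.
- exact: ext_poly_sum.
- by apply: h; rewrite mem_head.
Qed.

Lemma ip_reproducing_ker_xmonom n x e : (\sum_i e i <= n)%N ->
  ip kappa (reproducing_ker n x) (xmonom^~ e) =
  \sum_(g : {ffun 'I_d.+1 -> 'I_n.+1}) (\prod_i poch_to_ffact (shift_half i) (e i) (g i)) * xmonom x (fun i => g i) *
    \sum_(m < n.+1) reproducing_coef n m *
    ((if (\sum_i g i <= m)%N then (m - \sum_i g i)`!%:R^-1 else 0) / poch half_sum (m + \sum_i e i)).
Proof.
move=> en.
have eM i : (e i < n.+1)%N.
  by rewrite ltnS (leq_trans _ en)// (bigD1 i)//= leq_addr.
have ee : ext_poly n.+1 (xmonom^~ e).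
  by have := @ext_poly_xmonom n.+1 1 e en; under eq_fun do rewrite mul1r.
rewrite ipC; transitivity (ip kappa (xmonom^~ e) (fun y =>
    \sum_(m <- index_enum 'I_n.+1) (simplex_mass^-1 * reproducing_coef n m) * prod_ker n.+1 m x y)).
  by apply: eq_ip => // y _; rewrite /reproducing_ker mulr_sumr; apply: eq_bigr => m _; rewrite mulrA.
rewrite (@ip_sumr n.+1 n.+1) //; last by move=> m _; exact: prod_ker_ext_poly.
transitivity (\sum_(m < n.+1) \sum_(g : {ffun 'I_d.+1 -> 'I_n.+1})
  reproducing_coef n m * ((\prod_i poch_to_ffact (shift_half i) (e i) (g i)) * xmonom x (fun i => g i) *
    ((if (\sum_i g i <= m)%N then (m - \sum_i g i)`!%:R^-1 else 0) / poch half_sum (m + \sum_i e i)))).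
  apply: eq_bigr => m _; rewrite ipC (@ip_prod_ker_xmonom _ _ n.+1)// -mulr_sumr.
  by have h := simplex_mass_gt0; field; rewrite gt_eqF.
rewrite exchange_big; apply: eq_bigr => g _ /=.
by rewrite mulr_sumr; apply: eq_bigr => m _; ring.
Qed.

Lemma poch_to_ffact_prod0 n e (g : {ffun 'I_d.+1 -> 'I_n}) :
  (\prod_i poch_to_ffact (shift_half i) (e i) (g i) == 0) || [forall i, (g i <= e i)%N].
Proof.
apply/orP; case: (boolP [forall i, (g i <= e i)%N]) => h; [by right|left].
move: h; rewrite negb_forall => /existsP[i]; rewrite -ltnNge => h.
by rewrite (bigD1 i)//= poch_to_ffact_gt// mul0r.
Qed.

Lemma ip_reproducing_ker_low n x e : (\sum_i e i < n)%N -> ip kappa (reproducing_ker n x) (xmonom^~ e) = 0.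
Proof.
move=> en; rewrite ip_reproducing_ker_xmonom; last exact: ltnW.
rewrite big1// => g _; case/orP: (poch_to_ffact_prod0 e g) => [/eqP->|/forallP h].
  by rewrite !mul0r.
by rewrite reproducing_coef_sum ?mulr0// leq_sum.
Qed.

Lemma ip_reproducing_ker_top n e : (\sum_i e i = n)%N ->
  exists2 r, ext_poly n r & forall x, ip kappa (reproducing_ker n x) (xmonom^~ e) = xmonom x e + r x.
Proof.
move=> en.
pose c (g : {ffun 'I_d.+1 -> 'I_n.+1}) := (\prod_i poch_to_ffact (shift_half i) (e i) (g i)) *
    \sum_(m < n.+1) reproducing_coef n m *
    ((if (\sum_i g i <= m)%N then (m - \sum_i g i)`!%:R^-1 else 0) / poch half_sum (m + \sum_i e i)).
exists (fun x => \sum_(g <- enum [pred g : {ffun 'I_d.+1 -> 'I_n.+1} | (\sum_i g i < n)%N]) c g * xmonom x (fun i => g i)).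
  apply: ext_poly_sum => g; rewrite mem_enum inE => gn.
  by have := @ext_poly_xmonom n 1 _ gn; under eq_fun do rewrite mul1r.
move=> x; rewrite ip_reproducing_ker_xmonom ?en//.
rewrite (bigID (fun g : {ffun 'I_d.+1 -> 'I_n.+1} => (\sum_i g i < n)%N)) /= addrC; congr (_ + _); last first.
  rewrite big_enum_cond /=; apply: eq_big => [g|g _]; first by rewrite andbT.
  by rewrite /c en; ring.
have eM i : (e i < n.+1)%N by rewrite ltnS -en (bigD1 i)//= leq_addr.
pose g0 : {ffun 'I_d.+1 -> 'I_n.+1} := [ffun i => Ordinal (eM i)].
have g0E i : g0 i = e i :> nat by rewrite ffunE.
have sg0 : (\sum_i g0 i = n)%N by rewrite -[RHS]en; apply: eq_bigr => i _; rewrite g0E.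
rewrite (bigD1 g0) /=; last by rewrite sg0 ltnn.
rewrite [X in _ + X]big1 ?addr0.
  rewrite big1 ?mul1r; last by move=> i _; rewrite g0E poch_to_ffact_diag.
  have -> : xmonom x (fun i => g0 i) = xmonom x e by apply: eq_bigr => i _; rewrite g0E.
  (* For |g| = n only [m = n] contributes, and [reproducing_coef_diag] makes its coefficient 1. *)
  rewrite sg0 big_ord_recr /= leqnn subnn fact0 big1 ?add0r.
    by rewrite reproducing_coef_diag invr1 mul1r mulfV ?mulr1// gt_eqF// poch_gt0// half_sum_gt0.
  by move=> i _; rewrite leqNgt ltn_ord mul0r mulr0.
(* A surviving [g] satisfies g <= e coordinatewise and |g| >= |e|, so it equals [e]. *)
move=> g /andP[gn gg]; case/orP: (poch_to_ffact_prod0 e g) => [/eqP->|/forallP h]; first by rewrite !mul0r.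
case/eqP: gg; apply/ffunP => i; apply/val_inj; rewrite /= g0E.
apply/eqP; rewrite eqn_leq h /=.
move: gn; rewrite -leqNgt -[X in (X <= _)%N]en => hs.
move: hs; rewrite (bigD1 i)//= [X in (_ <= X)%N](bigD1 i)//= => hs.
have : (\sum_(j | j != i) g j <= \sum_(j | j != i) e j)%N by apply: leq_sum.
by move=> h2; have := leq_trans hs (leq_add (leqnn _) h2); rewrite leq_add2r.
Qed.

Lemma ip_reproducing_ker_ext_poly0 n x q : ext_poly n q -> ip kappa (reproducing_ker n x) q = 0.
Proof.
move=> [s [/allP hs qs]].
pose z : ('I_d.+1 -> nat) * R := (fun=> 0%N, 0).
transitivity (ip kappa (reproducing_ker n x) (fun y =>
  \sum_(i <- index_enum 'I_(size s)) (nth z s i).2 * xmonom y (nth z s i).1)).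
  by apply: eq_ip => // y _; rewrite qs (big_nth z) big_mkord.
rewrite (@ip_sumr n.+1 n.+1 _ _ _ _ (fun i : 'I_(size s) => xmonom^~ (nth z s i).1)); first last.
- move=> i _; have h := hs _ (mem_nth z (ltn_ord i)).
  by have := @ext_poly_xmonom n.+1 1 _ (ltnW h); under eq_fun do rewrite mul1r.
- exact: reproducing_ker_ext_poly.
by rewrite big1// => i _; rewrite ip_reproducing_ker_low ?mulr0//; apply: hs; exact: mem_nth.
Qed.

Lemma ip_reproducing_ker_ext_poly n p : ext_poly n.+1 p ->
  exists2 r, ext_poly n r & forall x, ip kappa (reproducing_ker n x) p = p x + r x.
Proof.
move=> [s [/allP hs ps]].
pose z : ('I_d.+1 -> nat) * R := (fun=> 0%N, 0).
have H (i : 'I_(size s)) : exists r : d.-tuple R -> R, ext_poly n r /\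
    forall x, ip kappa (reproducing_ker n x) (xmonom^~ (nth z s i).1) = xmonom x (nth z s i).1 + r x.
  have := hs _ (mem_nth z (ltn_ord i)); rewrite ltnS leq_eqVlt => /predU1P[h|h].
    by have [r er hr] := ip_reproducing_ker_top h; exists r.
  exists (fun x => -1 * xmonom x (nth z s i).1); split; first exact: ext_poly_xmonom.
  by move=> x; rewrite ip_reproducing_ker_low// mulN1r subrr.
have [F FP] := choice H.
exists (fun x => \sum_(i <- index_enum 'I_(size s)) (nth z s i).2 * F i x).
  by apply: ext_poly_sum => i _; case: (FP i).
move=> x.
transitivity (ip kappa (reproducing_ker n x) (fun y =>
  \sum_(i <- index_enum 'I_(size s)) (nth z s i).2 * xmonom y (nth z s i).1)).
  by apply: eq_ip => // y _; rewrite ps (big_nth z) big_mkord.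
rewrite (@ip_sumr n.+1 n.+1 _ _ _ _ (fun i : 'I_(size s) => xmonom^~ (nth z s i).1)); first last.
- move=> i _; have h := hs _ (mem_nth z (ltn_ord i)).
  by have := @ext_poly_xmonom n.+1 1 _ h; under eq_fun do rewrite mul1r.
- exact: reproducing_ker_ext_poly.
rewrite ps (big_nth z) big_mkord -big_split; apply: eq_bigr => i _ /=.
by case: (FP i) => _ ->; rewrite mulrDr.
Qed.

(** The explicit kernel reproduces polynomials of degree [n] only up to lower degree. Applied to
    [P n y], this makes the difference [r] of the two kernels an element of V_n of degree below [n];
    reproducing [r] by [P n x] and using orthogonality gives [r x = 0]. *)
Lemma proj_kernelE (P : nat -> d.-tuple R -> d.-tuple R -> R) n x y :
  proj_kernel kappa P -> Tsimplex x -> Tsimplex y -> P n x y = reproducing_ker n x y.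
Proof.
move=> hP Tx Ty.
have PC u v : Tsimplex u -> Tsimplex v -> P n u v = P n v u.
  move=> Tu Tv; have [Pu ru] := hP n u Tu; have [Pv rv] := hP n v Tv.
  by rewrite -(rv _ Pu) ipC (ru _ Pv).
have KV u : in_Vn kappa n (reproducing_ker n u).
  split; first by exists (reproducing_ker n u); split=> //; apply/ext_poly_poly_le/reproducing_ker_ext_poly.
  move=> m q mn /poly_le_ext_poly [s [hs qs]]; apply: ip_reproducing_ker_ext_poly0; exists s; split=> //.
  by apply: sub_all hs => a h; apply: leq_trans h mn.
have [[[p [/poly_le_ext_poly ep Pp]] Plow] rep] := hP n y Ty.
have [r er hr] := ip_reproducing_ker_ext_poly ep.
have Kr u : Tsimplex u -> reproducing_ker n y u = P n y u + r u.
  move=> Tu; rewrite reproducing_kerC -(rep _ (KV u)) Pp// -hr.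
  by apply: eq_ip => // v Tv; rewrite Pp.
have rV : in_Vn kappa n r.
  split.
    exists r; split=> //; apply: ext_poly_poly_le; case: er => s [hs rs]; exists s; split=> //.
    by apply: sub_all hs => a; exact: ltnW.
  move=> m q mn qm; have eq := poly_le_ext_poly qm.
  transitivity (ip kappa q (fun u => reproducing_ker n y u + -1 * p u)).
    by rewrite ipC; apply: eq_ip => // u Tu; rewrite Kr// Pp// mulN1r addrAC subrr add0r.
  rewrite (@ip_addr m.+1 n.+1 n.+1)//; last exact: reproducing_ker_ext_poly.
  have [_ KVy] := KV y.
  rewrite ipC (KVy _ _ mn qm) add0r ipC.
  suff -> : ip kappa p q = 0 by rewrite mulr0.
  by rewrite -(Plow _ _ mn qm); apply: eq_ip => // u Tu; rewrite Pp.
have [[_ Pxlow] repx] := hP n x Tx.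
have r0 : r x = 0.
  (* For [n = 0] there is no lower degree to be orthogonal to, but [ext_poly 0] contains only the
     zero function. *)
  have [n0|n0] := posnP n.
    by case: er => -[|a s] [+ rs]; [rewrite rs big_nil|rewrite n0].
  rewrite -(repx _ rV) ipC; apply: (Pxlow n.-1); first by rewrite ltn_predL.
  by apply: ext_poly_poly_le; rewrite prednK.
by rewrite PC// reproducing_kerC Kr// r0 addr0.
Qed.

End Kernel.

(** * Averages against symmetric beta densities *)

Section Functional.
Variable R : realType.
Notation mu := (@lebesgue_measure R).
Implicit Types (p q f g : {poly R}).

(** At [r = 2m] and [k > 0] this is B(1/2 + m, k) / B(1/2, k); at [k = 0] the formula gives 1, the
    even moments of a random sign. *)
Definition beta_moment (k : R) (r : nat) : R :=
  if odd r then 0 else poch 2^-1 r./2 / poch (k + 2^-1) r./2.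

(* For [k > 0] this is the mean of [p] against the density proportional to
   [(1-t^2)^(k-1)] on [-1, 1]; for [k = 0] it is [(p.[1] + p.[-1]) / 2]. *)
Definition beta_mean (k : R) (p : {poly R}) : R := \sum_(r < size p) p`_r * beta_moment k r.

Lemma beta_meanE k p N : (size p <= N)%N -> beta_mean k p = \sum_(r < N) p`_r * beta_moment k r.
Proof.
move=> h; rewrite /beta_mean (big_ord_widen N (fun r => p`_r * beta_moment k r) h) [LHS]big_mkcond.
apply: eq_bigr => r _; case: ifP => //; rewrite ltnNge => /negbFE hr.
by rewrite nth_default// mul0r.
Qed.

Lemma beta_meanD k p q : beta_mean k (p + q) = beta_mean k p + beta_mean k q.
Proof.
pose N := maxn (size p) (size q).
rewrite (@beta_meanE _ _ N) ?(@beta_meanE _ p N) ?(@beta_meanE _ q N) ?leq_maxl ?leq_maxr//.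
  by rewrite -big_split; apply: eq_bigr => r _; rewrite coefD mulrDl.
exact: leq_trans (size_polyD _ _) _.
Qed.

Lemma beta_meanZ k c p : beta_mean k (c *: p) = c * beta_mean k p.
Proof.
rewrite (@beta_meanE _ _ (size p)) ?size_scale_leq// mulr_sumr.
by apply: eq_bigr => r _; rewrite coefZ mulrA.
Qed.

(** Only the even part (p(u) + p(-u))/2 counts. For [k > 0] it is evaluated at u = sqrt t and
    integrated against t^(-1/2) (1-t)^(k-1), which yields B(1/2, k) times the mean; for [k = 0] the
    mean is its value at u = 1. *)
Lemma beta_mean_ge0 k p : 0 <= k -> (forall t, -1 <= t <= 1 -> 0 <= p.[t]) -> 0 <= beta_mean k p.
Proof.
move=> k0 p0.
have even_part (u : R) : 0 <= u <= 1 ->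
    0 <= \sum_(r < size p) p`_r * (~~ odd r)%:R * u ^+ r.
  move=> /andP[u0 u1]; rewrite (_ : \sum_(r < _) _ = (p.[u] + p.[- u]) / 2).
    by rewrite divr_ge0// addr_ge0// p0//; apply/andP; split; lra.
  rewrite !horner_coef -big_split mulr_suml /=; apply: eq_bigr => r _.
  rewrite exprNn -signr_odd; case: (odd r) => /=; [rewrite expr1|rewrite expr0]; by field.
have [->|kn0] := eqVneq k 0.
  rewrite /beta_mean; have := even_part 1; rewrite lexx ler01 => /(_ isT).
  congr (_ <= _); apply: eq_bigr => r _; rewrite expr1n mulr1 /beta_moment; congr (_ * _).
  case: (odd r) => //=; rewrite add0r divff// gt_eqF// poch_gt0//.
have kp : 0 < k by rewrite lt_neqAle eq_sym kn0.
have h0 : 0 < 2^-1 :> R by [].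
have : 0 <= \int[mu]_(t in `[0, 1])
    (\sum_(r < size p) (p`_r * (~~ odd r)%:R) * beta_dens (2^-1 + (r./2)%:R) k 1 t).
  apply: Rintegral_ge0 => t; rewrite /= in_itv/= => /andP[t0 t1].
  rewrite (_ : \sum_(r < _) _ = (\sum_(r < size p) (p`_r * (~~ odd r)%:R) * Num.sqrt t ^+ r) *
      (t `^ (0 - 2^-1) * (1 - t) `^ (k - 1))).
    rewrite mulr_ge0 ?mulr_ge0 ?powR_ge0// even_part// sqrtr_ge0 -(sqrtr1 R) ler_wsqrtr//.
  rewrite mulr_suml; apply: eq_bigr => r _; case: (boolP (odd r)) => o.
    by rewrite !mulr0 !mul0r.
  rewrite /beta_dens -[2^-1 + _]add0r addrA -powR_shift// !mulrA; congr (_ * _ * _ * _).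
  by rewrite -[in RHS](even_halfK o) -muln2 mulnC exprM sqr_sqrtr.
rewrite Rintegral_sum; last 2 first.
- exact: measurable_itv.
- by move=> r; apply: beta_dens_integrable; rewrite // ltr_wpDr.
have -> : \sum_(r < size p) p`_r * (~~ odd r)%:R *
    (\int[mu]_(t in `[0, 1]) beta_dens (2^-1 + (r./2)%:R) k 1 t) = beta 2^-1 k * beta_mean k p.
  rewrite /beta_mean mulr_sumr; apply: eq_bigr => r _.
  rewrite Rintegral_beta_dens ?ltr_wpDr// powR1 mul1r -[X in beta _ X]addr0 (@beta_poch _ _ _ _ 0)//.
  rewrite poch0 mulr1 addn0 /beta_moment (addrC k); case: (odd r) => /=; by rewrite ?mulr0 ?mul0r ?mulr1 ?mulr0; ring.
by rewrite pmulr_rge0// beta_gt0.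
Qed.

Lemma beta_mean_norm_le k p q : 0 <= k -> (forall t, -1 <= t <= 1 -> `|p.[t]| <= q.[t]) ->
  `|beta_mean k p| <= beta_mean k q.
Proof.
move=> k0 h; rewrite ler_norml -subr_ge0 opprK -beta_meanD -(subr_ge0 (beta_mean k p)) -mulN1r -beta_meanZ -beta_meanD.
apply/andP; split; apply: beta_mean_ge0 => // t /h; rewrite ler_norml => /andP[h1 h2].
  by rewrite hornerD; lra.
by rewrite hornerD hornerZ; lra.
Qed.

Implicit Types (k c : R) (l : seq (R * R)).

(* The mean of [t |-> f.[u + p t]], as a polynomial in [u]. *)
Definition beta_average (p k : R) f : {poly R} :=
  \sum_(r < size f) (beta_moment k r * p ^+ r) *: f^`N(r).

Lemma beta_averageE (p : R) k f N : (size f <= N)%N ->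
  beta_average p k f = \sum_(r < N) (beta_moment k r * p ^+ r) *: f^`N(r).
Proof.
move=> h; rewrite /beta_average (big_ord_widen N (fun r => (beta_moment k r * p ^+ r) *: f^`N(r)) h) [LHS]big_mkcond.
apply: eq_bigr => r _; case: ifP => //; rewrite ltnNge => /negbFE hr.
by rewrite nderivn_poly0// scaler0.
Qed.

Lemma beta_averageP (p : R) k c f g : beta_average p k (c *: f + g) = c *: beta_average p k f + beta_average p k g.
Proof.
pose N := maxn (size f) (size g).
rewrite (@beta_averageE _ _ _ N) ?(@beta_averageE _ _ f N) ?(@beta_averageE _ _ g N) ?leq_maxl ?leq_maxr//.
  rewrite scaler_sumr -big_split; apply: eq_bigr => r _ /=.
  by rewrite linearP scalerDr !scalerA mulrC.
rewrite (leq_trans (size_polyD _ _))// geq_max leq_maxr andbT.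
by rewrite (leq_trans (size_scale_leq _ _))// leq_maxl.
Qed.

Lemma beta_average_beta_mean (p : R) k f (u : R) :
  exists2 q, (beta_average p k f).[u] = beta_mean k q & forall t, q.[t] = f.[u + p * t].
Proof.
exists (\poly_(r < size f) (f^`N(r).[u] * p ^+ r)) => [|t].
  rewrite (@beta_meanE _ _ (size f)) ?size_poly// /beta_average horner_sum; apply: eq_bigr => r _.
  by rewrite hornerZ coef_poly ltn_ord; ring.
rewrite nderiv_taylor; last exact: mulrC.
by rewrite horner_poly; apply: eq_bigr => r _; rewrite exprMn mulrA.
Qed.

Definition iter_average (l : seq (R * R)) (f : {poly R}) : {poly R} :=
  foldr (fun pk => beta_average pk.1 pk.2) f l.

Lemma iter_averageP l c f g : iter_average l (c *: f + g) = c *: iter_average l f + iter_average l g.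
Proof. by elim: l => //= pk l ->; rewrite beta_averageP. Qed.

(** On divided powers an average acts as convolution with the moments divided by factorials, so
    composing averages multiplies the generating polynomials [moment_poly]. *)
Definition divpow r : {poly R} := r`!%:R^-1 *: 'X^r.

Lemma beta_average_divpow (p : R) k r : beta_average p k (divpow r) =
  \sum_(s < r.+1) (beta_moment k s * p ^+ s / s`!%:R) *: divpow (r - s).
Proof.
rewrite (@beta_averageE _ _ _ r.+1); last by rewrite (leq_trans (size_scale_leq _ _))// size_polyXn.
apply: eq_bigr => s _; have sr : (s <= r)%N by rewrite -ltnS.
rewrite /divpow linearZ /= nderivnXn -['X^_ *+ _]scaler_nat !scalerA.
congr (_ *: _).
have -> : 'C(r, s)%:R = r`!%:R / (s`!%:R * (r - s)`!%:R) :> R.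
  by rewrite -(bin_fact sr) !natrM mulfK// mulf_neq0 ?fact_neq0.
by field; rewrite !fact_neq0.
Qed.

Lemma iter_average0 l : iter_average l 0 = 0.
Proof. by have := iter_averageP l (-1) 0 0; rewrite scaler0 addr0 scaleN1r addNr. Qed.

Lemma iter_average_sum l (I : Type) (r : seq I) (c : I -> R) (f : I -> {poly R}) :
  iter_average l (\sum_(i <- r) c i *: f i) = \sum_(i <- r) c i *: iter_average l (f i).
Proof.
elim: r => [|i r IH]; first by rewrite !big_nil iter_average0.
by rewrite !big_cons iter_averageP IH.
Qed.

Definition moment_poly N (pk : R * R) : {poly R} :=
  \poly_(a < N) (beta_moment pk.2 a * pk.1 ^+ a / a`!%:R).

Lemma divpow_shift (q : {poly R}) r s : (s <= r)%N ->
  \sum_(u < r.+1) (q * 'X^s)`_u *: divpow (r - u) =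
  \sum_(t < (r - s).+1) q`_t *: divpow (r - s - t).
Proof.
move=> sr; rewrite -(big_mkord xpredT (fun u => (q * 'X^s)`_u *: divpow (r - u))).
rewrite (@big_cat_nat _ _ _ s) //=; last by lia.
rewrite big_nat big1 ?add0r; last first.
  by move=> i /andP[_ ij]; rewrite coefMXn ij scale0r.
rewrite -{1}[s]add0n big_addn big_mkord.
have -> : (r.+1 - s = (r - s).+1)%N by lia.
apply: eq_bigr => t _; rewrite coefMXn ltnNge leq_addl /= addnK.
by have -> : (r - (t + s) = r - s - t)%N by lia.
Qed.

Lemma iter_average_divpow l N r : (r < N)%N ->
  iter_average l (divpow r) = \sum_(s < r.+1) (\prod_(pk <- l) moment_poly N pk)`_s *: divpow (r - s).
Proof.
move=> rN; elim: l => [|pk l IH].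
  rewrite big_nil /= big_ord_recl coefC scale1r subn0 big1 ?addr0// => i _.
  by rewrite coefC scale0r.
rewrite big_cons; set q := \prod_(pk <- l) _ in IH *.
rewrite /= IH -[beta_average _ _]/(iter_average [:: pk]) iter_average_sum /=.
transitivity (\sum_(s < r.+1) q`_s *: \sum_(u < r.+1) (moment_poly N pk * 'X^s)`_u *: divpow (r - u)).
  apply: eq_bigr => s _; congr (_ *: _); rewrite divpow_shift ?leq_ord// beta_average_divpow.
  apply: eq_bigr => t _; rewrite coef_poly ifT//.
  by have := ltn_ord t; have := leq_subr s r; lia.
transitivity (\sum_(s < r.+1) \sum_(u < r.+1) (q`_s * (moment_poly N pk * 'X^s)`_u) *: divpow (r - u)).
  by apply: eq_bigr => s _; rewrite scaler_sumr; apply: eq_bigr => u _; rewrite scalerA.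
rewrite exchange_big; apply: eq_bigr => u _ /=; rewrite -scaler_suml; congr (_ *: _).
rewrite mulrC coefM.
have ur : (u.+1 <= r.+1)%N by [].
rewrite (big_ord_widen r.+1 (fun j => q`_j * (moment_poly N pk)`_(u - j)) ur) [RHS]big_mkcond.
apply: eq_bigr => s _; rewrite coefMXn ltnS ltnNge; case: leqP => //= _.
by rewrite mulr0.
Qed.

Lemma iter_average_divpow0 l N r : (r < N)%N ->
  (iter_average l (divpow r)).[0] = (\prod_(pk <- l) moment_poly N pk)`_r.
Proof.
move=> rN; rewrite (iter_average_divpow l rN) horner_sum big_ord_recr /= big1 ?add0r.
  by rewrite subnn /divpow fact0 invr1 scale1r hornerZ hornerXn expr0 mulr1.
move=> i _; rewrite /divpow !hornerZ hornerXn expr0n subn_eq0 leqNgt ltn_ord /=.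
by rewrite !mulr0.
Qed.

Lemma coef_comp_sq (q : {poly R}) c r :
  (q \Po (c *: 'X^2))`_r = if odd r then 0 else c ^+ r./2 * q`_(r./2).
Proof.
rewrite comp_polyE coef_sum.
under eq_bigr do rewrite exprZn -exprM mulnC scalerA coefZ coefXn muln2.
case: ifP => o.
  rewrite big1// => i _; case: eqP => [E|]; last by rewrite mulr0.
  by move: o; rewrite E odd_double.
have rE : r = r./2.*2 by rewrite even_halfK ?o.
case: (ltnP r./2 (size q)) => h.
  rewrite (bigD1 (Ordinal h)) //= -rE eqxx mulr1 mulrC big1 ?addr0// => i ih.
  rewrite rE (inj_eq double_inj); case: eqP => [E|]; last by rewrite mulr0.
  by case/eqP: ih; apply: val_inj; rewrite /= E.
rewrite (nth_default _ h) mulr0 big1// => i _; case: eqP => [E|]; last by rewrite mulr0.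
by move: h; rewrite E doubleK leqNgt ltn_ord.
Qed.

Lemma fact_double n : n.*2`!%:R = 4 ^+ n * n`!%:R * poch 2^-1 n :> R.
Proof.
elim: n => [|n IH]; first by rewrite fact0 poch0 !mulr1.
rewrite doubleS !factS !natrM IH pochS exprS -!natr1 -!muln2 natrM.
by field.
Qed.

(** Since (2a)! = 4^a a! (1/2)_a, the (1/2)_a of the moment cancels. The result is a Bessel-type
    series in p^2, and for p = sqrt(x_i y_i) it is the factor that occurs in [prod_ker]. *)
Lemma moment_poly_comp N (p : R) k : 0 <= k -> moment_poly N.*2 (p, k) =
  (\poly_(a < N) ((p ^+ 2) ^+ a / (a`!%:R * poch (k + 2^-1) a))) \Po (4^-1 *: 'X^2).
Proof.
move=> k0; apply/polyP => r; rewrite coef_comp_sq !coef_poly /beta_moment /=.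
case: (boolP (odd r)) => o; first by rewrite !mul0r if_same.
rewrite -(even_halfK o) doubleK; move: (r./2) => m {o}.
rewrite ltn_double; case: ifP => _; last by rewrite mulr0.
rewrite fact_double -mul2n exprM exprVn.
have h1 : poch 2^-1 m != 0 :> R by rewrite gt_eqF// poch_gt0.
have h2 : poch (k + 2^-1) m != 0 by rewrite gt_eqF// poch_gt0// ltr_wpDl.
have h3 : 4 ^+ m != 0 :> R by rewrite expf_neq0.
by field; rewrite h1 h2 h3 fact_neq0.
Qed.

End Functional.

(** * Gegenbauer polynomials *)

Section Gegenbauer.
Variables (R : realType) (lam : R).
Hypothesis lam0 : 0 <= lam.

(* [geg i] is [(i + lam)/lam] times the Gegenbauer polynomial [C_i^lam]; dividing by [lam]
   formally keeps [lam = 0] (twice the Chebyshev polynomials for [i > 0]) uniform. *)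
Definition geg_coef k r : R :=
  (if (k + r == 0)%N then 1 else ((r + k.*2)%:R + lam) * poch (lam + 1) (k + r).-1)
  * (-1) ^+ k * 2 ^+ r / (k`!%:R * r`!%:R).

Definition geg i : {poly R} :=
  \poly_(r < i.+1) (if odd (i - r) then 0 else geg_coef (i - r)./2 r).

(** The recurrence reads X Z_j = [gegrec] (j+1) Z_(j+1) + (1 - [gegrec] (j-1)) Z_(j-1). At [i = 0]
    the value is 0 also when [lam = 0], by the convention on division, and this is the value that
    the recurrence needs. *)
Definition gegrec i : R := i%:R / (2 * (i%:R + lam)).

Lemma coef_geg k r : (geg (r + k.*2))`_r = geg_coef k r.
Proof. by rewrite coef_poly ltnS leq_addr addKn odd_double doubleK. Qed.

Lemma coef_geg_eq0 i r : (i < r)%N || odd (i - r) -> (geg i)`_r = 0.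
Proof. by rewrite coef_poly ltnS; case: leqP => //= _ ->. Qed.

Lemma coef_geg_odd i r : odd (i + r) -> (geg i)`_r = 0.
Proof.
by move=> o; apply: coef_geg_eq0; case: ltnP => //= h; rewrite oddB// -oddD.
Qed.

Lemma geg_coefE k r : (0 < k + r)%N ->
  geg_coef k r = (r%:R + 2 * k%:R + lam) * poch (lam + 1) (k + r).-1
  * (-1) ^+ k * 2 ^+ r / (k`!%:R * r`!%:R).
Proof. by rewrite /geg_coef; case: (k + r)%N => // n _; rewrite -mul2n natrD natrM. Qed.

Lemma gegrecE k r : gegrec (r + k.*2) = (r%:R + 2 * k%:R) / (2 * (r%:R + 2 * k%:R + lam)).
Proof. by rewrite /gegrec -mul2n natrD natrM. Qed.

Lemma natR_gen n : exists2 x : R, x = n%:R & 0 <= x.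
Proof. by exists n%:R. Qed.

Lemma natr_factS n : n.+1`!%:R = (n%:R + 1) * n`!%:R :> R.
Proof. by rewrite factS natrM -natr1. Qed.

Lemma geg_coef_rec k r : geg_coef k.+1 r =
  gegrec (r.+1 + k.+1.*2) * geg_coef k.+1 r.+1 + (1 - gegrec (r.+1 + k.*2)) * geg_coef k r.+1.
Proof.
rewrite !gegrecE !geg_coefE ?addnS ?addSn ?addnS // [in LHS]/= [in RHS]/= pochS !natr_factS !exprS -!natr1 natrD.
have h1 := fact_neq0 R r; have h2 := fact_neq0 R k.
have lamp := lam0; have [u <- hu] := natR_gen r; have [v <- hv] := natR_gen k.
by field; rewrite h1 h2 /= !gt_eqF//; lra.
Qed.

Lemma geg_coef_rec0 r : geg_coef 0 r = gegrec r.+1 * geg_coef 0 r.+1.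
Proof.
rewrite /gegrec [in RHS]geg_coefE//.
have lamp := lam0; have l1 : 1 + lam != 0 by rewrite gt_eqF//; lra.
case: r => [|r].
  rewrite /geg_coef /= poch0 fact0 (_ : 1`! = 1)%N//; field; rewrite ?addr0 ?mulr0 ?addr0//.
rewrite geg_coefE// !add0n /= pochS !natr_factS !exprS -!natr1.
have h1 := fact_neq0 R r; have [u <- hu] := natR_gen r.
by field; rewrite h1 /= !gt_eqF//; lra.
Qed.

Lemma geg_coef_rec1 k : 0 = gegrec k.+1.*2 * geg_coef k.+1 0 + (1 - gegrec k.*2) * geg_coef k 0.
Proof.
rewrite /gegrec -!mul2n !natrM [geg_coef k.+1 _]geg_coefE//.
have lamp := lam0; have l1 : 2 + lam != 0 by rewrite gt_eqF//; lra.
case: k => [|k].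
  rewrite mulr0 mul0r subr0 /geg_coef /= poch0 fact0 (_ : 1`! = 1)%N//.
  by field; rewrite ?mulr0 ?addr0 ?mulr1 ?l1.
rewrite geg_coefE// !addn0 /= pochS !natr_factS !exprS -!natr1.
have h1 := fact_neq0 R k; have [u <- hu] := natR_gen k.
by field; rewrite h1 /= !gt_eqF//; lra.
Qed.

Lemma geg_rec0 : 'X * geg 0 = gegrec 1 *: geg 1.
Proof.
apply/polyP => r; rewrite coefXM coefZ; case: r => [|[|r]] /=.
- by rewrite coef_geg_eq0// mulr0.
- by have := coef_geg 0 0; have := coef_geg 0 1; rewrite !addn0 => -> ->; rewrite geg_coef_rec0.
- by rewrite !coef_geg_eq0// mulr0.
Qed.

Lemma geg_rec i : 'X * geg i.+1 = gegrec i.+2 *: geg i.+2 + (1 - gegrec i) *: geg i.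
Proof.
apply/polyP => r; rewrite coefXM coefD !coefZ.
case: (boolP (odd (i + r))) => o.
  rewrite (@coef_geg_eq0 i.+2) ?(@coef_geg_eq0 i) ?mulr0 ?addr0//.
  - case: r o => [|r] o //=; rewrite coef_geg_eq0//.
    by case: (ltnP i.+1 r) => //= h; rewrite subSn // ; move: o; lia.
  - by move: o; lia.
  - by move: o; lia.
case: (ltnP i.+2 r) => ri.
  rewrite (@coef_geg_eq0 i.+2) ?ri// (@coef_geg_eq0 i) ?(ltn_trans _ ri)// !mulr0 addr0.
  by case: r ri {o} => // r ri /=; rewrite coef_geg_eq0// -ltnS ri.
have [k ik] : exists k, i.+2 = (r + k.*2)%N.
  by exists (i.+2 - r)./2; rewrite even_halfK ?subnKC// oddB//= negbK -oddD.
case: k ik => [|k] ik.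
  rewrite addn0 in ik; rewrite -ik /= (@coef_geg_eq0 i i.+2) ?mulr0 ?addr0; last by lia.
  have := coef_geg 0 i.+1; have := coef_geg 0 i.+2; rewrite !addn0 => -> ->.
  exact: geg_coef_rec0.
have iE : i = (r + k.*2)%N by move: ik; rewrite doubleS; lia.
rewrite ik iE !coef_geg; case: r {ri o ik iE} => [|r] /=; first exact: geg_coef_rec1.
have -> : (r.+1 + k.*2).+1 = (r + k.+1.*2)%N by rewrite doubleS; lia.
by rewrite coef_geg geg_coef_rec.
Qed.

Lemma geg_coef_ode k r : (r.+2 * r.+1)%:R * geg_coef k r.+2 =
  - (4 * k.+1%:R * (r%:R + k.+1%:R + lam)) * geg_coef k.+1 r.
Proof.
rewrite !geg_coefE ?addnS// addSn /= pochS !natr_factS !exprS natrM -!natr1 natrD.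
have h1 := fact_neq0 R r; have h2 := fact_neq0 R k.
have lamp := lam0; have [u <- hu] := natR_gen r; have [v <- hv] := natR_gen k.
by field; rewrite h1 h2 /= !gt_eqF//; lra.
Qed.

Lemma geg_ode i : (1 - 'X^2) * (geg i)^`()^`() - (2 * lam + 1) *: ('X * (geg i)^`())
  + (i%:R * (i%:R + 2 * lam)) *: geg i = 0.
Proof.
apply/polyP => r; rewrite coef0 mulrBl mul1r coefD !coefB !coefZ coefXnM coefXM !coef_deriv.
have -> : (if (r < 2)%N then 0 else (geg i)`_(r - 2).+2 *+ (r - 2).+2 *+ (r - 2).+1)
   = (geg i)`_r * (r%:R * (r%:R - 1)).
  case: r => [|[|r]] /=; rewrite ?mul0r ?mulr0 ?subrr ?mulr0//.
  by rewrite ?subSS ?subn0 -[_ *+ r.+2]mulr_natr -[_ *+ r.+1]mulr_natr -!natr1; ring.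
have -> : (if (r == 0)%N then 0 else (geg i)`_(r.-1).+1 *+ (r.-1).+1) = (geg i)`_r * r%:R.
  by case: r => [|r] /=; rewrite ?mulr0// mulr_natr.
rewrite -mulrnA -[_ *+ (r.+2 * r.+1)]mulr_natr.
case: (boolP (odd (i + r))) => o.
  by rewrite (coef_geg_odd o) (@coef_geg_odd i r.+2) ?addnS /= ?negbK//; ring.
case: (ltnP i r) => ri.
  by rewrite (@coef_geg_eq0 i r) ?ri// (@coef_geg_eq0 i r.+2) ?leqW//; ring.
have [k ->] : exists k, i = (r + k.*2)%N.
  by exists (i - r)./2; rewrite even_halfK ?subnKC// oddB// -oddD.
case: k => [|k].
  rewrite addn0 (@coef_geg_eq0 r r.+2); last by lia.
  by ring.
have -> : (r + k.+1.*2 = r.+2 + k.*2)%N by rewrite doubleS; lia.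
rewrite {1}coef_geg mulrC geg_coef_ode.
have -> : (r.+2 + k.*2 = r + k.+1.*2)%N by rewrite doubleS; lia.
rewrite coef_geg -mul2n natrD natrM; ring.
Qed.

Lemma gegrec_gt0 i : 0 < gegrec i.+1.
Proof. by rewrite divr_gt0// mulr_gt0// ltr_pwDl. Qed.

Lemma gegrec_le i : gegrec i <= 2^-1.
Proof.
rewrite /gegrec; case: i => [|i]; first by rewrite mul0r.
have lamp := lam0; have h : 0 < i.+1%:R :> R by [].
rewrite ler_pdivrMr; last by rewrite mulr_gt0// ltr_pwDl.
by rewrite mulrA mulVf// mul1r lerDl.
Qed.

Definition geg_at1 i : R := \prod_(j < i) ((1 - gegrec j) / gegrec j.+1).

Lemma geg_at1S i : geg_at1 i.+1 = geg_at1 i * ((1 - gegrec i) / gegrec i.+1).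
Proof. by rewrite /geg_at1 big_ord_recr. Qed.

Lemma geg_at1_gt0 i : 0 < geg_at1 i.
Proof.
by apply: prodr_gt0 => j _; rewrite divr_gt0 ?gegrec_gt0//; have := gegrec_le j; lra.
Qed.

Lemma geg0E : geg 0 = 1.
Proof.
apply/polyP => -[|r]; last by rewrite coef1 coef_geg_eq0.
by have := coef_geg 0 0; rewrite coef1 => ->; rewrite /geg_coef/= !expr0 fact0 !mulr1 divr1.
Qed.

(** At z = 1 the three-term recurrence is solved by any sequence with [gegrec] (i+1) w_(i+1) = (1 -
    [gegrec] i) w_i, a relation of first order. *)
Lemma geg_1 i : (geg i).[1] = geg_at1 i.
Proof.
suff : (geg i).[1] = geg_at1 i /\ (geg i.+1).[1] = geg_at1 i.+1 by case.
have g0 j : gegrec j.+1 != 0 by rewrite gt_eqF// gegrec_gt0.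
elim: i => [|i [IH1 IH2]].
  have z0 : (geg 0).[1] = 1 by rewrite geg0E hornerC.
  split; first by rewrite z0 /geg_at1 big_ord0.
  have /(congr1 (fun p => p.[1])) := geg_rec0.
  rewrite hornerM hornerX hornerZ z0 mul1r => h.
  rewrite geg_at1S /geg_at1 big_ord0 mul1r /(gegrec 0) mul0r subr0.
  by apply: (mulfI (g0 0%N)); rewrite -h; field; rewrite g0.
split=> //; have /(congr1 (fun p => p.[1])) := geg_rec i.
rewrite hornerM hornerX hornerD !hornerZ IH1 IH2 mul1r => h.
have h2 : geg_at1 i * (1 - gegrec i) = geg_at1 i.+1 * gegrec i.+1.
  by rewrite geg_at1S; field; rewrite g0.
rewrite [in RHS]geg_at1S; apply: (mulfI (g0 i.+1)).
transitivity (geg_at1 i.+1 - (1 - gegrec i) * geg_at1 i); first by rewrite {1}h; ring.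
by rewrite [(1 - _) * _]mulrC h2; field; rewrite g0.
Qed.

Lemma geg_parity i x : `|(geg i).[- x]| = `|(geg i).[x]|.
Proof.
have -> : (geg i).[- x] = (-1) ^+ i * (geg i).[x].
  rewrite !horner_coef mulr_sumr; apply: eq_bigr => r _.
  rewrite [(- x) ^+ r]exprNn; case: (boolP (odd (i + r))) => o.
    by rewrite coef_geg_odd// !mul0r mulr0.
  have -> : (-1) ^+ i = (-1) ^+ r :> R.
    by rewrite -signr_odd -[RHS]signr_odd; move: o; rewrite oddD; case: (odd i); case: (odd r).
  ring.
by rewrite normrM normrX normrN1 expr1n mul1r.
Qed.

(* Sonin's argument: [c Y^2 + (1-x^2) Y'^2] is nondecreasing on [0, 1] by the
   differential equation. *)
Lemma geg_le1 i x : -1 <= x <= 1 -> `|(geg i).[x]| <= `|(geg i).[1]|.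
Proof.
wlog hx : x / 0 <= x.
  move=> H hx; have [x0|x0] := leP 0 x; first exact: H.
  by rewrite -geg_parity; apply: H; [lra|move/andP: hx => [? ?]; apply/andP; split; lra].
move=> /andP[_ x1]; case: i => [|i].
  have -> : geg 0 = ((geg 0)`_0)%:P by apply: size1_polyC; rewrite size_poly.
  by rewrite !hornerC.
pose c : R := i.+1%:R * (i.+1%:R + 2 * lam).
have lamp := lam0; have c0 : 0 < c by rewrite mulr_gt0// ltr_pwDl// mulr_ge0.
pose Y := geg i.+1.
pose F := c *: Y ^+ 2 + (1 - 'X^2) * Y^`() ^+ 2.
have dF : F^`() = (4 * lam) *: ('X * Y^`() ^+ 2).
  have d2 (p : {poly R}) : (p ^+ 2)^`() = 2 *: (p * p^`()).
    by rewrite expr2 derivM [p^`() * p]mulrC -mulr2n scaler_nat.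
  rewrite /F derivD derivZ [((1 - 'X^2) * _)^`()]derivM !d2 derivB derivC ?d2 derivX mulr1 sub0r.
  have E : (1 - 'X^2) * Y^`()^`() = (2 * lam + 1) *: ('X * Y^`()) - c *: Y.
    by have := geg_ode i.+1; rewrite -/Y -/c => /eqP; rewrite addr_eq0 subr_eq => /eqP ->; rewrite addrC.
  have -> : (1 - 'X^2) * (2 *: (Y^`() * Y^`()^`())) =
     2 *: (Y^`() * ((1 - 'X^2) * Y^`()^`())).
    by rewrite -!scalerAr; congr (_ *: _); ring.
  rewrite E -!mul_polyC !polyCD !polyCM.
  ring.
have mono : F.[x] <= F.[1].
  apply: (@ger0_derive1_le_cc _ (horner F) 0 1) => //.
  - move=> t; rewrite in_itv/= => /andP[t0 t1].
    rewrite derive1E derive_val dF hornerZ hornerM hornerX horner_exp.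
    by apply: mulr_ge0; [exact: mulr_ge0|apply: mulr_ge0; [exact: ltW|exact: sqr_ge0]].
  - apply: continuous_subspaceT => t; exact: continuous_horner.
  - by rewrite in_itv/= hx.
  - by rewrite in_itv/= ler01 lexx.
have FE t : F.[t] = c * Y.[t] ^+ 2 + (1 - t ^+ 2) * Y^`().[t] ^+ 2.
  by rewrite /F !hornerE; ring.
have : c * Y.[x] ^+ 2 <= c * Y.[1] ^+ 2.
  move: mono; rewrite !FE expr1n subrr mul0r addr0; apply: le_trans.
  by rewrite lerDl mulr_ge0 ?sqr_ge0// subr_ge0 exprn_ile1.
rewrite ler_pM2l// => h; rewrite -(@ler_pXn2r _ 2)// ?nnegrE//.
by rewrite !real_normK ?num_real.
Qed.

(** Passes through exp(1/(m+2)) <= (m+2)/(m+1). The right-hand sides telescope in the product for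
    [geg_at1]. *)
Lemma ratio_powR (m : nat) : 1 + 2 * lam / m.+2%:R <= (m.+2%:R / m.+1%:R) `^ (2 * lam).
Proof.
have h : expR (m.+2%:R^-1) <= m.+2%:R / m.+1%:R :> R.
  rewrite -[X in X <= _]invrK -expRN -[X in _ <= X]invrK invfM invrK.
  rewrite lef_pV2 ?posrE ?expR_gt0 ?mulr_gt0//.
  apply: (le_trans _ (expR_ge1Dx _)).
  have -> : m.+1%:R = m.+2%:R - 1 :> R by rewrite -[m.+2%:R]natr1 addrK.
  by rewrite mulrBr mulVf ?pnatr_eq0// mulr1.
apply: (@le_trans _ _ (expR (m.+2%:R^-1) `^ (2 * lam))).
  by rewrite -expRM mulrC (le_trans _ (expR_ge1Dx _)).
by rewrite ge0_ler_powR ?mulr_ge0 ?nnegrE ?expR_ge0 ?divr_ge0.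
Qed.

Lemma geg_at1_le m : geg_at1 m.+2 <= geg_at1 2 * ((m.+2%:R + lam) / m.+2%:R) * m.+1%:R `^ (2 * lam).
Proof.
have lamp := lam0.
elim: m => [|m IH].
  rewrite powR1 mulr1 ler_peMr ?(ltW (geg_at1_gt0 _))// ler_pdivlMr// mul1r lerDl//.
rewrite geg_at1S.
have -> : (1 - gegrec m.+2) / gegrec m.+3 = (m.+2%:R / (m.+2%:R + lam)) * ((m.+3%:R + lam) / m.+3%:R) * (1 + 2 * lam / m.+2%:R).
  rewrite /gegrec -[m.+3%:R]natr1; have h : 0 < m.+2%:R :> R by [].
  move: (m.+2%:R) h => t h; field; rewrite !gt_eqF//; lra.
have h2 : 0 < m.+2%:R + lam by rewrite ltr_pwDl.
have h3 : 0 < m.+3%:R + lam by rewrite ltr_pwDl.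
have r0 : 0 <= (m.+2%:R / (m.+2%:R + lam)) * ((m.+3%:R + lam) / m.+3%:R).
  by rewrite mulr_ge0 ?divr_ge0// ltW.
apply: (@le_trans _ _ (geg_at1 2 * ((m.+2%:R + lam) / m.+2%:R) * m.+1%:R `^ (2 * lam) *
   ((m.+2%:R / (m.+2%:R + lam)) * ((m.+3%:R + lam) / m.+3%:R) * ((m.+2%:R / m.+1%:R) `^ (2 * lam))))).
  apply: ler_pM => //; first exact: ltW (geg_at1_gt0 _).
    by rewrite mulr_ge0// addr_ge0// divr_ge0// mulr_ge0.
  by rewrite ler_wpM2l// ratio_powR.
have -> : m.+2%:R `^ (2 * lam) = m.+1%:R `^ (2 * lam) * (m.+2%:R / m.+1%:R) `^ (2 * lam) :> R.
  by rewrite -powRM ?divr_ge0//; congr (_ `^ _); rewrite mulrC divfK ?pnatr_eq0.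
rewrite le_eqVlt; apply/orP; left; apply/eqP.
by field; rewrite !gt_eqF// ltr_pwDl// ltr_pwDl.
Qed.

Lemma geg_at1_bound : exists2 C : R, 0 <= C & forall i, geg_at1 i <= C * i.+1%:R `^ (2 * lam).
Proof.
have w0 i := ltW (geg_at1_gt0 i).
have lam2 : 0 <= 2 * lam by rewrite mulr_ge0.
have p1 i : 1 <= i.+1%:R `^ (2 * lam) :> R.
  by have {1}-> : 1 = 1 `^ (2 * lam) :> R by [rewrite powR1]; rewrite ge0_ler_powR ?nnegrE// ler1n.
exists (geg_at1 0 + geg_at1 1 + geg_at1 2 * (1 + lam)); first by rewrite !addr_ge0// mulr_ge0// addr_ge0.
case=> [|[|m]].
- rewrite (le_trans _ (ler_peMr _ (p1 _)))// ?addr_ge0 ?mulr_ge0 ?addr_ge0//.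
  by rewrite -addrA lerDl addr_ge0 ?mulr_ge0 ?addr_ge0.
- rewrite (le_trans _ (ler_peMr _ (p1 _)))// ?addr_ge0 ?mulr_ge0 ?addr_ge0//.
  by rewrite addrAC lerDr addr_ge0 ?mulr_ge0 ?addr_ge0.
apply: (le_trans (geg_at1_le m)); apply: ler_pM; rewrite ?powR_ge0//.
- by rewrite mulr_ge0// divr_ge0// addr_ge0.
- apply: (@le_trans _ _ (geg_at1 2 * (1 + lam))); last by rewrite lerDr addr_ge0.
  rewrite ler_wpM2l// mulrDl divff// lerD2l ler_pdivrMr// ler_peMr// ler1n//.
- by rewrite ge0_ler_powR ?nnegrE// ler_nat leqW// leqW.
Qed.

End Gegenbauer.

(** * Summation by parts *)

Section Sequences.
Variable R : realType.
Implicit Types (u v s : nat -> R) (b : nat -> nat -> R).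

Definition fdiff u (i : nat) : R := u i.+1 - u i.

Lemma fdiff_ext r u v i : (forall j, (i <= j <= i + r)%N -> u j = v j) ->
  iter r fdiff u i = iter r fdiff v i.
Proof.
elim: r i => [|r IH] i h /=; first by apply: h; rewrite addn0 leqnn.
rewrite /fdiff !IH// => j hj; apply: h; lia.
Qed.

Lemma fdiff_shift r u i : iter r fdiff (fun j => u j.+1) i = iter r fdiff u i.+1.
Proof. by elim: r i => //= r IH i; rewrite /fdiff !IH. Qed.

Lemma fdiff_shiftn r u i : iter r fdiff u i = iter r fdiff (fun j => u (i + j)%N) 0.
Proof.
elim: i u => [//|i IH] u.
by rewrite -fdiff_shift IH; apply: fdiff_ext => j _; rewrite addSn.
Qed.

Lemma fdiff_lin r c u v i :
  iter r fdiff (fun j => u j + c * v j) i = iter r fdiff u i + c * iter r fdiff v i.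
Proof. by elim: r i => //= r IH i; rewrite /fdiff !IH; ring. Qed.

Lemma fdiff_cst r c i : iter r.+1 fdiff (fun=> c) i = 0.
Proof.
elim: r i => [|r IH] i; first by rewrite /= /fdiff subrr.
by rewrite iterS {1}/fdiff !IH subrr.
Qed.

(* Families vanishing to infinite order at [i / N = 0], of size [N ^- p],
   each difference gaining a factor [N^-1]. *)
Definition flat p b := forall r M, exists2 C : R, 0 <= C & forall N i, (0 < N)%N ->
  `|iter r fdiff (b N) i| * N%:R ^+ (p + r + M) <= C * i.+1%:R ^+ M.

(* Symbols of order [-q]. *)
Definition symbol q s := forall r, exists2 C : R, 0 <= C & forall i,
  `|iter r fdiff s i| * i.+1%:R ^+ (q + r) <= C.

Lemma flat_dif p b : flat p b -> flat p.+1 (fun N => fdiff (b N)).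
Proof.
move=> h r M; have [C C0 hC] := h r.+1 M; exists C => // N i N0.
by have := hC N i N0; rewrite iterSr addnS addSn.
Qed.

Lemma symbol_dif q s : symbol q s -> symbol q.+1 (fdiff s).
Proof.
move=> h r; have [C C0 hC] := h r.+1; exists C => // i.
by have := hC i; rewrite iterSr addnS addSn.
Qed.

Lemma flat_lin p b b' c : flat p b -> flat p b' -> flat p (fun N i => b N i + c * b' N i).
Proof.
move=> h h' r M; have [C C0 hC] := h r M; have [C' C0' hC'] := h' r M.
exists (C + `|c| * C'); first by rewrite addr_ge0 ?mulr_ge0.
move=> N i N0; rewrite fdiff_lin mulrDl.
apply: (@le_trans _ _ ((`|iter r fdiff (b N) i| + `|c| * `|iter r fdiff (b' N) i|) * N%:R ^+ (p + r + M))).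
  by rewrite ler_wpM2r ?exprn_ge0// (le_trans (ler_normD _ _))// normrM.
by rewrite mulrDl lerD ?hC// -mulrA -[X in _ <= X]mulrA ler_wpM2l ?hC'.
Qed.

Lemma flat_weak p b : flat p.+1 b -> flat p b.
Proof.
move=> h r M; have [C C0 hC] := h r M; exists C => // N i N0.
apply: le_trans (hC N i N0); rewrite ler_wpM2l// !addSn exprS ler_peMl ?exprn_ge0// ler1n//.
Qed.

Lemma flat_shift p b : flat p b -> flat p (fun N i => b N i.+1).
Proof.
move=> h r M; have [C C0 hC] := h r M; exists (C * 2 ^+ M); first by rewrite mulr_ge0 ?exprn_ge0.
move=> N i N0; rewrite fdiff_shift (le_trans (hC N i.+1 N0))// -mulrA ler_wpM2l// -exprMn.
by rewrite lerXn2r ?nnegrE ?mulr_ge0// -natrM ler_nat; lia.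
Qed.

(** The predecessor is truncated at 0, so differences starting at 0 need a bound of their own. There
    a difference seems to gain nothing, but at [i = 0] flatness supplies any power of N^-1: the
    induction on [r] raises [M] instead. *)
Lemma flat_pred p b : flat p b -> flat p (fun N i => b N i.-1).
Proof.
move=> h r M.
have S N r' i : iter r' fdiff (fun i => b N i.-1) i.+1 = iter r' fdiff (b N) i.
  by rewrite -fdiff_shift.
have [C C0 hC] := h r M.
have [K K0 hK] : exists2 K : R, 0 <= K & forall N, (0 < N)%N ->
    `|iter r fdiff (fun i => b N i.-1) 0| * N%:R ^+ (p + r + M) <= K.
  elim: r M {C C0 hC} => [|r IH] M.
    have [C C0 hC] := h 0%N M; exists C => // N N0.
    by have := hC N 0%N N0; rewrite expr1n mulr1.
  have [K K0 hK] := IH M.+1; have [C C0 hC] := h r M.+1.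
  exists (C + K); first by rewrite addr_ge0.
  move=> N N0; rewrite /= {1}/fdiff S.
  rewrite (_ : (p + r.+1 + M = p + r + M.+1)%N); last by lia.
  apply: (@le_trans _ _ ((`|iter r fdiff (b N) 0| + `|iter r fdiff (fun i => b N i.-1) 0|) * N%:R ^+ (p + r + M.+1))).
    by rewrite ler_wpM2r ?exprn_ge0// ler_normB.
  by rewrite mulrDl lerD ?hK//; have := hC N 0%N N0; rewrite expr1n mulr1.
exists (C + K); first by rewrite addr_ge0.
move=> N [|i] N0; first by rewrite expr1n mulr1 (le_trans (hK N N0))// lerDr.
rewrite S (le_trans (hC N i N0))//; apply: ler_pM; rewrite ?exprn_ge0 ?lerDl//.
by rewrite lerXn2r ?nnegrE// ler_nat.
Qed.

(** Flatness trades powers of i+1 for powers of N, so decay of the symbol in [i] becomes decay in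
    [N]: apply the bound on [b] with [M + q]. Differences follow by the Leibniz rule. *)
Lemma flat_mul q p s b : symbol q s -> flat p b -> flat (q + p) (fun N i => s i * b N i).
Proof.
move=> hs hb r; elim: r q p s b hs hb => [|r IH] q p s b hs hb M.
  have [C C0 hC] := hs 0%N; have [K K0 hK] := hb 0%N (M + q)%N.
  exists (C * K); first exact: mulr_ge0.
  move=> N i N0; rewrite /= normrM.
  have := hC i; have := hK N i N0; rewrite /= !addn0 => h1 h2.
  rewrite (_ : (q + p + M = p + (M + q))%N); last by lia.
  have P : 0 < i.+1%:R ^+ q :> R by rewrite exprn_gt0.
  rewrite -(ler_pM2r P); apply: (@le_trans _ _ ((`|s i| * i.+1%:R ^+ q) * (`|b N i| * N%:R ^+ (p + (M + q))))).
    by rewrite le_eqVlt; apply/orP; left; apply/eqP; ring.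
  apply: (le_trans (ler_pM _ _ h2 h1)); rewrite ?mulr_ge0 ?exprn_ge0//.
  by rewrite le_eqVlt; apply/orP; left; apply/eqP; rewrite exprD; ring.
have [C C0 hC] := IH _ _ _ _ (symbol_dif hs) (flat_shift hb) M.
have [K K0 hK] := IH _ _ _ _ hs (flat_dif hb) M.
exists (C + K); first exact: addr_ge0.
move=> N i N0; rewrite iterSr.
have -> : iter r fdiff (fdiff (fun j => s j * b N j)) i =
    iter r fdiff (fun j => fdiff s j * b N j.+1) i + 1 * iter r fdiff (fun j => s j * fdiff (b N) j) i.
  by rewrite -fdiff_lin; apply: fdiff_ext => j _; rewrite /fdiff; ring.
rewrite mul1r; have h1 := hC N i N0; have h2 := hK N i N0.
rewrite (_ : (q + p + r.+1 + M = q.+1 + p + r + M)%N); last by lia.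
rewrite (_ : (q + p.+1 + r + M = q.+1 + p + r + M)%N) in h2; last by lia.
apply: (le_trans (ler_wpM2r (exprn_ge0 _ (ler0n R N)) (ler_normD _ _))).
by rewrite mulrDl mulrDl lerD.
Qed.

End Sequences.

(** * The difference operator dual to multiplication by [1 - z] *)

Section Localization.
Variables (R : realType) (lam : R).
Hypothesis lam0 : 0 <= lam.
Local Notation gegrec := (gegrec lam).
Implicit Types (u v s : nat -> R) (b : nat -> nat -> R).

(** The deviation of the recurrence from that of the Chebyshev polynomials; it is of order 1/i. *)
Definition theta i : R := 1 - 2 * gegrec i.

Lemma thetaE i : (0 < i)%N -> theta i = lam / (i%:R + lam).
Proof.
move=> i0; have h : i%:R + lam != 0 by rewrite gt_eqF// ltr_pwDl// ltr0n.
by rewrite /theta /gegrec; field.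
Qed.

Lemma fdiff_theta r i : (0 < i)%N -> iter r (@fdiff R) theta i =
  lam * (-1) ^+ r * r`!%:R / poch (i%:R + lam) r.+1.
Proof.
elim: r i => [|r IH] i i0.
  by rewrite /= thetaE// expr0 fact0 !mulr1 pochS poch0 mul1r addr0.
have p1 : 0 < i%:R + lam by rewrite ltr_pwDl// ltr0n.
rewrite /= /fdiff !IH// [poch (i%:R + lam) r.+2]pochSl [poch (i%:R + lam) r.+1]pochSl.
rewrite [poch (i.+1%:R + lam) r.+1]pochS.
have -> : i.+1%:R + lam = i%:R + lam + 1 by rewrite -natr1; ring.
have q := poch_gt0 r (ltr_wpDr ler01 p1).
rewrite [poch _ r.+1]pochS factS natrM exprS -natr1.
have p2 : 0 < i%:R + lam + 1 + r%:R by rewrite ltr_pwDl// ltr_pwDl.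
by field; rewrite !gt_eqF.
Qed.

Lemma symbol_theta : symbol 1 theta.
Proof.
move=> r; pose K := lam * r`!%:R * 2 ^+ r.+1.
have K0 : 0 <= K by rewrite !mulr_ge0 ?exprn_ge0.
exists (`|iter r (@fdiff R) theta 0| + K); first by rewrite addr_ge0.
case=> [|i]; first by rewrite expr1n mulr1 lerDl.
rewrite fdiff_theta// (@le_trans _ _ K) ?lerDr// add1n.
have P : i.+1%:R ^+ r.+1 <= poch (i.+1%:R + lam) r.+1.
  rewrite -[r.+1 in X in X <= _]card_ord -prodr_const; apply: ler_prod => j _.
  by rewrite ler0n /= -addrA lerDl addr_ge0.
have P0 : 0 < poch (i.+1%:R + lam) r.+1 by apply: poch_gt0; rewrite ltr_pwDl.
rewrite !normrM normrX normrN1 expr1n mulr1 normfV (ger0_norm lam0) (ger0_norm (ltW P0)) ger0_norm//.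
rewrite mulrAC ler_pdivrMr// /K -!mulrA ler_wpM2l// ler_wpM2l//.
apply: (@le_trans _ _ (2 ^+ r.+1 * i.+1%:R ^+ r.+1)); last by rewrite ler_wpM2l ?exprn_ge0.
rewrite -exprMn lerXn2r ?nnegrE ?mulr_ge0//.
by rewrite -natrM ler_nat; lia.
Qed.

(* The adjoint, under summation against [geg], of multiplication by [1 - z]. *)
Definition dlaplace u i : R := - ((1 - gegrec i) * fdiff u i - gegrec i * fdiff u i.-1).

(** With D = [fdiff u], the operator is -1/2 [(D_i - D_(i-1)) + theta_i (D_i + D_(i-1))]: a second
    difference plus a symbol of order -1 times first differences. Both gain one power of N^-1 over
    D. *)
Lemma flat_dlaplace p b : flat p (fun N => fdiff (b N)) -> flat p.+1 (fun N => dlaplace (b N)).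
Proof.
move=> h; have h1 := flat_mul symbol_theta h.
have h2 := flat_dif (flat_pred h).
have h3 := flat_weak (flat_mul symbol_theta h2).
have := flat_lin (- 2^-1) (flat_lin 2^-1 (flat_lin (-2) h1 h1) h3) h2.
rewrite add1n; congr flat; apply/funext => N; apply/funext => i.
by rewrite /dlaplace /fdiff /theta; field.
Qed.

Lemma flat_iter_dlaplace b k : flat 1 (fun N => fdiff (b N)) -> flat k.*2.+2 (fun N => iter k.+1 dlaplace (b N)).
Proof.
move=> h; elim: k => [|k IH]; first exact: flat_dlaplace.
by rewrite doubleS; apply: (@flat_dlaplace _ (fun N => iter k.+1 dlaplace (b N))); exact: flat_dif.
Qed.

Lemma dlaplace_supp u B : (forall i, (B <= i)%N -> u i = 0) -> forall i, (B.+1 <= i)%N -> dlaplace u i = 0.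
Proof.
move=> h [|i] // hi; rewrite /dlaplace /fdiff /= (h i.+2) ?(h i.+1) ?(h i) ?(leqW hi) ?(ltnW hi) //.
  by rewrite subrr !mulr0 subrr oppr0.
by do 2 apply: leqW.
Qed.

Lemma iter_dlaplace_supp u B k : (forall i, (B <= i)%N -> u i = 0) ->
  forall i, (B + k <= i)%N -> iter k dlaplace u i = 0.
Proof.
move=> h; elim: k => [|k IH] i; first by rewrite addn0; exact: h.
by rewrite addnS; exact: (dlaplace_supp IH).
Qed.

(** The recurrence moves multiplication by [z] onto the coefficients; the two vanishing conditions
    remove the boundary terms. *)
Lemma dlaplace_sum u L z : u L = 0 -> u L.+1 = 0 ->
  (1 - z) * \sum_(i < L.+1) u i * (geg lam i).[z] = \sum_(i < L.+1) dlaplace u i * (geg lam i).[z].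
Proof.
move=> uL uL1; pose g i := (geg lam i).[z].
have g0 : gegrec 0 = 0 by exact: mul0r.
have r0 : z * g 0%N = gegrec 1 * g 1%N.
  have /(congr1 (fun p => p.[z])) := geg_rec0 lam0.
  by rewrite hornerM hornerX hornerZ.
have r1 i : z * g i.+1 = gegrec i.+2 * g i.+2 + (1 - gegrec i) * g i.
  have /(congr1 (fun p => p.[z])) := geg_rec lam0 i.
  by rewrite hornerM hornerX hornerD !hornerZ.
have K l : \sum_(i < l.+1) u i * (z * g i) =
  \sum_(i < l.+1) (gegrec i * u i.-1 + (1 - gegrec i) * u i.+1) * g i
  + u l * gegrec l.+1 * g l.+1 - u l.+1 * (1 - gegrec l) * g l.
  elim: l => [|l IH].
    by rewrite !big_ord1 /= r0 g0; ring.
  by rewrite big_ord_recr [in RHS]big_ord_recr /= IH r1; ring.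
have := K L; rewrite uL uL1 !mul0r addr0 subr0 => H.
transitivity (\sum_(i < L.+1) u i * g i - \sum_(i < L.+1) u i * (z * g i)).
  by rewrite mulrBl mul1r; congr (_ - _); rewrite mulr_sumr; apply: eq_bigr => i _; rewrite mulrCA.
rewrite H -sumrB; apply: eq_bigr => i _.
rewrite /dlaplace /fdiff -/(g i); case: i => [[|i] /= _]; last by ring.
by rewrite g0; ring.
Qed.

End Localization.

(** * Localization of the univariate kernel *)

Section Cutoff.
Variable R : realType.

Lemma is_derive_fdiff (f df : R -> R) h r i (x : R) :
  (forall t : R, is_derive t 1 f (df t)) ->
  is_derive x 1 (fun x => iter r (@fdiff R) (fun j => f (x + j%:R * h)) i)
    (iter r (@fdiff R) (fun j => df (x + j%:R * h)) i).
Proof.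
move=> hf; elim: r i => [|r IH] i /=.
  have H2 : is_derive x 1 (fun x : R => x + i%:R * h) 1.
    by apply: is_derive_eq; rewrite addr0.
  by have := @is_derive1_comp _ f (fun x => x + i%:R * h) _ _ _ (hf _) H2; rewrite mulr1.
have := is_deriveB (IH i.+1) (IH i).
by apply.
Qed.

(** The mean value theorem, applied to the lower-order difference as a function of its base point,
    turns one difference into [h] times a derivative; after [r] rounds only the maximum of the
    [r]-th derivative on [0, T] remains. *)
Lemma fdiff_bound (g : R -> R) (T : R) : (forall k t, derivable (derive1n k g) t 1) ->
  0 <= T -> forall r, exists2 C : R, 0 <= C & forall x h, 0 < h -> 0 <= x ->
    x + r%:R * h <= T ->
    `|iter r (@fdiff R) (fun j => g (x + j%:R * h)) 0| <= C * h ^+ r.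
Proof.
move=> gs T0 r.
have cont k (t : R) : {for t, continuous (derive1n k g)}.
  by apply/differentiable_continuous/derivable1_diffP.
have [C C0 hC] : exists2 C : R, 0 <= C & forall t, 0 <= t <= T -> `|derive1n r g t| <= C.
  have [c _ hc] := @EVT_max R (fun t => `|derive1n r g t|) 0 T T0
    (continuous_subspaceT (fun t => continuous_comp (cont r t) (@norm_continuous _ _ _))).
  exists `|derive1n r g c| => //.
exists C => // x h h0 x0 xT.
have D k (t : R) : is_derive t 1 (derive1n k g) (derive1n k.+1 g t).
  by split=> //; rewrite derive1nS -derive1E.
have G n k y : (n + k = r)%N -> 0 <= y -> y + n%:R * h <= T ->
    `|iter n (@fdiff R) (fun j => derive1n k g (y + j%:R * h)) 0| <= C * h ^+ n.
  elim: n k y => [|n IH] k y.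
    rewrite add0n mul0r addr0 => -> y0 yT; rewrite /= mul0r addr0 mulr1.
    by apply: hC; rewrite y0.
  move=> nk y0 yT.
  pose V (x : R) := iter n (@fdiff R) (fun j => derive1n k g (x + j%:R * h)) 0.
  pose dV (x : R) := iter n (@fdiff R) (fun j => derive1n k.+1 g (x + j%:R * h)) 0.
  have VD (t : R) : is_derive t 1 V (dV t) by apply: is_derive_fdiff.
  have yh : y < y + h by rewrite ltrDl.
  have [|c] := @MVT R V dV y (y + h) yh (fun t _ => VD t).
    apply: continuous_subspaceT => t; apply/differentiable_continuous/derivable1_diffP.
    exact: ex_derive.
  rewrite in_itv/= => /andP[yc cy] Vc.
  rewrite [X in `|X|](_ : _ = V (y + h) - V y); last first.
    have -> : V (y + h) - V y = V (y + h) + -1 * V y by rewrite mulN1r.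
    rewrite /V -fdiff_lin -[fdiff (iter _ _ _)]/(iter n.+1 _ _) iterSr; apply: fdiff_ext => j _.
    by rewrite /fdiff mulN1r -addrA -[j.+1%:R]nat1r mulrDl mul1r.
  rewrite Vc addrAC subrr add0r normrM (gtr0_norm h0) exprSr mulrA ler_wpM2r ?(ltW h0)//.
  apply: IH; first by rewrite addnS -addSn.
    exact: le_trans (ltW yc).
  apply: le_trans yT; rewrite -natr1 mulrDl mul1r; lra.
by apply: (G r 0%N) => //; rewrite addn0.
Qed.

(** Every admissible cutoff is constant on [0, 1/2), so differences vanish unless N <= 2(i + r + 1)
    <= 2(r+1)(i+1). In that range powers of N are bounded by powers of i+1, which is flatness. *)
Lemma flat_cutoff (a : R -> R) : admissible a ->
  flat 1 (fun N => fdiff (fun i => a (i%:R / N%:R))) /\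
  (exists2 C : R, 0 <= C & forall N i, (0 < N)%N -> `|a (i%:R / N%:R)| <= C) /\
  (forall N i, (0 < N)%N -> (2 * N < i)%N -> a (i%:R / N%:R) = 0).
Proof.
move=> adm.
have [sm a2 [c ac]] : [/\ smooth_on_nonneg a, forall t, 2 < t -> a t = 0 &
    exists c, forall t, 0 <= t -> t < 2^-1 -> a t = c].
  have cb : cutoff_b a -> [/\ smooth_on_nonneg a, forall t, 2 < t -> a t = 0 &
      exists c, forall t, 0 <= t -> t < 2^-1 -> a t = c].
    move=> [sm h]; split=> // [t t2|]; first by apply: h; [lra|right].
    by exists 0 => t t0 t2; apply: h => //; left.
  case: adm => [[sm [h1 h2]]|[/cb//|[/cb//]]].
  by split=> //; exists 1 => t t0 t2; apply: h2; apply/andP; split; lra.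
have [g [gs ga]] := sm.
have supp N i : (0 < N)%N -> (2 * N < i)%N -> a (i%:R / N%:R) = 0.
  by move=> N0 h; apply: a2; rewrite ltr_pdivlMr ?ltr0n// -natrM ltr_nat.
have F1 r : exists2 C : R, 0 <= C & forall N i, (0 < N)%N ->
    `|iter r (@fdiff R) (fun i => a (i%:R / N%:R)) i| * N%:R ^+ r <= C.
  (* The sample points start at i/N <= 2 and advance by at most r/N <= r, so they stay in
     [0, 2 + r]. *)
  have [C C0 hC] := fdiff_bound gs (addr_ge0 (ler0n R 2) (ler0n R r)) r.
  exists C => // N i N0; have N0' : 0 < N%:R :> R by rewrite ltr0n.
  case: (leqP i (2 * N)) => hi; last first.
    rewrite (@fdiff_ext _ _ _ (fun=> 0)); last by move=> j hj; rewrite supp//; lia.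
    have -> : iter r (@fdiff R) (fun=> 0) i = 0.
      by case: r {C C0 hC} => // r; rewrite fdiff_cst.
    by rewrite normr0 mul0r.
  have -> : iter r (@fdiff R) (fun i => a (i%:R / N%:R)) i =
     iter r (@fdiff R) (fun j => g (i%:R / N%:R + j%:R * N%:R^-1)) 0.
    rewrite (fdiff_shiftn r (fun i => a (i%:R / N%:R)) i).
    apply: fdiff_ext => j _; rewrite ga.
      by rewrite natrD mulrDl.
    by rewrite addr_ge0 ?divr_ge0// mulr_ge0.
  rewrite -ler_pdivlMr ?exprn_gt0// -exprVn; apply: hC; rewrite ?invr_gt0 ?divr_ge0//.
  rewrite -mulrDl ler_pdivrMr// -natrD -natrD -natrM ler_nat.
  nia.
split; last by split=> //; have [C C0 hC] := F1 0%N; exists C => // N i N0; have := hC N i N0; rewrite mulr1.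
move=> r M; have [C C0 hC] := F1 r.+1.
exists (C * (2 * r.+1%:R) ^+ M); first by rewrite mulr_ge0 ?exprn_ge0 ?mulr_ge0.
move=> N i N0; rewrite -iterSr; have N0' : 0 < N%:R :> R by rewrite ltr0n.
case: (ltnP (2 * (i + r.+1)) N) => h.
  rewrite (@fdiff_ext _ _ _ (fun=> c)); last first.
    move=> j /andP[_ jh]; apply: ac; rewrite ?divr_ge0// ltr_pdivrMr// mulrC ltr_pdivlMr// -natrM ltr_nat.
    by lia.
  by rewrite fdiff_cst normr0 mul0r !mulr_ge0 ?exprn_ge0 ?mulr_ge0.
rewrite add1n exprD mulrA -mulrA; rewrite -[X in _ <= X]mulrA.
rewrite mulrA; apply: ler_pM; rewrite ?mulr_ge0 ?exprn_ge0//; first exact: hC.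
rewrite -exprMn lerXn2r ?nnegrE ?mulr_ge0// -!natrM ler_nat.
nia.
Qed.

Lemma dlaplace_cutoff_bound (lam : R) (a : R -> R) k : 0 <= lam -> admissible a ->
  exists2 C : R, 0 <= C & forall N i, (0 < N)%N ->
    `|iter k (dlaplace lam) (fun i => a (i%:R / N%:R)) i| * N%:R ^+ (k.*2) <= C.
Proof.
move=> lam0 /flat_cutoff[fl [[C C0 hC] _]].
case: k => [|k]; first by exists C => // N i N0; rewrite mulr1 hC.
have [K K0 hK] := @flat_iter_dlaplace _ lam lam0 (fun N i => a (i%:R / N%:R)) k fl 0%N 0%N.
by exists K => // N i N0; have := hK N i N0; rewrite !addn0 mulr1.
Qed.

Definition geg_ker (lam : R) (a : R -> R) N : {poly R} :=
  \sum_(i < (2 * N).+1) a (i%:R / N%:R) *: geg lam i.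

Lemma geg_ker_bound (lam : R) (a : R -> R) k : 0 <= lam -> admissible a ->
  exists2 C : R, 0 <= C & forall N z, (0 < N)%N -> -1 <= z <= 1 ->
    `|(geg_ker lam a N).[z]| * (N%:R ^+ 2 * (1 - z)) ^+ k <= C * (N%:R * N%:R `^ (2 * lam)).
Proof.
move=> lam0 adm; have [_ [_ supp]] := flat_cutoff adm.
have [C C0 hC] := dlaplace_cutoff_bound k lam0 adm.
have [K K0 hK] := geg_at1_bound lam0.
have lam2 : 0 <= 2 * lam by rewrite mulr_ge0.
(* Chosen so that [L.+2], which is 2N + k + 3, is at most Q N. *)
pose Q : R := (k + 5)%:R.
exists (C * K * (Q * Q `^ (2 * lam))); first by rewrite !mulr_ge0 ?powR_ge0.
move=> N z N0 z1; have N0' : 0 < N%:R :> R by rewrite ltr0n.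
(* Each application of [dlaplace] widens the support by one index; the margin [k] keeps the boundary
   terms zero throughout. *)
pose u i := a (i%:R / N%:R); pose L := (2 * N + k).+1.
have us i : ((2 * N).+1 <= i)%N -> u i = 0 by move=> h; apply: supp.
have ME : (geg_ker lam a N).[z] = \sum_(i < L.+1) u i * (geg lam i).[z].
  rewrite /geg_ker horner_sum.
  have LB : ((2 * N).+1 <= L.+1)%N by rewrite /L; lia.
  rewrite (big_ord_widen L.+1 (fun i => (u i *: geg lam i).[z]) LB) big_mkcond.
  apply: eq_bigr => i _; rewrite hornerZ; case: ifP => //; rewrite ltnNge => /negbFE h.
  by rewrite us// mul0r.
have DE j : (j <= k)%N -> (1 - z) ^+ j * (geg_ker lam a N).[z] =
    \sum_(i < L.+1) iter j (dlaplace lam) u i * (geg lam i).[z].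
  elim: j => [|j IH] jk; first by rewrite mul1r ME.
  rewrite exprS -mulrA IH ?(ltnW jk)// dlaplace_sum//; (have jk1 : ((2 * N).+1 + j <= L)%N by rewrite /L; lia).
    exact: (@iter_dlaplace_supp R lam u _ j us L jk1).
  exact: (@iter_dlaplace_supp R lam u _ j us L.+1 (leqW jk1)).
rewrite exprMn mulrC -exprM mul2n -[X in X <= _]mulrA.
have z0 : 0 <= 1 - z by move/andP: z1 => [_ ?]; rewrite subr_ge0.
have -> : (1 - z) ^+ k * `|(geg_ker lam a N).[z]| = `|\sum_(i < L.+1) iter k (dlaplace lam) u i * (geg lam i).[z]|.
  by rewrite -DE// normrM (ger0_norm (exprn_ge0 _ z0)).
have LQ : L.+1.+1%:R <= Q * N%:R :> R by rewrite /Q /L -natrM ler_nat; nia.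
have T (i : 'I_L.+1) : N%:R ^+ k.*2 * `|iter k (dlaplace lam) u i * (geg lam i).[z]| <=
    C * (K * (Q * N%:R) `^ (2 * lam)).
  rewrite normrM [X in X <= _]mulrA; apply: ler_pM; rewrite ?mulr_ge0 ?exprn_ge0//.
    by rewrite mulrC; exact: (hC N i N0).
  apply: (le_trans (geg_le1 lam0 _ z1)); rewrite geg_1// ger0_norm ?(ltW (geg_at1_gt0 _ _))//.
  apply: (le_trans (hK i)); rewrite ler_wpM2l// ge0_ler_powR ?nnegrE ?mulr_ge0//.
  by apply: le_trans LQ; rewrite ler_nat; have := ltn_ord i; lia.
apply: (@le_trans _ _ (\sum_(i < L.+1) C * (K * (Q * N%:R) `^ (2 * lam)))).
  apply: (@le_trans _ _ (\sum_(i < L.+1) N%:R ^+ k.*2 * `|iter k (dlaplace lam) u i * (geg lam i).[z]|)).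
    by rewrite -mulr_sumr ler_wpM2l ?exprn_ge0// ler_norm_sum.
  by apply: ler_sum => i _.
rewrite sumr_const card_ord -[_ *+ L.+1]mulr_natl powRM//.
apply: (@le_trans _ _ ((Q * N%:R) * (C * (K * (Q `^ (2 * lam) * N%:R `^ (2 * lam)))))).
  rewrite ler_wpM2r ?mulr_ge0 ?powR_ge0//.
  by apply: le_trans LQ; rewrite ler_nat.
by rewrite le_eqVlt; apply/orP; left; apply/eqP; ring.
Qed.

End Cutoff.

(** * Decay of beta means *)

Section Decay.
Variable R : realType.

(** Young's inequality for the numbers (1+y)^th and 1 with exponents 1/th and 1/(1-th). *)
Lemma bernoulli_powR (y th : R) : 0 <= y -> 0 <= th <= 1 -> (1 + y) `^ th <= 1 + th * y.
Proof.
move=> y0 /andP[t0 t1]; have y1 : 0 <= 1 + y by rewrite addr_ge0.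
have [->|tn0] := eqVneq th 0; first by rewrite powRr0 mul0r addr0.
have [->|tn1] := eqVneq th 1; first by rewrite powRr1// mul1r.
have tp : 0 < th by rewrite lt_neqAle eq_sym tn0.
have tl : 0 < 1 - th by rewrite subr_gt0 lt_neqAle tn1.
have := @conjugate_powR R ((1 + y) `^ th) 1 th^-1 (1 - th)^-1 (powR_ge0 _ _) ler01.
rewrite !invrK !invr_gt0 subrKC => /(_ tp tl erefl).
by rewrite mulr1 -powRrM mulfV// powRr1// powR1 mul1r; lra.
Qed.

Definition beta_even_moment (k : R) (a : nat) : R := poch 2^-1 a / poch (k + 2^-1) a.

(* For integral [k] the Pochhammer quotient telescopes; Bernoulli's inequality, factor by
   factor, interpolates to real exponents. *)
Lemma beta_even_moment_bound (k0 : R) : 0 <= k0 -> exists2 C : R, 0 < C & forall k a, 0 <= k <= k0 ->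
  0 <= beta_even_moment k a <= C * a.+1%:R `^ (- k).
Proof.
move=> k00; pose K := (Num.trunc k0).+1.
have K0 : 0 < K%:R :> R by [].
have kK : k0 <= K%:R by apply: ltW; exact: truncnS_gt.
pose C1 : R := poch 2^-1 K * 2 ^+ K; have h2 : 0 < 2^-1 :> R by [].
have C10 : 0 < C1 by rewrite mulr_gt0// poch_gt0.
exists (1 + C1); first by rewrite addr_gt0.
move=> k a /andP[k1 k2]; have kh : 0 < k + 2^-1 by rewrite ltr_wpDl.
have b0 : 0 <= beta_even_moment k a by rewrite divr_ge0// ltW// poch_gt0.
rewrite b0 /=.
pose th := k / K%:R.
have th01 : 0 <= th <= 1 by rewrite divr_ge0//= ler_pdivrMr// mul1r (le_trans k2).
have kE : k = K%:R * th by rewrite /th mulrCA divff ?mulr1// gt_eqF.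
have bK : beta_even_moment K%:R a <= C1 * a.+1%:R `^ (- K%:R).
  have P : 0 < poch (2^-1 + a%:R) K :> R by rewrite poch_gt0// ltr_pwDl.
  have -> : beta_even_moment K%:R a = poch 2^-1 K / poch (2^-1 + a%:R) K.
    have := pochD (2^-1 : R) a K; rewrite addnC pochD [2^-1 + K%:R]addrC => E.
    have n1 : poch (K%:R + 2^-1 : R) a != 0 by apply: lt0r_neq0; apply: poch_gt0; rewrite ltr_pwDl.
    have n2 : poch (2^-1 + a%:R : R) K != 0 by apply: lt0r_neq0.
    by apply/eqP; rewrite /beta_even_moment eqr_div// E.
  rewrite /C1 -mulrA ler_wpM2l ?(ltW (poch_gt0 _ _))//.
  rewrite powRN powR_mulrn// -[X in X * _]invrK -invfM lef_pV2 ?posrE ?mulr_gt0 ?invr_gt0 ?exprn_gt0//.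
  rewrite -exprVn -exprMn -[K in X in X <= _]card_ord -prodr_const; apply: ler_prod => j _.
  rewrite mulr_ge0//= -[a.+1%:R]natr1.
  have u0 : 0 <= a%:R :> R by []. have w0 : 0 <= j%:R :> R by [].
  by lra.
have bth : beta_even_moment k a <= (beta_even_moment K%:R a) `^ th.
  have pr0 (c : R) : 0 <= c -> 0 <= \prod_(j < a) ((2^-1 + j%:R) / (c + 2^-1 + j%:R)).
    by move=> c0; apply: prodr_ge0 => j _; rewrite divr_ge0// !addr_ge0.
  have bE c : beta_even_moment c a = \prod_(j < a) ((2^-1 + j%:R) / (c + 2^-1 + j%:R)).
    by rewrite /beta_even_moment /poch -prodf_div.
  rewrite !bE; elim: a {b0 bK bE pr0} => [|a IH]; first by rewrite !big_ord0 powR1.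
  rewrite !big_ord_recr /=.
  have fp (c : R) : 0 <= c -> 0 <= (2^-1 + a%:R) / (c + 2^-1 + a%:R).
    by move=> c0; rewrite divr_ge0// !addr_ge0.
  rewrite powRM ?fp//; last by apply: prodr_ge0 => j _; rewrite divr_ge0// !addr_ge0.
  apply: ler_pM; rewrite ?fp//; first by apply: prodr_ge0 => j _; rewrite divr_ge0// !addr_ge0.
  pose p : R := 2^-1 + a%:R.
  have p0 : 0 < p by rewrite ltr_pwDl.
  pose x : R := K%:R / p.
  have x0 : 0 <= x by rewrite divr_ge0// ltW.
  have := bernoulli_powR x0 th01.
  have e (c t : R) : c = K%:R * t -> (2^-1 + a%:R) / (c + 2^-1 + a%:R) = (1 + t * x)^-1.
    move=> ->; rewrite -addrA -/p.
    have -> : 1 + t * x = (K%:R * t + p) / p.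
      rewrite /x mulrDl divff ?gt_eqF// addrC; congr (_ + _); ring.
    by rewrite invf_div.
  rewrite (e k th kE) (e K%:R 1) ?mulr1// mul1r.
  have q1 : 0 < 1 + x by rewrite ltr_pwDl.
  have q2 : 0 < 1 + th * x by rewrite ltr_pwDl// mulr_ge0//; case/andP: th01.
  have -> : (1 + x)^-1 `^ th = ((1 + x) `^ th)^-1.
    by rewrite -powR_inv1 ?(ltW q1)// -powRrM mulN1r powRN.
  by move=> h; rewrite lef_pV2 ?posrE ?powR_gt0.
have [th0 th1] := andP th01.
apply: (le_trans bth); apply: (@le_trans _ _ ((C1 * a.+1%:R `^ (- K%:R)) `^ th)).
  have bK0 : 0 <= beta_even_moment K%:R a.
    by rewrite /beta_even_moment divr_ge0// ltW//; apply: poch_gt0 => //; rewrite ltr_pwDl.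
  by apply: ge0_ler_powR => //; rewrite nnegrE // mulr_ge0 // ?powR_ge0// ltW.
rewrite powRM ?powR_ge0 ?(ltW C10)// -powRrM mulNr -kE ler_wpM2r ?powR_ge0//.
apply: (@le_trans _ _ ((1 + C1) `^ th)).
  by rewrite ge0_ler_powR ?nnegrE ?addr_ge0 ?(ltW C10)// lerDr.
by rewrite ler1_powR// lerDl ltW.
Qed.

Lemma sum_sqrt_inv m : \sum_(j < m) (Num.sqrt j.+1%:R)^-1 <= 2 * Num.sqrt m%:R :> R.
Proof.
elim: m => [|m IH]; first by rewrite big_ord0 mulr_ge0.
rewrite big_ord_recr /=; apply: (le_trans (lerD IH (lexx _))).
have s0 : 0 < Num.sqrt m.+1%:R :> R by rewrite sqrtr_gt0.
have t0 := sqrtr_ge0 (m%:R : R).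
have sE : Num.sqrt m.+1%:R ^+ 2 = m%:R + 1 :> R by rewrite sqr_sqrtr// natr1.
have tE : Num.sqrt m%:R ^+ 2 = m%:R :> R by rewrite sqr_sqrtr.
move: (Num.sqrt m.+1%:R) (Num.sqrt m%:R) s0 t0 sE tE => s t s0 t0 sE tE.
rewrite -(ler_pM2r s0) mulrDl mulVf ?gt_eqF//.
have : 0 <= (s - t) ^+ 2 by exact: sqr_ge0.
rewrite !expr2 in sE tE *; nra.
Qed.

(** From (m/j)^th <= (m/j)^(1/2) everything reduces to the exponent 1/2. Staying away from exponent
    1 keeps the constant 2 uniform in [th]. *)
Lemma sum_powR_le (th : R) m : 0 <= th <= 2^-1 -> (0 < m)%N ->
  \sum_(j < m) j.+1%:R `^ (- th) <= 2 * m%:R * m%:R `^ (- th).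
Proof.
move=> /andP[t0 t1] m0; have m0' : 0 < m%:R :> R by rewrite ltr0n.
apply: (@le_trans _ _ (\sum_(j < m) m%:R `^ (- th) * Num.sqrt m%:R * (Num.sqrt j.+1%:R)^-1)).
  apply: ler_sum => j _; have j0 : 0 < j.+1%:R :> R by [].
  have -> : j.+1%:R `^ (- th) = m%:R `^ (- th) * (m%:R / j.+1%:R) `^ th.
    rewrite powRM ?invr_ge0// mulrA -powRD ?addNr ?powRr0 ?mul1r ?(gt_eqF m0') ?implybT//.
    by rewrite -powR_inv1// -powRrM mulN1r.
  rewrite -mulrA ler_wpM2l ?powR_ge0//.
  have -> : Num.sqrt m%:R / Num.sqrt j.+1%:R = (m%:R / j.+1%:R) `^ (2^-1) :> R.
    by rewrite powR12_sqrt ?divr_ge0// sqrtrM// sqrtrV.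
  by apply: ler_powR => //; rewrite ler_pdivlMr// mul1r ler_nat.
rewrite -mulr_sumr; apply: (le_trans (ler_wpM2l _ (sum_sqrt_inv m))).
  by rewrite mulr_ge0 ?powR_ge0 ?sqrtr_ge0.
rewrite le_eqVlt; apply/orP; left; apply/eqP.
have : Num.sqrt m%:R * Num.sqrt m%:R = m%:R :> R by rewrite -expr2 sqr_sqrtr.
move: (m%:R `^ (- th)) => w E; rewrite -[in RHS]E; ring.
Qed.

Lemma beta_mean_Xn k r : beta_mean k 'X^r = beta_moment k r :> R.
Proof.
rewrite (@beta_meanE _ _ _ r.+1) ?size_polyXn// big_ord_recr /= coefXn eqxx mul1r.
by rewrite big1 ?add0r// => i _; rewrite coefXn ltn_eqF ?mul0r.
Qed.

Lemma beta_mean_sum k (I : Type) (r : seq I) (P : pred I) (f : I -> {poly R}) :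
  beta_mean k (\sum_(i <- r | P i) f i) = \sum_(i <- r | P i) beta_mean k (f i).
Proof.
have l0 : beta_mean k (0 : {poly R}) = 0 by rewrite /beta_mean size_poly0 big_ord0.
by apply: (big_morph _ (beta_meanD k) l0).
Qed.

Definition even_geometric m : {poly R} := \sum_(j < m) 'X^(j.*2).

(** Expanding the power gives moments of order 2|f|, and (1 + |f|)^(-k) <= prod_i (1 + f_i)^(-k/K)
    separates the variables. The condition 2 k0 <= K makes each exponent k/K at most 1/2. *)
Lemma beta_mean_geometric (C k0 k : R) K m : 0 <= k <= k0 -> (0 < K)%N -> 2 * k0 <= K%:R -> (0 < m)%N -> 0 <= C ->
  (forall a, 0 <= beta_even_moment k a <= C * a.+1%:R `^ (- k)) ->
  beta_mean k (even_geometric m ^+ K) <= C * 2 ^+ K * m%:R ^+ K * m%:R `^ (- k).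
Proof.
move=> /andP[k1 k2] K0 kK m0 C0 hb.
have K0' : 0 < K%:R :> R by rewrite ltr0n.
pose th := k / K%:R.
have th01 : 0 <= th <= 2^-1.
  by rewrite divr_ge0//= ler_pdivrMr// mulrC ler_pdivlMr//; lra.
have kE : k = th * K%:R by rewrite /th divfK// gt_eqF.
rewrite -[K in even_geometric m ^+ K]card_ord -prodr_const /even_geometric bigA_distr_bigA /= beta_mean_sum.
apply: (@le_trans _ _ (\sum_(f : {ffun 'I_K -> 'I_m}) C * \prod_(i < K) (f i).+1%:R `^ (- th))).
  apply: ler_sum => f _; rewrite prodrXr beta_mean_Xn.
  have -> : (\sum_(i < K) (f i).*2 = (\sum_(i < K) f i).*2)%N.
    by rewrite -muln2 big_distrl; apply: eq_bigr => i _ /=; rewrite muln2.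
  rewrite /beta_moment odd_double doubleK -/(beta_even_moment k _).
  have /andP[_ h] := hb (\sum_(i < K) f i)%N; apply: (le_trans h); rewrite ler_wpM2l//.
  rewrite {1}kE -mulNr powRrM powR_mulrn ?powR_ge0// -[X in _ ^+ X <= _]card_ord -prodr_const.
  apply: ler_prod => i _; rewrite powR_ge0 !powRN lef_pV2 ?posrE ?powR_gt0//.
  have /andP[t0 _] := th01.
  by rewrite ge0_ler_powR ?nnegrE// ler_nat ltnS (bigD1 i)//= leq_addr.
rewrite -mulr_sumr -!mulrA ler_wpM2l//.
rewrite -(bigA_distr_bigA (fun (i : 'I_K) (j : 'I_m) => j.+1%:R `^ (- th) : R)) /=.
rewrite prodr_const card_ord.
have -> : m%:R `^ (- k) = (m%:R `^ (- th)) ^+ K :> R.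
  by rewrite {1}kE -mulNr powRrM powR_mulrn ?powR_ge0.
rewrite -!exprMn lerXn2r ?nnegrE ?mulr_ge0 ?powR_ge0//.
  by apply: sumr_ge0 => j _; exact: powR_ge0.
by rewrite mulrA; exact: sum_powR_le.
Qed.

(* [(1 + A(1-t))^-K] is dominated on [-1, 1] by a multiple of the [K]-th power of an even
   truncated geometric series, whose beta mean is explicit. *)
Lemma beta_mean_decay (k0 : R) K : 0 <= k0 -> (0 < K)%N -> 2 * k0 <= K%:R ->
  exists2 C : R, 0 <= C & forall k A B (f : {poly R}), 0 <= k <= k0 -> 0 <= A -> 0 <= B ->
    (forall t, -1 <= t <= 1 -> `|f.[t]| * (1 + A * (1 - t)) ^+ K <= B) ->
    `|beta_mean k f| <= C * B * (1 + A) `^ (- k).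
Proof.
move=> k00 K0 kK; have [C C0 hC] := beta_even_moment_bound k00.
exists (C * 4 ^+ K * 3 `^ k0); first by rewrite !mulr_ge0 ?powR_ge0 ?exprn_ge0// ltW.
move=> k A B f /andP[k1 k2] A0 B0 hf.
(* This length matches the scale of [A]: with u = t^2 and 1 - u <= 2(1 - t) one has 1 + m(1-u) <=
   2(1 + A(1-t)), and conversely 1 + A <= 3m. *)
pose m := (Num.trunc (A / 2)).+1.
have m0 : 0 < m%:R :> R by [].
have mA : A / 2 < m%:R by exact: truncnS_gt.
have mA2 : m%:R <= A / 2 + 1.
  by rewrite /m -natr1 lerD2r; have /andP[] := truncn_itv (divr_ge0 A0 (ler0n R 2)).
pose g := (B * (2 / m%:R) ^+ K) *: even_geometric m ^+ K.
have fg t : -1 <= t <= 1 -> `|f.[t]| <= g.[t].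
  move=> ht; have /andP[t1 t2] := ht; pose u := t ^+ 2.
  have u0 : 0 <= u by exact: sqr_ge0.
  have u1 : u <= 1 by rewrite /u expr2; nra.
  have gu : (even_geometric m).[t] = \sum_(j < m) u ^+ j.
    by rewrite horner_sum; apply: eq_bigr => j _; rewrite hornerXn -mul2n exprM.
  (* The truncated geometric sum S satisfies (1-u) S = 1 - u^m, and S >= m u^m pays for the
     truncation. *)
  have key : m%:R <= (1 + m%:R * (1 - u)) * \sum_(j < m) u ^+ j.
    have G : (1 - u) * \sum_(j < m) u ^+ j = 1 - u ^+ m.
      by have := subrX1 u m => E; rewrite -[1 - u]opprB mulNr -E opprB.
    have S1 : m%:R * u ^+ m <= \sum_(j < m) u ^+ j.
      rewrite mulr_natl -[X in _ *+ X <= _]card_ord -sumr_const; apply: ler_sum => j _.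
      by apply: ler_wiXn2l => //; apply: ltnW; exact: ltn_ord.
    by rewrite mulrDl mul1r -mulrA G mulrBr mulr1; lra.
  have w : 1 + m%:R * (1 - u) <= 2 * (1 + A * (1 - t)).
    have q1 : 1 - u = (1 - t) * (1 + t) by rewrite /u; ring.
    have q2 : 1 - u <= 2 * (1 - t) by rewrite q1; nra.
    have q3 : m%:R * (1 - u) <= (A / 2 + 1) * (1 - u) by rewrite ler_wpM2r// subr_ge0.
    nra.
  have P : 0 < 1 + A * (1 - t) by rewrite ltr_pwDl// mulr_ge0// subr_ge0.
  have S0 : 0 <= \sum_(j < m) u ^+ j by apply: sumr_ge0 => j _; rewrite exprn_ge0.
  rewrite -(ler_pM2r (exprn_gt0 K P)); apply: (le_trans (hf t ht)).
  rewrite /g hornerZ horner_exp gu -!mulrA -!exprMn -[X in X <= _]mulr1 ler_wpM2l//.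
  apply: exprn_ege1; rewrite -[X in X <= _](@divff _ m%:R) ?gt_eqF//.
  rewrite [X in _ <= X](_ : _ = (2 * (1 + A * (1 - t)) * \sum_(j < m) u ^+ j) / m%:R); last by ring.
  rewrite ler_pM2r ?invr_gt0//; apply: (le_trans key); exact: ler_wpM2r.
apply: (le_trans (beta_mean_norm_le k1 fg)); rewrite /g beta_meanZ.
have kk : 0 <= k <= k0 by rewrite k1.
have := @beta_mean_geometric C k0 k K m kk K0 kK isT (ltW C0) (fun a => hC k a kk).
move=> h; apply: (le_trans (ler_wpM2l _ h)).
  by rewrite mulr_ge0// exprn_ge0// divr_ge0.
have m3 : m%:R `^ (- k) <= 3 `^ k0 * (1 + A) `^ (- k).
  have A1 : 0 < 1 + A by rewrite ltr_pwDl.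
  have m1 : 1 <= m%:R :> R by rewrite ler1n.
  rewrite !powRN -[X in X <= _]mul1r ler_pdivrMr ?powR_gt0// mulrAC ler_pdivlMr ?powR_gt0// mul1r.
  apply: (@le_trans _ _ ((3 * m%:R) `^ k)).
    by rewrite ge0_ler_powR ?nnegrE ?mulr_ge0 ?(ltW A1)//; lra.
  by rewrite powRM// ler_wpM2r ?powR_ge0// ler_powR// ler1n.
apply: (@le_trans _ _ (B * 4 ^+ K * C * m%:R `^ (- k))).
  rewrite le_eqVlt; apply/orP; left; apply/eqP.
  have -> : 4 = 2 * 2 :> R by rewrite -natrM.
  rewrite !exprMn exprVn; have mK : m%:R ^+ K != 0 :> R by rewrite expf_neq0// gt_eqF.
  by field.
rewrite [X in _ <= X](_ : _ = B * 4 ^+ K * C * (3 `^ k0 * (1 + A) `^ (- k))); last by ring.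
by rewrite ler_wpM2l// !mulr_ge0 ?exprn_ge0// ltW.
Qed.

End Decay.

(** * Reduction to the univariate kernel *)

Section Combination.
Variable R : realType.

Lemma sum_even (V : nmodType) (f : nat -> V) n :
  \sum_(r < (2 * n).+1) (if odd r then 0 else f r./2) = \sum_(m < n.+1) f m.
Proof.
elim: n => [|n IH]; first by rewrite muln0 !big_ord1.
rewrite mulnS 2!addSn add0n big_ord_recr [X in X + _ = _]big_ord_recr /= IH.
by rewrite mul2n odd_double /= addr0 doubleK [RHS]big_ord_recr /=.
Qed.

Lemma comp_poly_prod k (F : 'I_k -> {poly R}) q :
  \prod_i (F i \Po q) = (\prod_i F i) \Po q.
Proof.
by apply: (big_ind2 (fun p r => p = r \Po q)) => [|p r p' r' -> ->|//]; rewrite ?comp_polyC ?comp_polyM.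
Qed.

Lemma coef_prod_moment_poly k (p kap : 'I_k -> R) N r : (forall i, 0 <= kap i) ->
  (\prod_i moment_poly N.*2 (p i, kap i))`_r = if odd r then 0 else
   4^-1 ^+ r./2 * (\prod_i \poly_(a < N) ((p i ^+ 2) ^+ a / (a`!%:R * poch (kap i + 2^-1) a)))`_(r./2).
Proof.
move=> k0; under eq_bigr do rewrite moment_poly_comp//.
by rewrite comp_poly_prod coef_comp_sq.
Qed.

Definition coord_pairs d (kappa : 'I_d.+1 -> R) (x y : d.-tuple R) : seq (R * R) :=
  [seq (Num.sqrt (xext x i * xext y i), kappa i) | i <- index_enum 'I_d.+1].

Lemma iter_average_poly d (kappa : 'I_d.+1 -> R) (x y : d.-tuple R) M N (q : {poly R}) :
  (forall i, 0 <= kappa i) -> Tsimplex x -> Tsimplex y -> (size q <= M <= N.*2)%N ->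
  (iter_average (coord_pairs kappa x y) q).[0] =
  \sum_(r < M) if odd r then 0 else q`_r * r`!%:R * (4^-1 ^+ r./2 * prod_ker kappa N r./2 x y).
Proof.
move=> k0 Tx Ty /andP[qM MN].
have qE : q = \sum_(r < M) (q`_r * r`!%:R) *: divpow R r.
  apply/polyP => j; rewrite coef_sum.
  under eq_bigr do rewrite /divpow scalerA -mulrA mulfV ?fact_neq0// mulr1.
  case: (ltnP j M) => jM.
    rewrite (bigD1 (Ordinal jM)) //= coefZ coefXn eqxx mulr1 big1 ?addr0// => i ij.
    rewrite coefZ coefXn; case: eqP => [E|]; last by rewrite mulr0.
    by case/eqP: ij; apply: val_inj.
  rewrite nth_default ?(leq_trans qM)// big1// => i _; rewrite coefZ coefXn.
  by rewrite gtn_eqF ?mulr0// (leq_trans _ jM).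
rewrite {1}qE iter_average_sum horner_sum; apply: eq_bigr => r _; rewrite hornerZ.
rewrite (@iter_average_divpow0 _ _ N.*2); last exact: leq_trans (ltn_ord r) MN.
rewrite big_map coef_prod_moment_poly//; case: ifP => o; first by rewrite mulr0.
congr (_ * (_ * _)); rewrite /prod_ker; congr nth; congr polyseq; apply: eq_bigr => i _.
by apply/polyP => a; rewrite !coef_poly sqr_sqrtr// mulr_ge0// xext_ge0.
Qed.

(** With lam = [half_sum kappa - 1], the number [geg_coef (j - m) (2m)] times (2m)!/4^m, the factor
    from the averages, is exactly [reproducing_coef j m]. *)
Lemma iter_average_geg_even d (kappa : 'I_d.+1 -> R) (x y : d.-tuple R) j :
  (forall i, 0 <= kappa i) -> Tsimplex x -> Tsimplex y ->
  (iter_average (coord_pairs kappa x y) (geg (half_sum kappa - 1) j.*2)).[0] =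
  simplex_mass kappa * reproducing_ker kappa j x y.
Proof.
move=> k0 Tx Ty; rewrite (@iter_average_poly _ _ _ _ (2 * j).+1 j.+1)//; last first.
  by rewrite /geg mul2n size_poly/= doubleS ltnS.
rewrite /reproducing_ker mulrA mulfV ?gt_eqF ?simplex_mass_gt0// mul1r.
rewrite -(sum_even (fun m => reproducing_coef kappa j m * prod_ker kappa j.+1 m x y)).
apply: eq_bigr => r _; case: ifP => // o.
have rE : r = r./2.*2 :> nat by rewrite even_halfK ?o.
have rj : (r./2 <= j)%N by rewrite -leq_double -rE -mul2n -ltnS.
rewrite mulrA; congr (_ * _).
move: (r./2) rE rj => m -> mj.
have -> : geg (half_sum kappa - 1) j.*2 = geg (half_sum kappa - 1) (m.*2 + (j - m).*2).
  by rewrite -doubleD subnKC.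
rewrite coef_geg /geg_coef /reproducing_coef.
have -> : (j - m + m.*2 = j + m)%N by rewrite -addnn addnA subnK.
have -> : (m.*2 + (j - m).*2 = j.*2)%N by rewrite -doubleD subnKC.
rewrite subrK addrA -[m.*2]mul2n exprM exprVn; move: (j.*2%:R : R) => w.
have h4 : (2 ^+ 2) ^+ m = 4 ^+ m :> R by rewrite -natrX.
have h5 : 4 ^+ m != 0 :> R by rewrite expf_neq0.
rewrite h4; have h6 := fact_neq0 R (2 * m); have h7 := fact_neq0 R (j - m).
case: j r {o} mj h7 => [|j] _ mj h7 /=.
  move: mj h5 h6; rewrite leqn0 => /eqP-> h5 h6; by rewrite fact0 !expr0 /= !divr1 !mulr1 divr1.
by field; rewrite h5 h6 h7.
Qed.

Lemma iter_average_geg_odd d (kappa : 'I_d.+1 -> R) (x y : d.-tuple R) i :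
  (forall i, 0 <= kappa i) -> Tsimplex x -> Tsimplex y -> odd i ->
  (iter_average (coord_pairs kappa x y) (geg (half_sum kappa - 1) i)).[0] = 0.
Proof.
move=> k0 Tx Ty oi; rewrite (@iter_average_poly _ _ _ _ i.+1 i.+1)//; last first.
  by rewrite /geg size_poly/= -addnn leq_addr.
by rewrite big1// => r _; case: ifP => // o; rewrite coef_geg_odd ?mul0r// oddD oi o.
Qed.

Lemma Lker_iter_average d (kappa : 'I_d.+1 -> R) (x y : d.-tuple R) a P n :
  (forall i, 0 <= kappa i) -> Tsimplex x -> Tsimplex y -> proj_kernel kappa P ->
  simplex_mass kappa * Lker a P n x y =
  (iter_average (coord_pairs kappa x y) (geg_ker (half_sum kappa - 1) a (2 * n))).[0].
Proof.
move=> k0 Tx Ty hP; rewrite /geg_ker iter_average_sum horner_sum.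
rewrite /Lker big_mkord mulr_sumr.
rewrite -(sum_even (fun j => simplex_mass kappa * (a (j%:R / n%:R) * P j x y))).
apply: eq_bigr => i _; rewrite hornerZ; case: ifP => o.
  by rewrite iter_average_geg_odd ?mulr0.
have iE : i = i./2.*2 :> nat by rewrite even_halfK ?o.
rewrite [in RHS]iE iter_average_geg_even// (proj_kernelE k0 _ hP)//.
rewrite -mul2n !natrM -mulf_div divff ?pnatr_eq0// mul1r; ring.
Qed.

(** Each average consumes [K] of the available powers and gains (1 + H p)^(-k); [K0] powers survive.
    The point [u] must be arbitrary because an outer average evaluates the inner one at u + p t, and
    |u| <= 1 - sum p keeps all arguments in [-1, 1]. *)
Lemma iter_average_decay (k0 : R) K : 0 <= k0 -> (0 < K)%N -> 2 * k0 <= K%:R ->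
  exists2 C : R, 0 <= C & forall (l : seq (R * R)) K0 (H B : R) (f : {poly R}), 0 <= H -> 0 <= B ->
    (forall pk, pk \in l -> 0 <= pk.1 /\ 0 <= pk.2 <= k0) ->
    (forall z, -1 <= z <= 1 -> `|f.[z]| * (1 + H * (1 - z)) ^+ (K0 + K * size l) <= B) ->
    forall u, `|u| <= 1 - \sum_(pk <- l) pk.1 ->
      `|(iter_average l f).[u]| * (1 + H * (1 - u - \sum_(pk <- l) pk.1)) ^+ K0 <=
      C ^+ size l * B * \prod_(pk <- l) (1 + H * pk.1) `^ (- pk.2).
Proof.
move=> k00 K0p kK; have [C C0 hC] := beta_mean_decay k00 K0p kK; exists C => //.
move=> l K0 H B f H0 B0; elim: l K0 => [|[p k] l IH] K0 hl hf u.
  rewrite !big_nil subr0 muln0 addn0 in hf * => hu; rewrite subr0 mul1r mulr1.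
  by apply: hf; rewrite -ler_norml.
rewrite !big_cons /=; set S := \sum_(pk <- l) pk.1 => hu.
have [p0 kb] := hl _ (mem_head _ _); rewrite /= in p0 kb.
have hl' pk : pk \in l -> 0 <= pk.1 /\ 0 <= pk.2 <= k0.
  by move=> h; apply: hl; rewrite inE h orbT.
have hf' z : -1 <= z <= 1 -> `|f.[z]| * (1 + H * (1 - z)) ^+ (K0 + K + K * size l) <= B.
  by move=> hz; have := hf z hz; rewrite /= mulnS addnA.
have {}IH := IH (K0 + K)%N hl' hf'.
have [q qE qt] := beta_average_beta_mean p k (iter_average l f) u.
set W := \prod_(pk <- l) _ in IH *.
have W0 : 0 <= W by apply: prodr_ge0 => pk _; exact: powR_ge0.
pose b := 1 - u - (p + S).
have b0 : 0 <= b by move: hu; rewrite ler_norml /b => /andP[h1 h2]; lra.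
have P : 0 < (1 + H * b) ^+ K0 by rewrite exprn_gt0// ltr_pwDl// mulr_ge0.
have D0 : 0 <= C ^+ size l * B * W by rewrite !mulr_ge0 ?exprn_ge0.
have := hC k (H * p) (C ^+ size l * B * W / (1 + H * b) ^+ K0) q kb (mulr_ge0 H0 p0) (divr_ge0 D0 (ltW P)).
rewrite -qE => X.
rewrite -ler_pdivlMr//; apply: (le_trans (X _)); last first.
  rewrite le_eqVlt; apply/orP; left; apply/eqP; rewrite exprS.
  by rewrite -/b; field; rewrite gt_eqF.
move=> t ht; have /andP[t1 t2] := ht; rewrite qt.
have pt : `|p * t| <= p by rewrite normrM (ger0_norm p0) ler_piMr// ler_norml.
have hu' : `|u + p * t| <= 1 - S by rewrite (le_trans (ler_normD _ _))//; move: hu pt; lra.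
rewrite ler_pdivlMr// -[X in X <= _]mulrA; apply: le_trans (IH _ hu'); rewrite ler_wpM2l//.
have c0 : 0 <= p * (1 - t) by rewrite mulr_ge0// subr_ge0.
(* Both summands are nonnegative, so the power K0 + K splits: K0 factors keep only [b], which does
   not involve [t], and K factors keep p(1 - t), the shape required by [beta_mean_decay]. *)
have bE : 1 - (u + p * t) - S = b + p * (1 - t) by rewrite /b; ring.
have Hb : 0 <= H * b by exact: mulr_ge0.
have Hc : 0 <= H * (p * (1 - t)) by exact: mulr_ge0.
rewrite bE exprD mulrC (mulrDr H b) -[H * p * (1 - t)]mulrA.
by apply: ler_pM; rewrite ?exprn_ge0 ?addr_ge0// lerXn2r ?nnegrE ?addr_ge0//; lra.
Qed.

End Combination.

(** * Geometry of the simplex *)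

Section Distance.
Variable R : realType.

Lemma sin_ge_linear (t : R) : 0 <= t <= 1 -> cos 1 * t <= sin t.
Proof.
move=> /andP[]; rewrite le_eqVlt => /predU1P[<-|t0] t1; first by rewrite mulr0 sin0.
have [c] := @MVT R sin cos 0 t t0 (fun x _ => is_derive_sin x) (continuous_subspaceT (@continuous_sin R)).
rewrite in_itv /= => /andP[c0 ct]; rewrite sin0 !subr0 => ->; rewrite ler_pM2r// ltW//.
by rewrite ltr_cos ?in_itv /= ?ler01 ?(ltW c0) ?(le_trans _ (pi_ge2 _)) ?(lt_le_trans ct) ?ler1n //; have := pi_ge2 R; lra.
Qed.

(** With u = cos t this is 1 - cos t = 2 sin^2(t/2); u >= 0 gives t <= pi/2, so t/2 lies in the
    range of [sin_ge_linear]. *)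
Lemma acos_sq_le (u : R) : 0 <= u <= 1 -> cos 1 ^+ 2 / 2 * acos u ^+ 2 <= 1 - u.
Proof.
move=> /andP[u0 u1].
have u11 : -1 <= u <= 1 by apply/andP; split; lra.
have [/andP[a0 ap] uE] := acos_def u11.
have a1 : acos u <= pi / 2.
  rewrite leNgt; apply/negP => h.
  have p0 := pi_gt0 R.
  have pin : (pi / 2 : R) \in `[0, pi] by rewrite in_itv /=; apply/andP; split; lra.
  have ain : acos u \in `[0, pi] by rewrite in_itv /= a0.
  by have := ltr_cos pin ain; rewrite uE cos_pihalf h ltNge u0.
have s := @sin_ge_linear (acos u / 2).
have {s} : cos 1 * (acos u / 2) <= sin (acos u / 2).
  by apply: s; have := pihalf_lt2 R; move: a1; move: (pi / 2 : R) => q; lra.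
have c1 := cos1_gt0 R; set t := acos u in a0 ap uE a1 *.
move=> h; have h0 : 0 <= cos 1 * (t / 2) by rewrite mulr_ge0 ?divr_ge0// ltW.
have {h0}h : (cos 1 * (t / 2)) ^+ 2 <= sin (t / 2) ^+ 2 by rewrite lerXn2r ?nnegrE ?(le_trans h0).
have := cos2Dsin2 (t / 2); have := cos_mulr2n (t / 2).
have -> : (t / 2) *+ 2 = t by rewrite -[_ *+ 2]mulr_natr; field.
by rewrite uE => -> E; move: h E; rewrite exprMn expr_div_n; lra.
Qed.

Lemma one_plus_acos_sq_le (u : R) (n : nat) : 0 <= u <= 1 ->
  (1 + n%:R * acos u) ^+ 2 <= (2 + (cos 1 ^+ 2)^-1) * (1 + (2 * n)%:R ^+ 2 * (1 - u)).
Proof.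
move=> hu; have := acos_sq_le hu; set t := acos u => h.
have c0 : 0 < cos 1 ^+ 2 :> R by rewrite exprn_gt0// cos1_gt0.
have h1 : t ^+ 2 <= 2 * (cos 1 ^+ 2)^-1 * (1 - u).
  by rewrite mulrAC ler_pdivlMr//; lra.
have i0 : 0 <= (cos 1 ^+ 2)^-1 :> R by rewrite invr_ge0 ltW.
move: (cos 1 ^+ 2)^-1 i0 h1 => i i0 h1.
have u0 : 0 <= 1 - u by move: hu; lra.
have := ler_wpM2l (sqr_ge0 (n%:R : R)) h1; rewrite natrM exprMn => h2.
have := sqr_ge0 (1 - n%:R * t).
have := mulr_ge0 (mulr_ge0 i0 u0) (sqr_ge0 (n%:R : R)).
have := mulr_ge0 u0 (sqr_ge0 (n%:R : R)).
rewrite !expr2 in h2 *; nra.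
Qed.

(** For a = sqrt x and b = sqrt y the left side equals (1 + H a b)^2 + H (a - b)^2, and the first
    square is at least 1. *)
Lemma geom_mean_shift (H x y : R) : 0 <= H -> 0 <= x -> 0 <= y ->
  (1 + H * x) * (1 + H * y) <=
  (1 + H * Num.sqrt (x * y)) ^+ 2 * (1 + H * (Num.sqrt x - Num.sqrt y) ^+ 2).
Proof.
move=> H0 x0 y0; rewrite sqrtrM//.
rewrite -{1}(sqr_sqrtr x0) -{1}(sqr_sqrtr y0).
move: (Num.sqrt x) (Num.sqrt y) (sqrtr_ge0 x) (sqrtr_ge0 y) => a b a0 b0.
have h1 : 0 <= H * (a * b) by rewrite !mulr_ge0.
have h2 : 0 <= H * (a - b) ^+ 2 by rewrite mulr_ge0// sqr_ge0.
rewrite -subr_ge0 (_ : _ - _ = H * (a - b) ^+ 2 * (H * (a * b) * (2 + H * (a * b)))); last by ring.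
by apply: mulr_ge0 => //; apply: mulr_ge0 => //; apply: addr_ge0.
Qed.

(** Uses n^2 (x + n^-2) = 1 + n^2 x <= 1 + (2n)^2 x and raises [geom_mean_shift] to the power k/2;
    [Q] is the price for replacing x and y by their geometric mean. *)
Lemma powR_geom_mean (n : nat) (k x y Q : R) : (0 < n)%N -> 0 <= k -> 0 <= x -> 0 <= y ->
  1 + (2 * n)%:R ^+ 2 * (Num.sqrt x - Num.sqrt y) ^+ 2 <= Q ->
  (1 + (2 * n)%:R ^+ 2 * Num.sqrt (x * y)) `^ (- k) <=
  Q `^ (k / 2) * (n%:R `^ (- 2 * k) *
   (Num.sqrt ((x + (n%:R ^+ 2)^-1) `^ k) * Num.sqrt ((y + (n%:R ^+ 2)^-1) `^ k))^-1).
Proof.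
move=> n0 k0 x0 y0 hQ; set H := (2 * n)%:R ^+ 2 in hQ *.
have nR : 0 < n%:R :> R by rewrite ltr0n.
have i0 : 0 < (n%:R ^+ 2)^-1 :> R by rewrite invr_gt0 exprn_gt0.
have H0 : 0 <= H by rewrite exprn_ge0.
have HE : H = 4 * n%:R ^+ 2 by rewrite /H natrM exprMn; congr (_ * _); ring.
set X := x + _; set Y := y + _; set G := 1 + H * _.
have X0 : 0 < X by rewrite ltr_wpDl.
have Y0 : 0 < Y by rewrite ltr_wpDl.
have G0 : 0 < G by rewrite ltr_pwDl// mulr_ge0// sqrtr_ge0.
have Q1 : 1 <= Q by apply: le_trans hQ; rewrite lerDl mulr_ge0// sqr_ge0.
have Q0 : 0 < Q by lra.
have key : (n%:R ^+ 2 * X) * (n%:R ^+ 2 * Y) <= G ^+ 2 * Q.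
  have h z : 0 <= z -> 0 <= n%:R ^+ 2 * (z + (n%:R ^+ 2)^-1) <= 1 + H * z.
    move=> z0; rewrite mulrDr mulfV ?gt_eqF ?exprn_gt0// HE.
    have := mulr_ge0 (sqr_ge0 (n%:R : R)) z0; lra.
  have /andP[hx hx'] := h x x0; have /andP[hy hy'] := h y y0.
  apply: le_trans (ler_pM hx hy hx' hy') _.
  apply: le_trans (geom_mean_shift H0 x0 y0) _.
  by rewrite ler_wpM2l// sqr_ge0.
have half z : 0 < z -> z `^ (k / 2) * z `^ (k / 2) = z `^ k.
  by move=> z0; rewrite -powRD ?(gt_eqF z0) ?implybT//; congr (_ `^ _); field.
have sq z : 0 < z -> Num.sqrt (z `^ k) = z `^ (k / 2).
  by move=> z0; rewrite -powR12_sqrt ?powR_ge0// -powRrM.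
have {}key : ((n%:R ^+ 2 * X) * (n%:R ^+ 2 * Y)) `^ (k / 2) <= (G ^+ 2 * Q) `^ (k / 2).
  by apply: ge0_ler_powR => //; rewrite ?divr_ge0// nnegrE ltW// !mulr_gt0// exprn_gt0.
rewrite !sq//; move: key.
have [nW XW YW GW QW] : [/\ 0 <= n%:R :> R, 0 <= X, 0 <= Y, 0 <= G & 0 <= Q].
  by split; exact: ltW.
rewrite !powRM ?mulr_ge0 ?exprn_ge0// !half//.
have -> : n%:R `^ (-2 * k) = (n%:R `^ k * n%:R `^ k)^-1 :> R.
  by rewrite -powRD ?(gt_eqF nR) ?implybT// -powRN; congr (_ `^ _); ring.
rewrite powRN; have a1 := powR_gt0 k nR; have a2 := powR_gt0 (k / 2) X0.
have a3 := powR_gt0 (k / 2) Y0; have a4 := powR_gt0 k G0.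
move: (n%:R `^ k) (X `^ (k / 2)) (Y `^ (k / 2)) (G `^ k) (Q `^ (k / 2)) a1 a2 a3 a4.
move=> N p q g r N0 p0 q0 g0 h.
rewrite -[g^-1]mul1r ler_pdivrMr// (_ : _ * g = g * r / (N * p * (N * q))); last first.
  by field; rewrite !gt_eqF.
by rewrite ler_pdivlMr ?mulr_gt0// mul1r.
Qed.

Lemma powR_sum (z : R) (I : Type) (r : seq I) (f : I -> R) : 0 < z ->
  \prod_(i <- r) z `^ f i = z `^ (\sum_(i <- r) f i).
Proof.
move=> z0; elim: r => [|i r IH]; first by rewrite !big_nil powRr0.
by rewrite !big_cons IH powRD// (gt_eqF z0) implybT.
Qed.

Lemma sqrtr_prod (I : Type) (r : seq I) (f : I -> R) : (forall i, 0 <= f i) ->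
  \prod_(i <- r) Num.sqrt (f i) = Num.sqrt (\prod_(i <- r) f i).
Proof.
move=> f0; elim: r => [|i r IH]; first by rewrite !big_nil sqrtr1.
by rewrite !big_cons IH sqrtrM.
Qed.

End Distance.

(** * Comparison with the weights [Wkappa] *)

Section Weights.
Variable R : realType.

Lemma one_plus_exp_le (w : R) k : 0 <= w -> (1 + w) ^+ k <= 2 ^+ k * (1 + w ^+ k).
Proof.
move=> w0; have [w1|/ltW w1] := leP w 1.
  rewrite -[leLHS]mulr1 ler_pM ?exprn_ge0 ?addr_ge0//; last by rewrite lerDl exprn_ge0.
  by rewrite lerXn2r ?nnegrE ?addr_ge0//; lra.
apply: (@le_trans _ _ ((2 * w) ^+ k)).
  by rewrite lerXn2r ?nnegrE ?addr_ge0 ?mulr_ge0//; lra.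
by rewrite exprMn ler_wpM2l ?exprn_ge0// lerDr.
Qed.

Lemma geg_ker_decay (lam : R) (a : R -> R) k : 0 <= lam -> admissible a ->
  exists2 C : R, 0 <= C & forall N z, (0 < N)%N -> -1 <= z <= 1 ->
    `|(geg_ker lam a N).[z]| * (1 + N%:R ^+ 2 * (1 - z)) ^+ k <= C * (N%:R * N%:R `^ (2 * lam)).
Proof.
move=> lam0 adm; have [C C_ge0 hC] := geg_ker_bound k lam0 adm.
have [C' C'_ge0 hC'] := geg_ker_bound 0 lam0 adm.
exists (2 ^+ k * (C' + C)); first by rewrite mulr_ge0 ?exprn_ge0 ?addr_ge0.
move=> N z N0 hz; have h1 := hC N z N0 hz; have := hC' N z N0 hz.
rewrite expr0 mulr1 => h2.
have w0 : 0 <= N%:R ^+ 2 * (1 - z) by rewrite mulr_ge0 ?exprn_ge0// subr_ge0; case/andP: hz.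
apply: le_trans (ler_wpM2l (normr_ge0 _) (one_plus_exp_le k w0)) _.
rewrite mulrCA -mulrA ler_wpM2l ?exprn_ge0// mulrDr mulr1 mulrDl.
exact: lerD.
Qed.

Definition cosrho d (x y : d.-tuple R) : R := \sum_i Num.sqrt (xext x i * xext y i).

(** Coordinatewise square roots map the simplex to the unit sphere, where [rho] is the angle; this
    is the squared chord length. *)
Lemma sum_sqrt_diff d (x y : d.-tuple R) : Tsimplex x -> Tsimplex y ->
  \sum_i (Num.sqrt (xext x i) - Num.sqrt (xext y i)) ^+ 2 = 2 * (1 - cosrho x y).
Proof.
move=> Tx Ty; transitivity (\sum_i (xext x i + xext y i - 2 * Num.sqrt (xext x i * xext y i))).
  apply: eq_bigr => i _; rewrite sqrtrM ?xext_ge0// sqrrB !sqr_sqrtr ?xext_ge0//.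
  by rewrite -[_ *+ 2]mulr_natr; ring.
by rewrite sumrB big_split /= !sum_xext -mulr_sumr /cosrho; ring.
Qed.

Lemma cosrho_bounds d (x y : d.-tuple R) : Tsimplex x -> Tsimplex y -> 0 <= cosrho x y <= 1.
Proof.
move=> Tx Ty; apply/andP; split; first by apply: sumr_ge0 => i _; exact: sqrtr_ge0.
have : 0 <= 2 * (1 - cosrho x y).
  by rewrite -sum_sqrt_diff// sumr_ge0// => i _; rewrite sqr_ge0.
by rewrite pmulr_rge0// subr_ge0.
Qed.

(** A single coordinate difference is at most the whole chord, so one [Q] serves all coordinates and
    the exponents kappa_i / 2 add up. *)
Lemma prod_coord_pairs_le d (kappa : 'I_d.+1 -> R) (x y : d.-tuple R) n :
  (forall i, 0 <= kappa i) -> Tsimplex x -> Tsimplex y -> (0 < n)%N ->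
  \prod_(pk <- coord_pairs kappa x y) (1 + (2 * n)%:R ^+ 2 * pk.1) `^ (- pk.2) <=
  (2 * (1 + (2 * n)%:R ^+ 2 * (1 - cosrho x y))) `^ (kabs kappa / 2) *
  (n%:R `^ (- 2 * kabs kappa) * (Num.sqrt (Wkappa kappa n x) * Num.sqrt (Wkappa kappa n y))^-1).
Proof.
move=> k0 Tx Ty n0; rewrite big_map /=.
set Q := 2 * _; have Q1 : forall i,
    1 + (2 * n)%:R ^+ 2 * (Num.sqrt (xext x i) - Num.sqrt (xext y i)) ^+ 2 <= Q.
  move=> i; have : (Num.sqrt (xext x i) - Num.sqrt (xext y i)) ^+ 2 <= 2 * (1 - cosrho x y).
    rewrite -sum_sqrt_diff// (bigD1 i)//= lerDl sumr_ge0// => j _; exact: sqr_ge0.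
  move=> h; have := ler_wpM2l (sqr_ge0 (2 * n)%:R) h; rewrite /Q; lra.
have Q0 : 0 < Q.
  apply: lt_le_trans (Q1 ord0); rewrite ltr_pwDl// mulr_ge0 ?sqr_ge0//.
have nR : 0 < n%:R :> R by rewrite ltr0n.
have -> : kabs kappa / 2 = \sum_i (kappa i / 2) by rewrite -mulr_suml.
have -> : -2 * kabs kappa = \sum_i (-2 * kappa i) by rewrite -mulr_sumr.
rewrite /Wkappa -!sqrtr_prod; try by move=> i; exact: powR_ge0.
rewrite -!powR_sum// -big_split/= -prodfV -!big_split/=.
apply: ler_prod => i _; rewrite powR_ge0 /=.
by apply: powR_geom_mean; rewrite ?xext_ge0.
Qed.

End Weights.

(** * The kernel estimate *)

Theorem theorem7p1 (R : realType) (a : R -> R) (d : nat) (sigma kabs0 : R) :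
  admissible a -> (0 < d)%N -> 0 < sigma ->
  exists c : R,
    forall (kappa : 'I_d.+1 -> R) (P : nat -> d.-tuple R -> d.-tuple R -> R),
      (forall i, 0 <= kappa i) -> kabs kappa = kabs0 ->
      proj_kernel kappa P ->
      forall (n : nat) (x y : d.-tuple R),
        (1 <= n)%N -> Tsimplex x -> Tsimplex y ->
        `|Lker a P n x y| <=
          c * n%:R ^+ d / (Num.sqrt (Wkappa kappa n x) * Num.sqrt (Wkappa kappa n y))
            * (1 + n%:R * rho x y) `^ (- sigma).
Proof.
(* A negative [kabs0] is the sum of no admissible [kappa]. *)
move=> adm d0 s0; have [k0|kn] := leP 0 kabs0; last first.
  exists 0 => kappa P kappa0 kE; move: kn.
  by rewrite -kE ltNge sumr_ge0// => i _; exact: kappa0.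
(* This is [half_sum kappa - 1]; its nonnegativity comes from d >= 1. *)
pose lam := kabs0 + (d.+1)%:R / 2 - 1.
have lam0 : 0 <= lam.
  have : 2 <= d.+1%:R :> R by rewrite ler_nat.
  by rewrite /lam; lra.
have s2 : 0 <= kabs0 / 2 + sigma / 2 by lra.
have k2 : 0 <= 2 * kabs0 by lra.
(* [K] powers are spent on each of the d+1 averages. The remaining [K0] cover Q^(kabs0/2), lost in
   the comparison with [Wkappa], and Q^(sigma/2), which gives the decay in [rho]. *)
pose K := Num.bound (2 * kabs0); pose K0 := Num.bound (kabs0 / 2 + sigma / 2).
have hK : 2 * kabs0 < K%:R := archi_boundP k2.
have hK0 : kabs0 / 2 + sigma / 2 < K0%:R := archi_boundP s2.
have Kp : (0 < K)%N by rewrite -(ltr0n R) (le_lt_trans k2).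
have [C C_ge0 hC] := iter_average_decay k0 Kp (ltW hK).
have [M M_ge0 hM] := geg_ker_decay (K0 + K * d.+1) lam0 adm.
(* A lower bound for [simplex_mass] independent of [kappa]: each kappa_i is at most [kabs0], and
   Dirichlet integrals decrease in their parameters. *)
pose c0 := dirichlet d (fun=> kabs0 + 2^-1) (kabs0 + 2^-1).
have hh : 0 < kabs0 + 2^-1 by rewrite ltr_wpDl.
have c0_gt0 : 0 < c0 by apply: dirichlet_gt0.
pose Cr := 2 + (cos 1 ^+ 2)^-1 : R.
(* The powers of 2 come from (2n)^(1 + 2 lam) = (2n)^(2 kabs0 + d) and from the factor 2 in (2
   Q)^(kabs0/2). *)
pose A := C ^+ d.+1 * M * 2 `^ (2 * kabs0 + d%:R) * 2 `^ (kabs0 / 2).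
exists (A * Cr `^ (sigma / 2) / c0) => kappa P kappa0 kE hP n x y n0 Tx Ty.
have kle i : kappa i <= kabs0 by rewrite -kE /kabs (bigD1 i)//= lerDl sumr_ge0.
have C0_ge : c0 <= simplex_mass kappa.
  by apply: dirichlet_le => *; rewrite ?ltr_wpDl// lerD2r.
have LamE : half_sum kappa - 1 = lam.
  rewrite /lam -kE /half_sum big_split /= sumr_const card_ord -[_ *+ _]mulr_natl.
  by rewrite -/(kabs kappa).
have /andP[u0 u1] := cosrho_bounds Tx Ty.
set u := cosrho x y in u0 u1.
set H : R := (2 * n)%:R ^+ 2.
have H0 : 0 <= H by rewrite exprn_ge0.
set Q := 1 + H * (1 - u).
have Q1 : 1 <= Q by rewrite lerDl mulr_ge0// subr_ge0.
have Q0 : 0 < Q by rewrite (lt_le_trans ltr01).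
have nR : 0 < n%:R :> R by rewrite ltr0n.
set W := Num.sqrt _ * Num.sqrt _.
have W0 : 0 <= W by rewrite mulr_ge0 ?sqrtr_ge0.
have szl : size (coord_pairs kappa x y) = d.+1.
  by rewrite size_map -sum1_size sum1_card card_ord.
have sumE : \sum_(pk <- coord_pairs kappa x y) pk.1 = u by rewrite big_map.
have mainbound : c0 * `|Lker a P n x y| * Q ^+ K0 <=
    A * n%:R ^+ d / W * Q `^ (kabs0 / 2).
  (* At the evaluation point 0 the quantity 1 - u - sum p of [iter_average_decay] is 1 - cos
     rho(x,y). *)
  have := hC (coord_pairs kappa x y) K0 H (M * ((2 * n)%:R * (2 * n)%:R `^ (2 * lam)))
    (geg_ker lam a (2 * n)) H0 _ _ _ 0.
  rewrite sumE normr0 subr0 szl -LamE -(@Lker_iter_average _ _ _ _ _ a P n)//.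
  have n2 : (0 < 2 * n)%N by rewrite muln_gt0.
  have hB : 0 <= M * ((2 * n)%:R * (2 * n)%:R `^ (2 * (half_sum kappa - 1))).
    by rewrite !mulr_ge0// powR_ge0.
  have hc pk : pk \in coord_pairs kappa x y -> 0 <= pk.1 /\ 0 <= pk.2 <= kabs0.
    by move=> /mapP[i _ ->]; rewrite sqrtr_ge0 kappa0 kle.
  move=> /(_ hB hc); rewrite LamE subr_ge0 => /(_ (fun z => hM _ z n2) u1) h.
  apply: le_trans (le_trans _ h) _.
    rewrite normrM (gtr0_norm (simplex_mass_gt0 kappa0)).
    by rewrite ler_wpM2r ?exprn_ge0 ?(ltW Q0)// ler_wpM2r.
  apply: le_trans (ler_wpM2l _ (prod_coord_pairs_le kappa0 Tx Ty n0)) _.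
    by rewrite mulr_ge0 ?exprn_ge0// -LamE.
  have Qw := ltW Q0; rewrite -/u -/H -/Q kE -/W powRM//.
  have -> : (2 * n)%:R * (2 * n)%:R `^ (2 * lam) =
      2 `^ (2 * kabs0 + d%:R) * (n%:R `^ (2 * kabs0) * n%:R ^+ d) :> R.
    have N0 : 0 < (2 * n)%:R :> R by rewrite ltr0n.
    rewrite -{1}[(2 * n)%:R]powRr1 ?ltW// -powRD ?(gt_eqF N0) ?implybT//.
    rewrite -[n%:R ^+ d]powR_mulrn ?ltW// -powRD ?(gt_eqF nR) ?implybT//.
    have -> : 1 + 2 * lam = 2 * kabs0 + d%:R.
      by rewrite /lam -natr1; field.
    by rewrite natrM powRM// ltW.
  rewrite mulNr powRN; have := powR_gt0 (2 * kabs0) nR => p0.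
  rewrite le_eqVlt /A; move: (W^-1) => w; apply/orP; left; apply/eqP.
  by field; rewrite gt_eqF.
have rhoE : rho x y = acos u by [].
have rho0 : 0 <= 1 + n%:R * rho x y.
  by rewrite rhoE addr_ge0// mulr_ge0// acos_ge0// u1 andbT; lra.
have u01 : 0 <= u <= 1 by rewrite u0.
have rb : (1 + n%:R * rho x y) `^ sigma <= Cr `^ (sigma / 2) * Q `^ (sigma / 2).
  have Cr0 : 0 <= Cr by rewrite addr_ge0// invr_ge0 sqr_ge0.
  rewrite -powRM ?(ltW Q0)//.
  have -> : (1 + n%:R * rho x y) `^ sigma = ((1 + n%:R * rho x y) ^+ 2) `^ (sigma / 2).
    by rewrite -powR_mulrn// -powRrM; congr (_ `^ _); field.
  apply: ge0_ler_powR; rewrite ?nnegrE ?sqr_ge0 ?mulr_ge0 ?(ltW Q0) ?divr_ge0 ?(ltW s0)//.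
  exact: one_plus_acos_sq_le.
have rp : 0 < (1 + n%:R * rho x y) `^ sigma.
  by apply: powR_gt0; rewrite ltr_pwDl// mulr_ge0// rhoE acos_ge0// u1 andbT; lra.
have Q2 : 0 < Q `^ (kabs0 / 2) by exact: powR_gt0.
have Q3 : 0 < Q `^ (sigma / 2) by exact: powR_gt0.
have hQ : Q `^ (kabs0 / 2) * Q `^ (sigma / 2) <= Q ^+ K0.
  rewrite -powRD ?(gt_eqF Q0) ?implybT// -powR_mulrn ?(ltW Q0)//.
  by apply: ler_powR => //; exact: ltW.
rewrite powRN ler_pdivlMr//.
apply: le_trans (ler_wpM2l (normr_ge0 _) rb) _.
have L0 : 0 <= c0 * `|Lker a P n x y| by rewrite mulr_ge0// ltW.
have := le_trans (ler_wpM2l L0 hQ) mainbound.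
have -> : c0 * `|Lker a P n x y| * (Q `^ (kabs0 / 2) * Q `^ (sigma / 2)) =
  c0 * `|Lker a P n x y| * Q `^ (sigma / 2) * Q `^ (kabs0 / 2) by ring.
rewrite ler_pM2r// => h.
have Cr0 : 0 <= Cr `^ (sigma / 2) by exact: powR_ge0.
have -> : A * Cr `^ (sigma / 2) / c0 * n%:R ^+ d / W =
  Cr `^ (sigma / 2) / c0 * (A * n%:R ^+ d / W) by ring.
have -> : `|Lker a P n x y| * (Cr `^ (sigma / 2) * Q `^ (sigma / 2)) =
  Cr `^ (sigma / 2) / c0 * (c0 * `|Lker a P n x y| * Q `^ (sigma / 2)).
  by field; rewrite gt_eqF.
by rewrite ler_wpM2l// divr_ge0// ltW.
Qed.
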